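(* Let $\Sigma=\{u\in\mathbb R^n:\langle\mathbf n,u\rangle=0\}$ with $|\mathbf n|=1$, $U^\pm=\{u:\pm\langle\mathbf n,u\rangle>0\}$, and let $f=f^\pm$ on $U^\pm$, where $f^\pm$ are vector fields smooth on $\overline{U^\pm}=U^\pm\cup\Sigma$. Let $\gamma:[-T,T]\to\mathbb R^n$ be a trajectory of $u'=f(u)$ crossing $\Sigma$ from $U^-$ to $U^+$ at $\gamma(0)=w\in\Sigma$ (with $\gamma(\xi)\in U^-$ for $\xi<0$ and $\gamma(\xi)\in U^+$ for $\xi>0$), such that $\langle f^\pm(w),\mathbf n\rangle>0$. Let $f^\mu$ ($\mu>0$ small) be the smoothing of $f$ and $\gamma^\mu:[-T,T]\to\mathbb R^n$ the solution of $(\gamma^\mu)'=f^\mu(\gamma^\mu)$, $\gamma^\mu(0)=w$. Fix $\lambda\in\mathbb C$ and $v^-,z^0\in\mathbb C^n$, and let $(v^\mu,z^\mu)$ be the solution on $[-T,T]$ of $$v'=\partial f^\mu(\gamma^\mu(\xi))v+z,\qquad z'=\lambda v,\qquad v^\mu(0)=v^-,\quad z^\mu(0)=z^0.$$ Then, as $\mu\to0$, $z^\mu(\xi)$ converges uniformly on $[-T,T]$ to a function $z(\xi)$, while $v^\mu(\xi)$ is uniformly bounded and converges pointwise on $[-T,T]\setminus\{0\}$ to a function $v(\xi)$. The functions $v,z$ are smooth on $[-T,0]$ and on $[0,T]$ (with one-sided values at $0$) and are the solutions of the initial value problems $$v'=\partial f^-(\gamma(\xi))v+z,\quad z'=\lambda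 v,\quad -T\le\xi\le0,\quad v(-0)=v^-,\ z(-0)=z^0,$$ $$v'=\partial f^+(\gamma(\xi))v+z,\quad z'=\lambda v,\quad 0\le\xi\le T,\quad v(+0)=v^+,\ z(+0)=z^0,$$ where, with $\hat f^\pm=f^\pm(w)$ and $\Delta f=\hat f^+-\hat f^-$, $$v^+=Sv^-:=v^-+\Delta f\,\frac{\langle v^-,\mathbf n\rangle}{\langle\hat f^-,\mathbf n\rangle}.$$
   Context: $\partial f$ denotes the Jacobi matrix of $f$. Smoothing: $\phi\in C^\infty(\mathbb R)$ is a fixed function with $\phi(y)=1$ for $y\ge1$, $\phi(y)=0$ for $y\le0$, and $\phi'(y)>0$ for $0<y<1$; the smoothed field is $$f^\mu(u)=\phi(\langle\mathbf n,u\rangle/\mu)\,f^+(u)+\big(1-\phi(\langle\mathbf n,u\rangle/\mu)\big)f^-(u),$$ where in the layer $0<\langle\mathbf n,u\rangle<\mu$ the field $f^-$ is understood as smoothly extended beyond $\Sigma$. Thus $f^\mu=f$ outside the layer. *)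

(* Defs.v *)
From HB Require Import structures.
From mathcomp Require Import all_boot all_order all_algebra.
From mathcomp Require Import all_classical all_reals all_analysis.
From mathcomp Require Import complex.
Set Implicit Arguments.
Unset Strict Implicit.
Unset Printing Implicit Defensive.
Import Order.TTheory GRing.Theory Num.Theory.
Import numFieldNormedType.Exports.
Local Open Scope classical_set_scope.
Local Open Scope ring_scope.

(* [complex R] packed as a numFieldType, so that it and the spaces
   ['rV[Cplx R]_n] carry the norm topology. *)
Definition Cplx (R : realType) : numFieldType := R[i]%C.

Definition ofreal (R : realType) (x : R) : Cplx R := x%:C%C.

Definition ofrealmx (R : realType) (m n : nat) (M : 'M[R]_(m, n)) :
  'M[Cplx R]_(m, n) := map_mx (@ofreal R) M.

(* Bilinear also over [Cplx R]: it is only used there with a real right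
   argument, so that no conjugation is needed. *)
Definition dot (K : pzRingType) (n : nat) (u v : 'rV[K]_n) : K :=
  \sum_(i < n) u 0 i * v 0 i.

(* The library norm on ['rV_n] is the maximum norm, hence this definition. *)
Definition eucl_norm (R : realType) (n : nat) (u : 'rV[R]_n) : R :=
  Num.sqrt (dot u u).

Section SwitchingSurface.
Context {R : realType} {n : nat} (nn : 'rV[R]_n).

Definition Sigma : set 'rV[R]_n := [set u | dot nn u = 0].
Definition Uplus : set 'rV[R]_n := [set u | 0 < dot nn u].
Definition Uminus : set 'rV[R]_n := [set u | dot nn u < 0].

(* The value on Sigma is irrelevant: trajectories are only required to satisfy
   the equation off Sigma. *)
Definition piecewise (fplus fminus : 'rV[R]_n -> 'rV[R]_n) (u : 'rV[R]_n) :
  'rV[R]_n := if 0 < dot nn u then fplus u else fminus u.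

Definition smoothed (phi : R -> R) (fplus fminus : 'rV[R]_n -> 'rV[R]_n)
    (mu : R) (u : 'rV[R]_n) : 'rV[R]_n :=
  phi (dot nn u / mu) *: fplus u + (1 - phi (dot nn u / mu)) *: fminus u.

End SwitchingSurface.

(* [Ck k D g] for an open set [D]. *)
Fixpoint Ck (R : realType) (V W : normedModType R) (k : nat) (D : set V)
    (g : V -> W) : Prop :=
  match k with
  | 0%N => forall u, D u -> {for u, continuous g}
  | k'.+1 => (forall u, D u -> differentiable g u) /\
             (forall e : V, Ck k' D (fun u => 'D_e g u))
  end.

(* Smoothness on a set that need not be open: [g] itself is a smooth extension
   to an open neighbourhood of [A]. On a closed half-space, the values and the
   derivatives of [g] up to the boundary do not depend on the extension. *)
Definition smooth_on (R : realType) (V W : normedModType R) (A : set V)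
    (g : V -> W) : Prop :=
  exists D : set V, [/\ open D, A `<=` D & forall k, Ck k D g].

(* Derivative of [g] at [x] along [A]; it is one-sided when [A] is an interval
   and [x] one of its endpoints. *)
Definition has_deriv_in (R : realType) (n : nat) (A : set R)
    (g : R -> 'rV[R]_n) (x : R) (l : 'rV[R]_n) : Prop :=
  (fun y => (y - x)^-1 *: (g y - g x)) @ within A x^' --> l.

(* The same for a complex-valued function of a real variable. *)
Definition has_cderiv_in (R : realType) (n : nat) (A : set R)
    (g : R -> 'rV[Cplx R]_n) (x : R) (l : 'rV[Cplx R]_n) : Prop :=
  (fun y => ofreal (y - x)^-1 *: (g y - g x)) @ within A x^' --> l.

(* C^infinity on an interval [A], with one-sided derivatives at endpoints:
   [h k] is the derivative of order [k]. *)
Definition csmooth_in (R : realType) (n : nat) (A : set R)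
    (g : R -> 'rV[Cplx R]_n) : Prop :=
  exists h : nat -> R -> 'rV[Cplx R]_n,
    (forall x, A x -> h 0%N x = g x) /\
    (forall k x, A x -> has_cderiv_in A (h k) x (h k.+1 x)).

Definition solves_on (R : realType) (n : nat) (A : set R)
    (F : 'rV[R]_n -> 'rV[R]_n) (gamma : R -> 'rV[R]_n) : Prop :=
  forall xi, A xi -> has_deriv_in A gamma xi (F (gamma xi)).

(* v' = (dF)(gamma) v + z, z' = lambda v. Vectors are rows, and the library's
   Jacobian ['J F u] acts on the right: ['d F u h = h *m 'J F u]. *)
Definition solves_lin_on (R : realType) (n : nat) (A : set R)
    (F : 'rV[R]_n -> 'rV[R]_n) (gamma : R -> 'rV[R]_n) (lambda : Cplx R)
    (v z : R -> 'rV[Cplx R]_n) : Prop :=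
  forall xi, A xi ->
    has_cderiv_in A v xi (v xi *m ofrealmx ('J F (gamma xi)) + z xi) /\
    has_cderiv_in A z xi (lambda *: v xi).

Definition smooth_ivp_solution (R : realType) (n : nat) (A : set R)
    (F : 'rV[R]_n -> 'rV[R]_n) (gamma : R -> 'rV[R]_n) (lambda : Cplx R)
    (v0 z0 : 'rV[Cplx R]_n) (v z : R -> 'rV[Cplx R]_n) : Prop :=
  [/\ csmooth_in A v, csmooth_in A z, solves_lin_on A F gamma lambda v z,
      v 0 = v0 & z 0 = z0].

Definition jumpS (R : realType) (n : nat) (nn fhatp fhatm : 'rV[R]_n)
    (v : 'rV[Cplx R]_n) : 'rV[Cplx R]_n :=
  v + (dot v (ofrealmx nn) / ofreal (dot fhatm nn)) *: ofrealmx (fhatp - fhatm).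

(* Main.v *)
Require Import Defs.
From HB Require Import structures.
From mathcomp Require Import all_boot all_order all_algebra.
From mathcomp Require Import all_classical all_reals all_analysis.
From mathcomp Require Import complex.
From mathcomp Require Import ring lra.
Import Order.TTheory GRing.Theory Num.Theory.
Import numFieldNormedType.Exports.
Local Open Scope classical_set_scope.
Local Open Scope ring_scope.
Set Implicit Arguments.
Unset Strict Implicit.
Unset Printing Implicit Defensive.

(** A solution starting at w stays, during a fixed time tau, in a ball around w
    where <n, f+> and <n, f-> are at least c > 0, so it leaves the layer before
    the time s = mu / c. After s the smoothed field is f+, and Gronwall's lemma
    keeps the solution O(mu)-close to gamma; before time 0 it equals gamma by
    uniqueness.

    In the layer the linearized equation contains the term
    mu^-1 phi' <n, v> (f+ - f-), of size 1 / mu. With p the velocity of the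
    solution, q = f+ - f- and Phi = phi(<n, .> / mu) along it, the quantities
    al = <n, v> / <n, p> and x = v - Phi al q satisfy together with z a linear
    system with bounded coefficients, hence change by O(mu) in the layer; as Phi
    goes from 0 to 1, v jumps from x to x + al q = S v.

    After s the solutions are a Cauchy family as mu -> 0: their difference
    satisfies a linear equation with an O(mu) perturbation. Their limit is the
    solution of the limiting problem, so that no existence theorem for linear
    equations is used. *)

(** * Derivatives along a set *)

(** The choice of al and x comes from the fact that the velocity p itself solves the linearized
    equation with z = 0. With kappa = mu^-1 phi', both <n, v> and <n, p> satisfy y' = kappa <n, q> y
    up to terms without kappa, so the large factor cancels in their quotient al. Since Phi' = kappa
    <n, p>, the derivative of Phi al q contains kappa <n, v> q, which is exactly the large term of
    v'. No bound on phi' enters the estimates. The quotient needs <n, p> to stay away from 0; this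
    holds because p is a convex combination of f+ and f-, both transversal to Sigma near w.

    All errors are O(mu) with constants chosen before mu, and this rate is what yields Cauchy
    families. The vectors v and z are real matrices with k rows: the Jacobian multiplies on the
    right, the scalar of the equation z' = lambda v on the left as a k x k matrix, and k = 2 covers
    complex lambda. *)

Lemma mx_entry_le (R : realType) (m n : nat) (M : 'M[R]_(m, n)) i j :
  `|M i j| <= `|M|.
Proof.
by rewrite [leRHS]/Num.Def.normr/= mx_normrE; exact: (le_bigmax _ _ (i, j)).
Qed.

Lemma mx_norm_le (R : realType) (m n : nat) (M : 'M[R]_(m, n)) (c : R) :
  0 <= c -> (forall i j, `|M i j| <= c) -> `|M| <= c.
Proof.
move=> c0 h; rewrite [leLHS]/Num.Def.normr/= mx_normrE.
by apply: bigmax_le => // -[i j] _; exact: h.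
Qed.

Lemma mulmx_norm (R : realType) (m n p : nat) (A : 'M[R]_(m, n))
  (B : 'M[R]_(n, p)) : `|A *m B| <= n%:R * `|A| * `|B|.
Proof.
apply: mx_norm_le => [|i j]; first by rewrite !mulr_ge0.
rewrite mxE; apply: (le_trans (ler_norm_sum _ _ _)).
apply: (@le_trans _ _ (\sum_(k < n) `|A| * `|B|)).
  by apply: ler_sum => k _; rewrite normrM ler_pM// mx_entry_le.
by rewrite sumr_const card_ord -[_ *+ n]mulr_natl -!mulrA.
Qed.

(* [has_deriv_in] without the division, for any normed module: see [hderE]. *)
Definition hder (R : realType) (W : normedModType R) (A : set R) (g : R -> W)
    (x : R) (l : W) : Prop :=
  forall e : R, 0 < e -> exists2 d : R, 0 < d & forall y, A y -> `|y - x| < d ->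
    `|g y - g x - (y - x) *: l| <= e * `|y - x|.

Section Hder.
Variables (R : realType).
Implicit Types (A B : set R) (x : R).

Lemma hderE (W : normedModType R) A (g : R -> W) x l :
  (fun y => (y - x)^-1 *: (g y - g x)) @ within A x^' --> l <-> hder A g x l.
Proof.
split=> [/cvgrPdist_le H e e0|H].
  have := H e e0; rewrite near_withinE /dnbhs near_withinE.
  move=> /nbhs_ballP[d /= d0 Hd]; exists d => // y Ay yx.
  have [->|ynx] := eqVneq y x; first by rewrite !subrr scale0r subrr !normr0 mulr0.
  have yx0 : y - x != 0 by rewrite subr_eq0.
  have := Hd y; rewrite /ball/= distrC => /(_ yx ynx Ay) Hy.
  have -> : g y - g x - (y - x) *: l =
      - ((y - x) *: (l - (y - x)^-1 *: (g y - g x))).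
    by rewrite scalerBr scalerA divff// scale1r opprB.
  by rewrite normrN normrZ mulrC ler_wpM2r.
apply/cvgrPdist_le => e e0; have [d d0 Hd] := H e e0.
rewrite near_withinE /dnbhs near_withinE.
apply/nbhs_ballP; exists d => //= y; rewrite /ball/= distrC => yx ynx Ay.
have yx0 : y - x != 0 by rewrite subr_eq0.
have := Hd y Ay yx.
have -> : g y - g x - (y - x) *: l =
    - ((y - x) *: (l - (y - x)^-1 *: (g y - g x))).
  by rewrite scalerBr scalerA divff// scale1r opprB.
by rewrite normrN normrZ mulrC ler_pM2r// normr_gt0.
Qed.

Lemma hder_sub (W : normedModType R) A B (g : R -> W) x l :
  B `<=` A -> hder A g x l -> hder B g x l.
Proof.
by move=> BA H e /H[d d0 Hd]; exists d => // y /BA; exact: Hd.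
Qed.

Lemma hder_ext (W : normedModType R) A (g h : R -> W) x l :
  A x -> (forall y, A y -> g y = h y) -> hder A g x l -> hder A h x l.
Proof.
move=> Ax gh H e /H[d d0 Hd]; exists d => // y Ay yx.
by rewrite -!gh//; exact: Hd.
Qed.

Lemma hder_cts (W : normedModType R) A (g : R -> W) x l :
  hder A g x l -> forall e : R, 0 < e -> exists2 d : R, 0 < d &
    forall y, A y -> `|y - x| < d -> `|g y - g x| < e.
Proof.
move=> /(_ 1 ltr01)[d d0 Hd] e e0.
have L0 : 0 < 1 + `|l| by rewrite ltr_wpDr.
exists (Num.min d (e / (1 + `|l|))); first by rewrite lt_min d0 divr_gt0.
move=> y Ay; rewrite lt_min => /andP[yd ye].
rewrite -(subrK ((y - x) *: l) (g y - g x)).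
apply: (le_lt_trans (ler_normD _ _)).
apply: (@le_lt_trans _ _ ((1 + `|l|) * `|y - x|)); last first.
  by rewrite mulrC -ltr_pdivlMr.
by rewrite mulrDl lerD// ?Hd// normrZ mulrC.
Qed.

Lemma hder_within_continuous (W : normedModType R) A (g g' : R -> W) :
  (forall x, A x -> hder A g x (g' x)) -> {within A, continuous g}.
Proof.
move=> H; apply/subspace_continuousP => x Ax; apply/cvgrPdist_lt => e e0.
have [d d0 Hd] := hder_cts (H x Ax) e0.
rewrite near_withinE; apply/nbhs_ballP; exists d => //= y.
by rewrite /ball/= distrC => yx Ay; rewrite distrC; exact: Hd.
Qed.

Lemma hder_cst (W : normedModType R) A (c : W) x : hder A (fun=> c) x 0.
Proof.
move=> e e0; exists 1 => // y _ _.
by rewrite subrr scaler0 subrr normr0 mulr_ge0// ltW.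
Qed.

Lemma hder_id A x : hder A (fun t => t : R^o) x 1.
Proof.
move=> e e0; exists 1 => // y _ _.
by rewrite /GRing.scale/= mulr1 subrr normr0 mulr_ge0// ltW.
Qed.

Lemma hderD (W : normedModType R) A (g h : R -> W) x l m :
  hder A g x l -> hder A h x m -> hder A (fun t => g t + h t) x (l + m).
Proof.
move=> Hg Hh e e0; have e20 : 0 < e / 2 by rewrite divr_gt0.
have [d d0 Hd] := Hg _ e20; have [d' d'0 Hd'] := Hh _ e20.
exists (Num.min d d'); first by rewrite lt_min d0.
move=> y Ay; rewrite lt_min => /andP[yd yd'].
have -> : g y + h y - (g x + h x) - (y - x) *: (l + m) =
  (g y - g x - (y - x) *: l) + (h y - h x - (y - x) *: m).
  by rewrite scalerDr !opprD (addrACA (g y)) [LHS]addrACA.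
apply: (le_trans (ler_normD _ _)); rewrite [e]splitr mulrDl.
by apply: lerD; [exact: Hd|exact: Hd'].
Qed.

Lemma hder_lip (W : normedModType R) A (g : R -> W) x l :
  hder A g x l -> exists2 d : R, 0 < d & forall y, A y -> `|y - x| < d ->
    `|g y - g x| <= (1 + `|l|) * `|y - x|.
Proof.
move=> /(_ 1 ltr01)[d d0 Hd]; exists d => // y Ay yd.
rewrite -(subrK ((y - x) *: l) (g y - g x)).
apply: (le_trans (ler_normD _ _)).
by rewrite mulrDl lerD// ?Hd// normrZ mulrC.
Qed.

(** Linearity and the bound are explicit hypotheses on a bare function, so that the same lemma
    serves scalings, matrix entries, submatrices and scalar products. *)
Lemma hder_lin (V W : normedModType R) (f : V -> W) (C : R) A g x l :
  0 <= C -> (forall a u v, f (a *: u + v) = a *: f u + f v) ->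
  (forall u, `|f u| <= C * `|u|) ->
  hder A g x l -> hder A (fun t => f (g t)) x (f l).
Proof.
move=> C0 fl fC H e e0.
have C10 : 0 < C + 1 by rewrite ltr_wpDl.
have [d d0 Hd] := H (e / (C + 1)) (divr_gt0 e0 C10).
exists d => // y Ay yx.
have fB u v : f (u - v) = f u - f v.
  by rewrite addrC -scaleN1r fl scaleN1r addrC.
have f0 : f 0 = 0 by have := fB 0 0; rewrite !subrr.
have fZ a u : f (a *: u) = a *: f u by rewrite -[_ *: u]addr0 fl f0 addr0.
rewrite -fZ -!fB.
apply: (le_trans (fC _)).
apply: (@le_trans _ _ ((C + 1) * (e / (C + 1) * `|y - x|))); last first.
  by rewrite mulrA mulrCA divff ?mulr1// lt0r_neq0.
by apply: ler_pM => //; [rewrite lerDl|exact: Hd].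
Qed.

Lemma hderZ (W : normedModType R) A (g : R -> W) x l (a : R) :
  hder A g x l -> hder A (fun t => a *: g t) x (a *: l).
Proof.
apply: (@hder_lin _ _ _ `|a|) => // [b u v|u]; last by rewrite normrZ.
by rewrite scalerDr !scalerA mulrC.
Qed.

Lemma hderN (W : normedModType R) A (g : R -> W) x l :
  hder A g x l -> hder A (fun t => - g t) x (- l).
Proof.
move=> /(hderZ (-1)); rewrite scaleN1r.
by rewrite (_ : (fun t => -1 *: g t) = (fun t => - g t))//; apply/funext => t;
  rewrite scaleN1r.
Qed.

Lemma hderB (W : normedModType R) A (g h : R -> W) x l m :
  hder A g x l -> hder A h x m -> hder A (fun t => g t - h t) x (l - m).
Proof. by move=> Hg /hderN; exact: hderD. Qed.

Lemma hder_bilin (U V W : normedModType R) (b : U -> V -> W) (C : R) A g h x l m :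
  0 <= C ->
  (forall a u v w, b (a *: u + v) w = a *: b u w + b v w) ->
  (forall a u v w, b w (a *: u + v) = a *: b w u + b w v) ->
  (forall u v, `|b u v| <= C * `|u| * `|v|) ->
  hder A g x l -> hder A h x m ->
  hder A (fun t => b (g t) (h t)) x (b l (h x) + b (g x) m).
Proof.
move=> C0 bl br bC Hg Hh e e0.
have blB u v w : b (u - v) w = b u w - b v w.
  by rewrite addrC -scaleN1r bl scaleN1r addrC.
have brB u v w : b w (u - v) = b w u - b w v.
  by rewrite addrC -scaleN1r br scaleN1r addrC.
have bl0 w : b 0 w = 0 by have := blB 0 0 w; rewrite !subrr.
have br0 w : b w 0 = 0 by have := brB 0 0 w; rewrite !subrr.
have blZ a u w : b (a *: u) w = a *: b u w by rewrite -[_ *: u]addr0 bl bl0 addr0.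
have brZ a u w : b w (a *: u) = a *: b w u by rewrite -[_ *: u]addr0 br br0 addr0.
(* The error splits into the remainder of [g] paired with [h x], [g x] paired with the remainder of
   [h], and the pairing of the two increments. Each is at most (1 + C) L (e / K) |y - x|, with L the
   last factor of [K]; hence the 3. *)
pose K := 3 * (1 + C) * (1 + `|h x| + `|g x| + `|l|).
have L0 : 0 < 1 + `|h x| + `|g x| + `|l| by rewrite !ltr_wpDr.
have C10 : 0 < 1 + C by rewrite ltr_wpDr.
have K0 : 0 < K by rewrite !mulr_gt0.
have eK : 0 < e / K by rewrite divr_gt0.
have [d1 d10 Hd1] := Hg _ eK; have [d2 d20 Hd2] := Hh _ eK.
have [d3 d30 Hd3] := hder_lip Hg; have [d4 d40 Hd4] := hder_cts Hh eK.
exists (Num.min (Num.min d1 d2) (Num.min d3 d4)); first by rewrite !lt_min d10 d20 d30.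
move=> y Ay; rewrite !lt_min => /andP[/andP[y1 y2] /andP[y3 y4]].
have {Hd1} H1 := Hd1 y Ay y1; have {Hd2} H2 := Hd2 y Ay y2.
have {Hd3} H3 := Hd3 y Ay y3; have {Hd4} H4 := ltW (Hd4 y Ay y4).
have -> : b (g y) (h y) - b (g x) (h x) - (y - x) *: (b l (h x) + b (g x) m) =
  b (g y - g x - (y - x) *: l) (h x) + b (g x) (h y - h x - (y - x) *: m) +
  b (g y - g x) (h y - h x).
  rewrite !(blB, brB, blZ, brZ) scalerDr.
  move: (b (g y) (h y)) (b (g x) (h x)) (b (g x) (h y)) (b (g y) (h x)) => p q r s.
  move: (_ *: b l _) (_ *: b _ m) => k k'.
  have -> : p - q = (s - q) + (r - q) + (p - s - (r - q)).
    by rewrite [RHS]addrC (addrC (s - q)) addrA subrK subrKA.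
  by rewrite (opprD k) [X in _ = X + _]addrACA [RHS]addrAC.
set L := 1 + `|h x| + `|g x| + `|l| in L0 K K0 eK H1 H2 H4 *.
set E := e / K * `|y - x| in H1 H2 *.
have E0 : 0 <= E by rewrite mulr_ge0// ltW.
have gx0 := normr_ge0 (g x); have hx0 := normr_ge0 (h x); have l0 := normr_ge0 l.
have -> : e * `|y - x| = 3 * ((1 + C) * (L * E)).
  transitivity (K * E); last by rewrite /K; ring.
  by rewrite /E mulrA (mulrCA K) divff ?mulr1// lt0r_neq0.
have key u v : `|u| * `|v| <= L * E -> `|b u v| <= (1 + C) * (L * E).
  move=> uv; apply: (le_trans (bC _ _)); rewrite -mulrA.
  by apply: ler_pM => //; rewrite ?mulr_ge0 ?lerDr.
have -> : 3 * ((1 + C) * (L * E)) =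
    (1 + C) * (L * E) + (1 + C) * (L * E) + (1 + C) * (L * E) by ring.
apply: (le_trans (ler_normD _ _)); apply: lerD; last first.
  apply: key; apply: (@le_trans _ _ ((1 + `|l|) * `|y - x| * (e / K))).
    by apply: ler_pM.
  rewrite -mulrA [X in _ * X]mulrC; apply: ler_wpM2r => //; rewrite /L; lra.
apply: (le_trans (ler_normD _ _)); apply: lerD; apply: key.
  by rewrite mulrC; apply: ler_pM => //; rewrite /L; lra.
by apply: ler_pM => //; rewrite /L; lra.
Qed.

Lemma hder_scale (W : normedModType R) A (f : R -> R) (g : R -> W) x (k : R) l :
  hder A (f : R -> R^o) x k -> hder A g x l ->
  hder A (fun t => f t *: g t) x (k *: g x + f x *: l).
Proof.
apply: (@hder_bilin R^o W W (fun a u => a *: u) 1) => //.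
- by move=> a u v w; rewrite scalerDl scalerA.
- by move=> a u v w; rewrite scalerDr !scalerA mulrC.
- by move=> u v; rewrite normrZ mul1r.
Qed.

Lemma hder_mulmx m n p A (f : R -> 'M[R]_(m, n)) (g : R -> 'M[R]_(n, p)) x k l :
  hder A f x k -> hder A g x l ->
  hder A (fun t => f t *m g t) x (k *m g x + f x *m l).
Proof.
apply: (@hder_bilin _ _ _ (fun u v => u *m v) n%:R) => //.
- by move=> a u v w; rewrite mulmxDl scalemxAl.
- by move=> a u v w; rewrite mulmxDr scalemxAr.
- by move=> u v; rewrite mulmx_norm.
Qed.

Lemma hder_mx m n A (f : R -> 'M[R]_(m, n)) x l :
  hder A f x l <-> forall i j, hder A (fun t => f t i j : R^o) x (l i j).
Proof.
split=> [H i j|H e e0].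
  apply: (@hder_lin _ R^o (fun M : 'M[R]_(m, n) => M i j) 1) H => //.
    by move=> a u v; rewrite !mxE.
  by move=> u; rewrite mul1r mx_entry_le.
have /choice[d Hd] : forall i : 'I_m * 'I_n, exists d : R, 0 < d /\
    forall y, A y -> `|y - x| < d ->
      `|f y i.1 i.2 - f x i.1 i.2 - (y - x) * l i.1 i.2| <= e * `|y - x|.
  by move=> i; have [d d0 Hd] := H i.1 i.2 e e0; exists d.
(* The default 1 keeps [D] positive for a matrix without entries. *)
pose D := \big[Num.min/1]_i d i.
exists D; first by apply: lt_bigmin => // i _; have [] := Hd i.
move=> y Ay yD; apply: mx_norm_le => [|i j]; first by rewrite mulr_ge0// ltW.
rewrite !mxE; have [_ H'] := Hd (i, j); apply: H' => //.
by apply: (lt_le_trans yD); rewrite /D; exact: (bigmin_le _ (i, j)).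
Qed.

Lemma hder_refl (W : normedModType R) A (g : R -> W) x l :
  hder A g (- x) l -> hder [set t | A (- t)] (fun t => g (- t)) x (- l).
Proof.
move=> H e e0; have [d d0 Hd] := H e e0; exists d => // y /= Ay yx.
have yxE : - y - (- x) = - (y - x) by rewrite opprD.
by have := Hd (- y) Ay; rewrite yxE normrN scalerN scaleNr; exact.
Qed.

Lemma hder_comp (V W : normedModType R) (F : V -> W) A (g : R -> V) x l :
  differentiable F (g x) -> hder A g x l ->
  hder A (fun t => F (g t)) x ('d F (g x) l).
Proof.
move=> dF Hg e e0.
have [k k0 Hk] := linear_lipschitz (diff_continuous dF).
have k10 : 0 < k + 1 by rewrite ltr_wpDr.
have L0 : 0 < 1 + `|l| by rewrite ltr_wpDr.
(* [e1] serves the remainder of [g] passed through the differential of [F], whose Lipschitz constant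
   is [k]; [e2] serves the remainder of [F] at an increment of size at most (1 + |l|) |y - x|. *)
have e1 : 0 < e / 2 / k by rewrite !divr_gt0.
have e2 : 0 < e / 2 / (1 + `|l|) by rewrite !divr_gt0.
have /diff_locally dFE := dF.
have : \forall h \near (0 : V), `|F (h + g x) - F (g x) - 'd F (g x) h| <=
    e / 2 / (1 + `|l|) * `|h|.
  move: dFE => /eqaddoP /(_ _ e2); apply: filterS => h.
  by rewrite !fctE /= opprD addrA.
move=> /nbhs_ballP[r /= r0 Hr].
have [d1 d10 Hd1] := Hg _ e1; have [d2 d20 Hd2] := hder_cts Hg r0.
have [d3 d30 Hd3] := hder_lip Hg.
exists (Num.min d1 (Num.min d2 d3)); first by rewrite !lt_min d10 d20.
move=> y Ay; rewrite !lt_min => /and3P[y1 y2 y3].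
have := Hr (g y - g x); rewrite -ball_normE/= sub0r normrN => /(_ (Hd2 y Ay y2)).
rewrite subrK => H1; have H2 := Hd1 y Ay y1; have H3 := Hd3 y Ay y3.
have -> : F (g y) - F (g x) - (y - x) *: 'd F (g x) l =
  (F (g y) - F (g x) - 'd F (g x) (g y - g x)) +
  'd F (g x) (g y - g x - (y - x) *: l).
  rewrite [X in _ = _ + X](_ : _ = 'd F (g x) (g y - g x) - (y - x) *: 'd F (g x) l).
    by rewrite addrA subrK.
  by rewrite [LHS]linearB linearZ.
apply: (le_trans (ler_normD _ _)); rewrite [e in leRHS]splitr mulrDl; apply: lerD.
  apply: (le_trans H1); rewrite -mulrA ler_pM2l ?divr_gt0//.
  by rewrite mulrC ler_pdivrMr// mulrC.
apply: (le_trans (Hk _)); rewrite -ler_pdivlMl//; apply: (le_trans H2).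
by rewrite mulrA (mulrC k^-1).
Qed.

Lemma hder_is_derive A (W : normedModType R) (g : R -> W) x l :
  A° x -> hder A g x l -> is_derive x 1 g l.
Proof.
move=> Ax /hderE H.
have H' : (fun h => h^-1 *: ((g \o shift x) (h *: 1) - g x)) @ 0^' --> l.
  apply/cvgrPdist_le => e e0; move/cvgrPdist_le: H => /(_ e e0).
  rewrite near_withinE /dnbhs near_withinE => /nbhs_ballP[d /= d0 Hd].
  move: Ax => /nbhs_ballP[d' /= d'0 Hd'].
  rewrite near_withinE; apply/nbhs_ballP; exists (Num.min d d') => /=.
    by rewrite lt_min d0.
  move=> h; rewrite /ball/= sub0r normrN lt_min => /andP[hd hd'] h0.
  have := Hd (h + x); rewrite /ball/= opprD addrCA subrr addr0 normrN addrK.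
  rewrite /GRing.scale/= mulr1; apply => //.
    by rewrite -subr_eq0 addrK.
  by apply: Hd'; rewrite /ball/= opprD addrCA subrr addr0 normrN.
split; first by apply/cvg_ex; exists l.
exact: cvg_lim.
Qed.

(** The first hypothesis makes [x] an accumulation point of [A]; at an isolated point every [l] is a
    derivative. *)
Lemma hder_uniq (W : normedModType R) A (g : R -> W) x l m :
  (forall d : R, 0 < d -> exists y, [/\ A y, y != x & `|y - x| < d]) ->
  hder A g x l -> hder A g x m -> l = m.
Proof.
move=> HA Hl Hm; apply/eqP; rewrite -subr_eq0 -normr_le0 leNgt; apply/negP => lm.
have [d d0 Hd] := Hl _ (divr_gt0 lm (ltr0n _ 4)).
have [d' d'0 Hd'] := Hm _ (divr_gt0 lm (ltr0n _ 4)).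
have [|y [Ay yx]] := HA (Num.min d d'); first by rewrite lt_min d0.
rewrite lt_min => /andP[yd yd'].
have y0 : 0 < `|y - x| by rewrite normr_gt0 subr_eq0.
have H1 := Hd y Ay yd; have H2 := Hd' y Ay yd'.
have : `|(y - x) *: (l - m)| <= `|l - m| / 2 * `|y - x|.
  have -> : (y - x) *: (l - m) =
    (g y - g x - (y - x) *: m) - (g y - g x - (y - x) *: l).
    by rewrite opprB [RHS]addrC subrKA scalerBr.
  apply: (le_trans (ler_normB _ _)).
  by apply: (le_trans (lerD H2 H1)); rewrite -mulrDl ler_pM2r//; lra.
rewrite normrZ mulrC ler_pM2r// => h; lra.
Qed.
End Hder.

(** * Mean value, Gronwall and first-exit arguments *)

Section Mvt.
Variable R : realType.
Implicit Types (a b t : R).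

Lemma itvccP a b t : `[a, b]%classic t <-> a <= t <= b.
Proof. by rewrite /= in_itv. Qed.

Lemma itvoo_interior a b t : a < t < b -> (`[a, b]%classic)° t.
Proof.
move=> tab; have : t \in `]a, b[ by rewrite in_itv.
move=> /near_in_itvoo; apply: filterS => y; rewrite in_itv/= => /andP[? ?].
by apply/itvccP; rewrite !ltW.
Qed.

Lemma within_ctsP (W : normedModType R) (A : set R) (g : R -> W) :
  {within A, continuous g} <-> forall x, A x -> forall e : R, 0 < e ->
    exists2 d : R, 0 < d & forall y, A y -> `|y - x| < d -> `|g y - g x| < e.
Proof.
split=> [/subspace_continuousP H x Ax e e0|H].
  have /cvgrPdist_lt/(_ e e0) := H x Ax.
  rewrite near_withinE => /nbhs_ballP[d /= d0 Hd]; exists d => // y Ay yx.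
  by rewrite distrC; apply: Hd => //; rewrite /ball/= distrC.
apply/subspace_continuousP => x Ax; apply/cvgrPdist_lt => e e0.
have [d d0 Hd] := H x Ax e e0.
rewrite near_withinE; apply/nbhs_ballP; exists d => //= y.
by rewrite /ball/= distrC => yx Ay; rewrite distrC; exact: Hd.
Qed.

Lemma mvt_le a b (g g' : R -> R) (K : R) : a <= b ->
  {within `[a, b], continuous g} ->
  (forall t, a < t < b -> hder `[a, b] (g : R -> R^o) t (g' t)) ->
  (forall t, a < t < b -> g' t <= K) -> g b - g a <= K * (b - a).
Proof.
move=> ab gc gd gK.
(* The intermediate point may be an endpoint, where nothing is known about [g']; the value [K] there
   keeps the final bound valid. *)
have [|t] := @MVT_segment R g (fun t => if a < t < b then g' t else K) a b ab _ gc.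
  move=> t; rewrite in_itv/= => tab; rewrite tab.
  by apply: (@hder_is_derive _ `[a, b]); [exact: itvoo_interior|exact: gd].
move=> _ ->; apply: ler_wpM2r; first by rewrite subr_ge0.
by case: ifPn => // /gK.
Qed.

Lemma within_cts_mx m n (A : set R) (g : R -> 'M[R]_(m, n)) i j :
  {within A, continuous g} -> {within A, continuous (fun t => g t i j : R^o)}.
Proof.
move=> /within_ctsP H; apply/within_ctsP => x Ax e e0.
have [d d0 Hd] := H x Ax e e0; exists d => // y Ay yx.
apply: le_lt_trans (Hd y Ay yx).
by have := mx_entry_le (g y - g x) i j; rewrite !mxE.
Qed.

(** With [l = 0] this gives Lipschitz bounds; with [l] the expected derivative at a point it turns
    closeness of nearby derivatives into differentiability. *)
Lemma mvt_mx m n a b (g g' : R -> 'M[R]_(m, n)) l (K : R) : a <= b ->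
  {within `[a, b], continuous g} ->
  (forall t, a < t < b -> hder `[a, b] g t (g' t)) ->
  0 <= K ->
  (forall t, a < t < b -> `|g' t - l| <= K) ->
  `|g b - g a - (b - a) *: l| <= K * (b - a).
Proof.
move=> ab gc gd K0 gK; apply: mx_norm_le => [|i j].
  by rewrite mulr_ge0// subr_ge0.
have K1 t : a < t < b -> `|g' t i j - l i j| <= K.
  move=> /gK; apply: le_trans.
  by have := mx_entry_le (g' t - l) i j; rewrite !mxE.
have gc' := @within_cts_mx _ _ _ _ i j gc.
have gd' t : a < t < b -> hder `[a, b] (fun t => g t i j : R^o) t (g' t i j).
  by move=> /gd /hder_mx.
rewrite !mxE ler_norml; apply/andP; split.
  have : - g b i j - (- g a i j) <= (K - l i j) * (b - a); last by lra.
  apply: (@mvt_le _ _ (fun t => - g t i j) (fun t => - g' t i j)) => //.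
  - apply/within_ctsP => x Ax e e0; have /within_ctsP H := gc'.
    have [d d0 Hd] := H x Ax e e0; exists d => // y Ay yx.
    by rewrite -opprD normrN; exact: Hd.
  - by move=> t /gd'; exact: hderN.
  - by move=> t /K1; rewrite ler_norml => /andP[? ?]; lra.
have : g b i j - g a i j <= (K + l i j) * (b - a); last by lra.
apply: (@mvt_le _ _ (fun t => g t i j) (fun t => g' t i j)) => //.
by move=> t /K1; rewrite ler_norml => /andP[? ?]; lra.
Qed.

Lemma hder_expR (A : set R) (C : R) x :
  hder A (fun t => expR (C * t) : R^o) x (C * expR (C * x)).
Proof.
have H : hder A (fun t => C *: t : R^o) x (C *: 1) by apply: hderZ; exact: hder_id.
have dE : differentiable (expR : R -> R^o) (C *: x).
  by apply/derivable1_diffP; exact: derivable_expR.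
have := hder_comp dE H; rewrite diff1E// derive1E.
by rewrite /GRing.scale/= mulr1 derive_val.
Qed.

(** The product [E t * expR (- C * t)] is nonincreasing. *)
Lemma gronwall_real a b (E E' : R -> R) (C : R) : a <= b ->
  (forall t, a <= t <= b -> hder `[a, b] (E : R -> R^o) t (E' t)) ->
  (forall t, a <= t <= b -> E' t <= C * E t) ->
  E b <= E a * expR (C * (b - a)).
Proof.
move=> ab Ed EC.
have Hd t : a <= t <= b -> hder `[a, b] (fun t => E t * expR (- C * t) : R^o) t
    (E' t * expR (- C * t) + E t * (- C * expR (- C * t))).
  by move=> tab; apply: (@hder_scale _ R^o); [exact: Ed|exact: hder_expR].
have : E b * expR (- C * b) - E a * expR (- C * a) <= 0 * (b - a).
  apply: (@mvt_le _ _ (fun t => E t * expR (- C * t))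
    (fun t => E' t * expR (- C * t) + E t * (- C * expR (- C * t)))) => //.
  - by apply: hder_within_continuous => t /itvccP; exact: Hd.
  - by move=> t /andP[? ?]; apply: Hd; rewrite !ltW.
  - move=> t /andP[? ?]; have tab : a <= t <= b by rewrite !ltW.
    have -> : E' t * expR (- C * t) + E t * (- C * expR (- C * t)) =
      (E' t - C * E t) * expR (- C * t) by ring.
    by rewrite mulr_le0_ge0 ?expR_ge0// subr_le0 EC.
rewrite mul0r subr_le0 => H.
have : E b * expR (- C * b) * expR (C * b) <= E a * expR (- C * a) * expR (C * b).
  by rewrite ler_wpM2r ?expR_ge0.
rewrite -!mulrA -!expRD mulNr addNr expR0 mulr1 => /le_trans; apply.
by rewrite (_ : - C * a + C * b = C * (b - a))//; ring.
Qed.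

(** A differentiable substitute for the square of the maximum norm, equivalent to it by [sqn_ge] and
    [sqn_le]; Gronwall's lemma needs the derivative. *)
Definition sqn m n (M : 'M[R]_(m, n)) : R := \sum_i \sum_j M i j ^+ 2.

Lemma sqn_ge m n (M : 'M[R]_(m, n)) : `|M| ^+ 2 <= sqn M.
Proof.
have [->|M0] := eqVneq `|M| 0.
  by rewrite expr0n/= /sqn; apply: sumr_ge0 => i _; apply: sumr_ge0 => j _; exact: sqr_ge0.
have [[i j]] := @mx_norm_neq0 _ _ _ M M0.
rewrite -[mx_norm M]/(`|M|) /= => ->; rewrite /sqn (bigD1 i)//= (bigD1 j)//=.
rewrite real_normK ?num_real// -addrA lerDl addr_ge0//.
  by apply: sumr_ge0 => k _; exact: sqr_ge0.
by apply: sumr_ge0 => k _; apply: sumr_ge0 => k' _; exact: sqr_ge0.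
Qed.

Lemma sqn_le m n (M : 'M[R]_(m, n)) : sqn M <= (m * n)%:R * `|M| ^+ 2.
Proof.
rewrite /sqn; apply: (@le_trans _ _ (\sum_(i < m) \sum_(j < n) `|M| ^+ 2)).
  apply: ler_sum => i _; apply: ler_sum => j _.
  by rewrite -[M i j ^+ 2]real_normK ?num_real// lerXn2r ?nnegrE ?mx_entry_le.
by rewrite !sumr_const !card_ord -mulrnA mulnC mulr_natl.
Qed.

Lemma hder_sum (A : set R) (I : Type) (r : seq I) (f : I -> R -> R) (f' : I -> R) x :
  (forall i, hder A (f i : R -> R^o) x (f' i)) ->
  hder A (fun t => \sum_(i <- r) f i t : R^o) x (\sum_(i <- r) f' i).
Proof.
move=> H; elim: r => [|i r IH].
  rewrite big_nil (_ : (fun _ => _) = fun=> 0); first exact: hder_cst.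
  by apply/funext => t; rewrite big_nil.
rewrite big_cons (_ : (fun _ => _) = fun t => f i t + \sum_(j <- r) f j t).
  exact: (@hderD _ R^o).
by apply/funext => t; rewrite big_cons.
Qed.

Lemma hder_sqn m n (A : set R) (g : R -> 'M[R]_(m, n)) x l :
  hder A g x l ->
  hder A (fun t => sqn (g t) : R^o) x (\sum_i \sum_j 2 * g x i j * l i j).
Proof.
move=> /hder_mx H; apply: hder_sum => i; apply: hder_sum => j.
rewrite (_ : (fun _ => _) = fun t => g t i j * g t i j).
  rewrite (_ : 2 * _ * _ = l i j *: (g x i j : R^o) + g x i j *: l i j).
    exact: (@hder_scale _ R^o).
  by rewrite /GRing.scale/=; ring.
by apply/funext => t; rewrite expr2.
Qed.

Lemma dsqn_le m n (M l : 'M[R]_(m, n)) :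
  \sum_i \sum_j 2 * M i j * l i j <= (m * n)%:R * (2 * `|M| * `|l|).
Proof.
apply: (@le_trans _ _ (\sum_(i < m) \sum_(j < n) 2 * `|M| * `|l|)).
  apply: ler_sum => i _; apply: ler_sum => j _.
  rewrite -!mulrA ler_pM2l//; apply: (le_trans (ler_norm _)).
  by rewrite normrM ler_pM// mx_entry_le.
by rewrite !sumr_const !card_ord -mulrnA mulnC [leRHS]mulr_natl.
Qed.


(* By contradiction, at the first time where [d] reaches [r]. *)
Lemma continuous_induction a b (d : R -> R) (r : R) :
  {within `[a, b], continuous d} -> d a < r ->
  (forall t, a <= t <= b -> (forall t', a <= t' <= t -> d t' <= r) -> d t < r) ->
  forall t, a <= t <= b -> d t < r.
Proof.
move=> /within_ctsP dc dar H t1 /andP[at1 t1b]; rewrite ltNge; apply/negP => rt1.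
pose S := [set t | a <= t <= t1 /\ r <= d t].
have Slb : lbound S a by move=> t [/andP[]].
have Si : has_inf S by split; [exists t1; split; rewrite ?at1 ?lexx|exists a].
pose s := inf S.
have as_ : a <= s by apply: lb_le_inf => //; exists t1; split; rewrite ?at1 ?lexx.
have st1 : s <= t1 by apply: ge_inf; [exists a|split; rewrite ?at1 ?lexx].
have sab : a <= s <= b by rewrite as_ (le_trans st1).
have before t : a <= t -> t < s -> d t < r.
  move=> at_ ts; rewrite ltNge; apply/negP => rt.
  have : s <= t by apply: ge_inf; [exists a|split; rewrite ?at_ ?(le_trans (ltW ts))].
  by rewrite leNgt ts.
have sI : `[a, b]%classic s by apply/itvccP.
have ds : d s <= r.
  rewrite leNgt; apply/negP => rs.
  have dsr : 0 < d s - r by rewrite subr_gt0.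
  have [e e0 He] := dc s sI _ dsr.
  have as' : a < s.
    by rewrite lt_neqAle as_ andbT; apply: contraTneq rs => <-; rewrite -leNgt ltW.
  pose t := Num.max a (s - e / 2).
  have ts : t < s by rewrite gt_max as'/=; lra.
  have at_ : a <= t by rewrite le_max lexx.
  have tI : `[a, b]%classic t by apply/itvccP; rewrite at_/=; lra.
  have set_ : s - e / 2 <= t by rewrite le_max lexx orbT.
  have te : `|t - s| < e by rewrite ltr0_norm; lra.
  have := He t tI te; have := before t at_ ts.
  by rewrite ltr_norml => ? /andP[? ?]; lra.
(* The bound holds before [s] and, by continuity, at [s], so the hypothesis makes it strict at [s].
   Continuity then carries it a little beyond [s], against the choice of [s] as an infimum. *)
have {ds} ds : d s < r.
  apply: H => // t /andP[at_]; rewrite le_eqVlt => /predU1P[->//|ts].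
  by apply/ltW/before.
have dsr : 0 < r - d s by rewrite subr_gt0.
have [e e0 He] := dc s sI _ dsr.
have [t [/andP[at_ tt1] rt] tse] := inf_adherent e0 Si.
have st : s <= t by apply: ge_inf; [exists a|split; rewrite ?at_].
have tI : `[a, b]%classic t by apply/itvccP; rewrite at_/= (le_trans tt1).
have te : `|t - s| < e by rewrite ger0_norm ?subr_ge0//; rewrite /s; lra.
by have := He t tI te; rewrite ltr_norml => /andP[? ?]; lra.
Qed.

(* [E], the sum of the squares of all entries plus [K ^+ 2], satisfies
   [E' <= c * E]. *)
Lemma gronwall3 (m1 n1 m2 n2 m3 n3 : nat) (L T : R) : 0 <= L -> 0 <= T ->
  exists2 C : R, 1 <= C & forall a b (x x' : R -> 'M[R]_(m1, n1))
    (y y' : R -> 'M[R]_(m2, n2)) (z z' : R -> 'M[R]_(m3, n3)) K,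
  b - a <= T -> 0 <= K ->
  (forall t, a <= t <= b -> [/\ hder `[a, b] x t (x' t),
    hder `[a, b] y t (y' t) & hder `[a, b] z t (z' t)]) ->
  (forall t, a <= t <= b ->
    [/\ `|x' t| <= L * (`|x t| + `|y t| + `|z t|) + K,
        `|y' t| <= L * (`|x t| + `|y t| + `|z t|) + K &
        `|z' t| <= L * (`|x t| + `|y t| + `|z t|) + K]) ->
  forall t, a <= t <= b ->
    `|x t| + `|y t| + `|z t| <= C * (`|x a| + `|y a| + `|z a| + K).
Proof.
move=> L0 T0.
pose N1 : R := (m1 * n1)%:R; pose N2 : R := (m2 * n2)%:R; pose N3 : R := (m3 * n3)%:R.
have N10 : 0 <= N1 by []; have N20 : 0 <= N2 by []; have N30 : 0 <= N3 by [].
pose N := N1 + N2 + N3; have N0 : 0 <= N by rewrite !addr_ge0.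
(* With S the sum of the three norms, E' is at most 2 N S (L S + K); then S ^ 2 <= 3 E and S K <= 2
   E give the factor 3 L + 2. *)
pose c := 2 * N * (3 * L + 2); have c0 : 0 <= c by rewrite !mulr_ge0// addr_ge0// mulr_ge0.
(* The 3 comes from S ^ 2 <= 3 E, and N + 1 from E a <= (N + 1) (S a + K) ^ 2. This bounds S t ^ 2
   by C (S a + K) ^ 2; as C >= 1, C ^ 2 may replace C, which avoids a square root in the
   constant. *)
pose C := 3 * (N + 1) * expR (c * T).
have e1 : 1 <= expR (c * T) by rewrite -expR0 ler_expR mulr_ge0.
have C1 : 1 <= C.
  by rewrite /C -[leLHS]mul1r ler_pM//; lra.
have C0 : 0 <= C by exact: le_trans C1.
exists C => // a b x x' y y' z z' K bT K0 Hd Hb t /andP[at_ tb].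
pose S s := `|x s| + `|y s| + `|z s|.
have S0 s : 0 <= S s by rewrite !addr_ge0.
pose E s := sqn (x s) + sqn (y s) + sqn (z s) + K ^+ 2.
pose E' s := \sum_i \sum_j 2 * x s i j * x' s i j +
  \sum_i \sum_j 2 * y s i j * y' s i j + \sum_i \sum_j 2 * z s i j * z' s i j + 0.
have SE s : S s ^+ 2 <= 3 * (E s - K ^+ 2).
  have := sqn_ge (x s); have := sqn_ge (y s); have := sqn_ge (z s).
  rewrite /S /E; move: `|x s| `|y s| `|z s| (sqn _) (sqn _) (sqn _) => p q r p' q' r'.
  have := sqr_ge0 (p - q); have := sqr_ge0 (p - r); have := sqr_ge0 (q - r).
  by rewrite !expr2 => ? ? ? ? ? ?; lra.
have sub s : a <= s <= t -> a <= s <= b by move=> /andP[-> st]; rewrite (le_trans st).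
have subI : `[a, t]%classic `<=` `[a, b]%classic.
  by move=> s /itvccP/sub ?; apply/itvccP.
have : E t <= E a * expR (c * (t - a)).
  apply: (@gronwall_real a t E E' c at_) => s /sub sab.
    have [Hx Hy Hz] := Hd s sab.
    apply: (hder_sub subI); apply: (@hderD _ R^o); last exact: hder_cst.
    apply: (@hderD _ R^o); last exact: hder_sqn.
    by apply: (@hderD _ R^o); exact: hder_sqn.
  have [Hx Hy Hz] := Hb s sab; rewrite -/(S s) in Hx Hy Hz.
  have LK : 0 <= L * S s + K by rewrite addr_ge0// mulr_ge0.
  have bnd m n (M l : 'M[R]_(m, n)) : `|M| <= S s -> `|l| <= L * S s + K ->
      \sum_i \sum_j 2 * M i j * l i j <= (m * n)%:R * (2 * S s * (L * S s + K)).
    move=> MS lS; apply: (le_trans (dsqn_le _ _)); apply: ler_wpM2l => //.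
    by apply: ler_pM => //; rewrite ?mulr_ge0// ler_pM2l.
  have x0 := normr_ge0 (x s); have y0 := normr_ge0 (y s); have z0 := normr_ge0 (z s).
  apply: (@le_trans _ _ (N * (2 * S s * (L * S s + K)))).
    have Bx : _ <= N1 * _ := bnd _ _ (x s) (x' s) _ Hx.
    have By : _ <= N2 * _ := bnd _ _ (y s) (y' s) _ Hy.
    have Bz : _ <= N3 * _ := bnd _ _ (z s) (z' s) _ Hz.
    rewrite /E' addr0 /N (mulrDl _ N3) (mulrDl N1).
    have xS : `|x s| <= S s by rewrite /S -addrA lerDl addr_ge0.
    have yS : `|y s| <= S s by rewrite /S addrAC lerDr addr_ge0.
    have zS : `|z s| <= S s by rewrite /S lerDr addr_ge0.
    by rewrite !lerD ?Bx ?By ?Bz.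
  have -> : N * (2 * S s * (L * S s + K)) = 2 * N * (L * S s ^+ 2 + S s * K) by ring.
  have -> : c * E s = 2 * N * ((3 * L + 2) * E s) by rewrite /c; ring.
  apply: ler_wpM2l; first by rewrite mulr_ge0.
  rewrite (mulrDl (3 * L)); apply: lerD.
    rewrite (mulrC 3) -mulrA; apply: ler_wpM2l => //.
    by have := SE s; have := sqr_ge0 K; lra.
  have := SE s; have := sqr_ge0 K; have := sqr_ge0 (S s - K).
  by have := sqr_ge0 (S s); rewrite !expr2; move: (S s) (E s) => p q; lra.
move=> HE.
have Ea : E a <= (N + 1) * (S a + K) ^+ 2.
  have := sqn_le (x a); have := sqn_le (y a); have := sqn_le (z a).
  rewrite -/N1 -/N2 -/N3 => Hz Hy Hx.
  have S2 p : 0 <= p -> p <= S a -> p ^+ 2 <= (S a + K) ^+ 2.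
    by move=> p0 pS; rewrite lerXn2r ?nnegrE ?addr_ge0//; lra.
  have x0 := normr_ge0 (x a); have y0 := normr_ge0 (y a); have z0 := normr_ge0 (z a).
  have Sx : `|x a| ^+ 2 <= (S a + K) ^+ 2 by apply: S2 => //; rewrite /S; lra.
  have Sy : `|y a| ^+ 2 <= (S a + K) ^+ 2 by apply: S2 => //; rewrite /S; lra.
  have Sz : `|z a| ^+ 2 <= (S a + K) ^+ 2 by apply: S2 => //; rewrite /S; lra.
  have SK : K ^+ 2 <= (S a + K) ^+ 2.
    by rewrite lerXn2r ?nnegrE ?addr_ge0// lerDr.
  rewrite /E /N !mulrDl mul1r; apply: lerD => //.
  apply: lerD; last by apply: (le_trans Hz); apply: ler_wpM2l.
  by apply: lerD; [apply: (le_trans Hx)|apply: (le_trans Hy)]; apply: ler_wpM2l.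
rewrite -/(S t) -/(S a) -(@ler_pXn2r _ 2) ?nnegrE ?mulr_ge0 ?addr_ge0//.
apply: (le_trans (SE t)).
apply: (@le_trans _ _ (C * (S a + K) ^+ 2)); last first.
  rewrite exprMn; apply: ler_wpM2r; first exact: sqr_ge0.
  by rewrite expr2 -[leLHS]mul1r ler_wpM2r.
have -> : C * (S a + K) ^+ 2 = 3 * ((N + 1) * (S a + K) ^+ 2 * expR (c * T)).
  by rewrite /C; ring.
rewrite ler_pM2l//.
apply: (@le_trans _ _ (E t)); first by have := sqr_ge0 K; lra.
apply: (le_trans HE); apply: ler_pM => //; rewrite ?expR_ge0//.
  by rewrite /E !addr_ge0 ?sqr_ge0// ; apply: sumr_ge0 => i _; apply: sumr_ge0 => j _; exact: sqr_ge0.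
by rewrite ler_expR ler_wpM2l//; lra.
Qed.

End Mvt.

(** * Local Lipschitz bounds *)

Section Lipschitz.
Variables (R : realType) (n : nat).
Local Notation V := 'rV[R]_n.

Lemma Ck_differentiable (W : normedModType R) (D : set V) (G : V -> W) :
  (forall k, Ck k D G) -> forall u, D u -> differentiable G u.
Proof. by move=> /(_ 1%N)[]. Qed.

Lemma Ck_derive (W : normedModType R) (D : set V) (G : V -> W) (e : V) :
  (forall k, Ck k D G) -> forall k, Ck k D (fun u => 'D_e G u).
Proof. by move=> H k; have [_ ] := H k.+1; exact. Qed.

Lemma Ck_continuous (W : normedModType R) (D : set V) (G : V -> W) :
  (forall k, Ck k D G) -> forall u, D u -> {for u, continuous G}.
Proof. by move=> /(_ 0%N). Qed.

Lemma mxBE p q (A B : 'M[R]_(p, q)) i j : (A - B) i j = A i j - B i j.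
Proof. by rewrite !mxE. Qed.

(** [Ck] speaks of directional derivatives, so this formula is how regularity reaches the
    Jacobian. *)
Lemma jacobianE (m : nat) (F : V -> 'rV[R]_m) u i j : differentiable F u ->
  'J F u i j = 'D_(delta_mx 0 i) F u 0 j.
Proof. by move=> dF; rewrite deriveE// /jacobian !mxE. Qed.

Lemma diff_norm_le p q (G : V -> 'M[R]_(p, q)) u (M : R) : differentiable G u ->
  (forall j : 'I_n, `|'D_(delta_mx 0 j) G u| <= M) ->
  forall h, `|'d G u h| <= n%:R * M * `|h|.
Proof.
move=> dG HM h; rewrite [X in 'd _ _ X]row_sum_delta linear_sum.
apply: (le_trans (ler_norm_sum _ _ _)).
apply: (@le_trans _ _ (\sum_(j < n) M * `|h|)).
  apply: ler_sum => j _; rewrite linearZ/= normrZ mulrC.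
  by apply: ler_pM => //; [rewrite -deriveE|exact: mx_entry_le].
by rewrite sumr_const card_ord -[leLHS]mulr_natl mulrA.
Qed.

(** The directional derivatives along the basis are continuous, hence bounded on a ball; balls are
    convex, so the mean value inequality applies on the segment from [v] to [u]. *)
Lemma local_lipschitz p q (D : set V) (G : V -> 'M[R]_(p, q)) (u0 : V) :
  open D -> (forall k, Ck k D G) -> D u0 ->
  exists r L : R, [/\ 0 < r, 0 <= L & forall u v, `|u - u0| < r -> `|v - u0| < r ->
    D u /\ `|G u - G v| <= L * `|u - v|].
Proof.
move=> oD sG Du0.
pose M : R := \big[Num.max/0]_(j < n) (`|'D_(delta_mx 0 j) G u0| + 1).
have M0 : 0 <= M by rewrite /M; exact: bigmax_ge_id.
have : \forall u \near u0, D u /\ forall j : 'I_n, `|'D_(delta_mx 0 j) G u| <= M.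
  near=> u; split; first by near: u; exact: open_nbhs_nbhs.
  near: u; apply: filter_forall => j.
  have /cvgrPdist_lt/(_ 1 ltr01) := Ck_continuous (Ck_derive (delta_mx 0 j) sG) Du0.
  apply: filterS => u Hu.
  apply: le_trans (_ : `|'D_(delta_mx 0 j) G u0| + 1 <= _); last first.
    exact: (le_bigmax _ (fun j => `|'D_(delta_mx 0 j) G u0| + 1)).
  rewrite -(subrK ('D_(delta_mx 0 j) G u0) ('D_(delta_mx 0 j) G u)) addrC.
  by apply: (le_trans (ler_normD _ _)); rewrite lerD2l distrC ltW.
move=> /nbhs_ballP[r /= r0 Hr]; exists r, (n%:R * M); split=> // [|u v ur vr].
  exact: mulr_ge0.
have inb t : 0 <= t <= 1 -> `|v + t *: (u - v) - u0| < r.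
  move=> /andP[t0 t1].
  have -> : v + t *: (u - v) - u0 = (1 - t) *: (v - u0) + t *: (u - u0).
    rewrite !scalerBr !scalerBl !scale1r.
    by apply/rowP => i; rewrite !mxE; ring.
  apply: (le_lt_trans (ler_normD _ _)); rewrite !normrZ.
  rewrite (ger0_norm t0) ger0_norm ?subr_ge0//.
  have [->|tn0] := eqVneq t 0; first by rewrite subr0 mul1r mul0r addr0.
  have tp : 0 < t by rewrite lt_neqAle eq_sym tn0.
  have : t * `|u - u0| < t * r by rewrite ltr_pM2l.
  have : (1 - t) * `|v - u0| <= (1 - t) * r.
    by rewrite ler_wpM2l ?subr_ge0// ltW.
  by lra.
have inD w : `|w - u0| < r -> D w /\ forall j : 'I_n, `|'D_(delta_mx 0 j) G w| <= M.
  by move=> wr; apply: Hr; rewrite -ball_normE/= distrC.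
split; first by have [] := inD u ur.
have gd t : 0 <= t <= 1 -> hder `[0, 1] (fun t => G (v + t *: (u - v))) t
    ('d G (v + t *: (u - v)) (u - v)).
  move=> t01; have [Dt _] := inD _ (inb t t01).
  apply: (@hder_comp _ _ _ G `[0, 1] (fun t => v + t *: (u - v))).
    exact: Ck_differentiable sG _ Dt.
  rewrite -[X in hder _ _ _ X]add0r; apply: hderD; first exact: hder_cst.
  rewrite [X in hder _ _ _ X](_ : _ = 1 *: (u - v) + t *: 0).
    by apply: hder_scale; [exact: hder_id|exact: hder_cst].
  by rewrite scale1r scaler0 addr0.
have := @mvt_mx _ _ _ 0 1 (fun t => G (v + t *: (u - v)))
  (fun t => 'd G (v + t *: (u - v)) (u - v)) 0 (n%:R * M * `|u - v|).
rewrite ler01 scale1r scale0r addr0 subrKC scaler0 !subr0 mulr1; apply => //.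
- by apply: hder_within_continuous => t /itvccP; exact: gd.
- by move=> t /andP[? ?]; apply: gd; rewrite !ltW.
- by rewrite !mulr_ge0.
move=> t /andP[t0 t1]; rewrite subr0.
have [Dt Mt] := inD _ (inb t (introT andP (conj (ltW t0) (ltW t1)))).
by apply: diff_norm_le => //; exact: Ck_differentiable sG _ Dt.
Unshelve. all: by end_near. Qed.

(** Compactness makes the local Lipschitz bounds uniform. A single small parameter [r] plays both
    roles, radius [r] and constant [r^-1], so that the statement is a filter statement and several
    tubes can be intersected. *)
Lemma tube p q (D K : set V) (G : V -> 'M[R]_(p, q)) :
  open D -> (forall k, Ck k D G) -> compact K -> K `<=` D ->
  \forall r \near (0 : R)^'+, forall u, K u -> forall v, `|v - u| < r ->
    D v /\ `|G v - G u| <= r^-1 * `|v - u|.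
Proof.
move=> oD sG cK KD.
have /compact_near_coveringP/near_covering_withinP := cK.
move=> /(_ R 0^'+ (fun r u => forall v, `|v - u| < r ->
    D v /\ `|G v - G u| <= r^-1 * `|v - u|)); apply => u0 Ku0.
have [r [L [r0 L0 H]]] := local_lipschitz oD sG (KD _ Ku0).
have r20 : 0 < r / 2 by rewrite divr_gt0.
have L10 : 0 < (L + 1)^-1 by rewrite invr_gt0 ltr_wpDl.
exists (ball u0 (r / 2), [set s | 0 < s < Num.min (r / 2) (L + 1)^-1]) => /=.
  split; first exact: nbhsx_ballx.
  near=> s; apply/andP; split; first by near: s; exact: nbhs_right_gt.
  by near: s; apply: nbhs_right_lt; rewrite lt_min r20.
move=> [u s] /= [+ /andP[s0]]; rewrite lt_min -ball_normE /= => uu0 /andP[sr sL] Ku v vu.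
have ur : `|u - u0| < r by rewrite distrC; apply: (lt_trans uu0); lra.
have vr : `|v - u0| < r.
  rewrite -(subrK u v) -addrA; apply: (le_lt_trans (ler_normD _ _)).
  by rewrite [r]splitr ltrD//; [exact: lt_trans sr|rewrite distrC].
have [Dv Hv] := H v u vr ur; split=> //.
apply: (le_trans Hv); apply: ler_wpM2r => //.
rewrite -[s^-1]mul1r ler_pdivlMr//.
by move: sL; rewrite -[X in _ < X]mul1r ltr_pdivlMr ?ltr_wpDl//; nra.
Unshelve. all: by end_near. Qed.

(** The rows of the Jacobian are directional derivatives, which are again of every class [Ck]; the
    finitely many tubes are intersected by [filter_forall]. *)
Lemma tube_jacobian m (D K : set V) (F : V -> 'rV[R]_m) :
  open D -> (forall k, Ck k D F) -> compact K -> K `<=` D ->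
  \forall r \near (0 : R)^'+, forall u, K u -> forall v, `|v - u| < r ->
    D v /\ `|'J F v - 'J F u| <= r^-1 * `|v - u|.
Proof.
move=> oD sF cK KD; near=> r => u Ku v vu.
have r0 : 0 < r by near: r; exact: nbhs_right_gt.
have [Dv _] : D v /\ `|F v - F u| <= r^-1 * `|v - u|.
  by move: u Ku v vu; near: r; exact: (@tube _ _ _ _ F).
split=> //; apply: mx_norm_le => [|i j]; first by rewrite mulr_ge0// invr_ge0 ltW.
have : `|'D_(delta_mx 0 i) F v - 'D_(delta_mx 0 i) F u| <= r^-1 * `|v - u|.
  suff [] : D v /\ `|'D_(delta_mx 0 i) F v - 'D_(delta_mx 0 i) F u| <= r^-1 * `|v - u| by [].
  move: u Ku v vu Dv; suff : forall u : V, K u -> forall v : V, `|v - u| < r -> 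
    D v /\ `|'D_(delta_mx 0 i) F v - 'D_(delta_mx 0 i) F u| <= r^-1 * `|v - u|.
    by move=> H u Ku v /(H u Ku).
  move: i; near: r; apply: filter_forall => i.
  by apply: (@tube _ _ _ _ (fun u => 'D_(delta_mx 0 i) F u)) => //; exact: Ck_derive.
apply: le_trans; have := mx_entry_le ('D_(delta_mx 0 i) F v - 'D_(delta_mx 0 i) F u) 0 j.
have dF w : D w -> differentiable F w by exact: Ck_differentiable.
rewrite (mxBE _ _ 0 j) => H.
have -> : ('J F v - 'J F u) i j =
    'D_(delta_mx 0 i) F v 0 j - 'D_(delta_mx 0 i) F u 0 j.
  rewrite (mxBE ('J F v) ('J F u) i j); congr (_ - _).
    exact: (jacobianE i j (dF _ Dv)).
  exact: (jacobianE i j (dF _ (KD _ Ku))).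
exact: H.
Unshelve. all: by end_near. Qed.
End Lipschitz.

(** * The smoothed field and its Jacobian *)

Section Dot.
Variables (R : realType) (n : nat).
Implicit Types (u v : 'rV[R]_n).

Lemma dotC u v : dot u v = dot v u.
Proof. by apply: eq_bigr => i _; rewrite mulrC. Qed.

Lemma dotE u v : (u *m v^T) 0 0 = dot u v.
Proof. by rewrite mxE; apply: eq_bigr => i _; rewrite mxE. Qed.

Lemma dotD u v x : dot x (u + v) = dot x u + dot x v.
Proof. by rewrite -big_split; apply: eq_bigr => i _; rewrite mxE mulrDr. Qed.

Lemma dotZ (a : R) u x : dot x (a *: u) = a * dot x u.
Proof. by rewrite mulr_sumr; apply: eq_bigr => i _; rewrite mxE mulrCA. Qed.

Lemma dotB u v x : dot x (u - v) = dot x u - dot x v.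
Proof. by rewrite -scaleN1r dotD dotZ mulN1r. Qed.

Lemma dot_norm_le u v : `|dot u v| <= n%:R * `|u| * `|v|.
Proof.
apply: (le_trans (ler_norm_sum _ _ _)).
apply: (@le_trans _ _ (\sum_(i < n) `|u| * `|v|)).
  by apply: ler_sum => i _; rewrite normrM ler_pM// mx_entry_le.
by rewrite sumr_const card_ord -[leLHS]mulr_natl mulrA.
Qed.

Lemma hder_dot (A : set R) (x : 'rV[R]_n) (g : R -> 'rV[R]_n) t l :
  hder A g t l -> hder A (fun t => dot x (g t) : R^o) t (dot x l).
Proof.
apply: (@hder_lin _ _ R^o (dot x) (n%:R * `|x|)); first exact: mulr_ge0.
  by move=> a u v; rewrite dotD dotZ.
by move=> u; exact: dot_norm_le.
Qed.

Lemma differentiable_dot (x u : 'rV[R]_n) : differentiable (dot x : _ -> R^o) u.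
Proof.
rewrite (_ : dot x = \sum_(i < n) (fun u => x 0 i *: (u 0 i : R^o))).
  by apply: differentiable_sum => i; apply: differentiableZ; exact: differentiable_coord.
by apply/funext => v; rewrite fct_sumE.
Qed.

Lemma dot_continuous (x : 'rV[R]_n) : continuous (dot x : _ -> R^o).
Proof. by move=> u; apply: differentiable_continuous; exact: differentiable_dot. Qed.

End Dot.

Lemma hder_uniqT (R : realType) (W : normedModType R) (g : R -> W) x l m :
  hder setT g x l -> hder setT g x m -> l = m.
Proof.
apply: hder_uniq => d d0; exists (x + d / 2); split => //.
  by apply/eqP => H; lra.
by rewrite addrC addKr ger0_norm; lra.
Qed.

(** * The cutoff function and its derivative *)

Section Cutoff.
Variables (R : realType) (phi : R -> R).
Hypothesis phi_der : forall y, derivable phi y 1.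
Hypothesis phi_one : forall y, 1 <= y -> phi y = 1.
Hypothesis phi_zero : forall y, y <= 0 -> phi y = 0.
Hypothesis phi_incr : forall y, 0 < y < 1 -> 0 < (phi^`())%classic y.

Lemma hder_cutoff (A : set R) y : hder A (phi : R -> R^o) y (phi^`()%classic y).
Proof.
have dphi : differentiable phi (id y) by apply/derivable1_diffP; exact: phi_der.
have := @hder_comp R R^o R^o phi A id y 1 dphi (hder_id _ _).
by rewrite diff1E// /GRing.scale/= mul1r.
Qed.

Lemma cutoff_bounds y : 0 <= phi y <= 1.
Proof.
have [y0|y0] := leP y 0; first by rewrite phi_zero// lexx ler01.
have [y1|y1] := leP 1 y; first by rewrite phi_one// lexx ler01.
have H a b : 0 <= a -> b <= 1 -> a <= b -> phi a <= phi b.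
  move=> a0 b1 ab.
  have : - phi b - (- phi a) <= 0 * (b - a); last by rewrite mul0r; lra.
  apply: (@mvt_le R a b (fun t => - phi t) (fun t => - (phi^`())%classic t)) => //.
  - apply: (@hder_within_continuous _ R^o _ _ (fun t => - (phi^`())%classic t)) => t _.
    by apply: (@hderN _ R^o); exact: hder_cutoff.
  - by move=> t _; apply: (@hderN _ R^o); exact: hder_cutoff.
  - move=> t /andP[at_ tb]; rewrite oppr_le0 ltW// phi_incr//.
    by rewrite (le_lt_trans a0)//= (lt_le_trans tb).
have := H 0 y (lexx _) (ltW y1) (ltW y0); have := H y 1 (ltW y0) (lexx _) (ltW y1).
by rewrite (phi_zero (lexx 0)) (phi_one (lexx 1)) => -> ->.
Qed.

(** At 0 and at 1 the function is constant on one side only. The derivative is therefore taken along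
    a half-line and identified by uniqueness there. *)
Lemma dcutoff_eq0 y : y <= 0 \/ 1 <= y -> (phi^`())%classic y = 0.
Proof.
case=> y0.
  apply: (@hder_uniq _ R^o [set t | t <= y] phi y _ _ _ (hder_cutoff _ _)).
    move=> d d0; exists (y - d / 2); split=> /=; first by lra.
      by apply/eqP => H; lra.
    by rewrite ltr0_norm; lra.
  apply: (@hder_ext R R^o _ (fun=> 0)) (hder_cst _ _ _) => //= t ty.
  by rewrite phi_zero//; exact: le_trans y0.
apply: (@hder_uniq _ R^o [set t | y <= t] phi y _ _ _ (hder_cutoff _ _)).
  move=> d d0; exists (y + d / 2); split=> /=; first by lra.
    by apply/eqP => H; lra.
  by rewrite gtr0_norm; lra.
apply: (@hder_ext R R^o _ (fun=> 1 : R^o)) (hder_cst _ _ _) => //= t ty.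
by rewrite phi_one//; exact: le_trans ty.
Qed.

End Cutoff.

Section Smoothed.
Variables (R : realType) (n : nat) (phi : R -> R).
Hypothesis phi_der : forall y, derivable phi y 1.
Hypothesis phi_one : forall y, 1 <= y -> phi y = 1.
Hypothesis phi_zero : forall y, y <= 0 -> phi y = 0.
Variables (nn : 'rV[R]_n) (fp fm : 'rV[R]_n -> 'rV[R]_n) (mu : R).
Hypothesis mu_gt0 : 0 < mu.
Local Notation f := (smoothed nn phi fp fm mu).

Lemma smoothed_minus u : dot nn u <= 0 -> f u = fm u.
Proof.
move=> u0; rewrite /smoothed phi_zero ?scale0r ?add0r ?subr0 ?scale1r//.
by rewrite pmulr_lle0// invr_gt0.
Qed.

Lemma smoothed_plus u : mu <= dot nn u -> f u = fp u.
Proof.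
move=> u0; rewrite /smoothed phi_one ?scale1r ?subrr ?scale0r ?addr0//.
by rewrite ler_pdivlMr ?mul1r.
Qed.

Lemma differentiable_scale m (a : 'rV[R]_n -> R) (g : 'rV[R]_n -> 'rV[R]_m) u :
  differentiable (a : _ -> R^o) u -> differentiable g u ->
  differentiable (fun v => a v *: g v) u.
Proof.
move=> da dg.
rewrite (_ : (fun v => _) =
    \sum_(j < m) (fun v => (a v * g v 0 j) *: (delta_mx 0 j : 'rV[R]_m))).
  apply: differentiable_sum => j; apply: differentiableZl.
  apply: (@differentiableM _ _ a (fun v => g v 0 j)) => //.
  apply: (@differentiable_comp _ _ _ _ g (fun N : 'rV[R]_m => N 0 j : R)) => //.
  exact: differentiable_coord.
apply/funext => v; rewrite fct_sumE [X in _ *: X]row_sum_delta scaler_sumr.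
by apply: eq_bigr => j _; rewrite scalerA.
Qed.

Lemma differentiable_weight u :
  differentiable ((fun u => phi (dot nn u / mu)) : _ -> R^o) u.
Proof.
apply: (@differentiable_comp _ _ R^o R^o (fun u => dot nn u / mu) phi).
  rewrite (_ : (fun u => _) = (mu^-1 *: (dot nn : _ -> R^o))).
    by apply: differentiableZ; exact: differentiable_dot.
  by apply/funext => v; rewrite mulrC.
by apply/derivable1_diffP; exact: phi_der.
Qed.

Lemma differentiable_smoothed u : differentiable fp u -> differentiable fm u ->
  differentiable f u.
Proof.
move=> dp dm.
apply: (@differentiableD _ _ _ (fun u => phi (dot nn u / mu) *: fp u)
  (fun u => (1 - phi (dot nn u / mu)) *: fm u)); apply: differentiable_scale => //.
  exact: differentiable_weight.
apply: (@differentiableB _ _ R^o (fun=> 1)); first exact: differentiable_cst.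
exact: differentiable_weight.
Qed.

Lemma hder_weight (A : set R) (g : R -> 'rV[R]_n) t l : hder A g t l ->
  hder A (fun t => phi (dot nn (g t) / mu) : R^o) t
    (phi^`()%classic (dot nn (g t) / mu) / mu * dot nn l).
Proof.
move=> Hg; have Hd : hder A (fun t => mu^-1 *: (dot nn (g t) : R^o)) t (mu^-1 *: (dot nn l : R^o)).
  by apply: hderZ; exact: hder_dot.
have dphi : differentiable phi (mu^-1 *: (dot nn (g t) : R^o)).
  by apply/derivable1_diffP; exact: phi_der.
have := @hder_comp R R^o R^o phi A (fun t => mu^-1 *: (dot nn (g t) : R^o)) t _ dphi Hd.
rewrite diff1E// /GRing.scale/= (mulrC mu^-1 (dot nn (g t))).
rewrite (_ : (fun t => phi (mu^-1 * _)) = fun t => phi (dot nn (g t) / mu)); last first.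
  by apply/funext => s; rewrite mulrC.
rewrite (_ : mu^-1 * dot nn l * _ = 
  phi^`()%classic (dot nn (g t) / mu) / mu * dot nn l)//.
by rewrite [LHS]mulrC mulrA.
Qed.

(** Row by row, both sides are the derivative of the field along the line through [u] in a basis
    direction [h]. Differentiating the weight gives the rank-one term, since [h *m nn^T] is <n,
    h>. *)
Lemma jacobian_smoothed u : differentiable fp u -> differentiable fm u ->
  'J f u = phi (dot nn u / mu) *: 'J fp u + (1 - phi (dot nn u / mu)) *: 'J fm u
    + (phi^`()%classic (dot nn u / mu) / mu) *: (nn^T *m (fp u - fm u)).
Proof.
move=> dp dm; apply/row_matrixP => i; set h : 'rV[R]_n := delta_mx 0 i.
rewrite !rowE -/h.
pose g := fun t : R => u + t *: h.
have g0 : g 0 = u by rewrite /g scale0r addr0.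
have Hg : hder setT g 0 h.
  rewrite -[X in hder _ _ _ X]add0r; apply: hderD; first exact: hder_cst.
  rewrite [X in hder _ _ _ X](_ : _ = (1 : R) *: h + (0 : R) *: 0).
    by apply: hder_scale; [exact: hder_id|exact: hder_cst].
  by rewrite scale1r scaler0 addr0.
have df : differentiable f (g 0) by rewrite g0; exact: differentiable_smoothed.
have dp' : differentiable fp (g 0) by rewrite g0.
have dm' : differentiable fm (g 0) by rewrite g0.
have Hj (F : 'rV[R]_n -> 'rV[R]_n) : 'd F u h = h *m 'J F u.
  by rewrite /jacobian mul_rV_lin1.
have H1 : hder setT (fun t => f (g t)) 0 (h *m 'J f u).
  by rewrite -Hj -g0; exact: hder_comp.
have Hp : hder setT (fun t => fp (g t)) 0 (h *m 'J fp u).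
  by rewrite -Hj -g0; exact: hder_comp.
have Hm : hder setT (fun t => fm (g t)) 0 (h *m 'J fm u).
  by rewrite -Hj -g0; exact: hder_comp.
have Hw := hder_weight Hg; rewrite g0 in Hw.
have H1w : hder setT (fun t => 1 - phi (dot nn (g t) / mu) : R^o) 0
    (0 - phi^`()%classic (dot nn u / mu) / mu * dot nn h).
  by apply: (@hderB _ R^o) => //; exact: hder_cst.
have H2 := hderD (hder_scale Hw Hp) (hder_scale H1w Hm); rewrite g0 in H2.
rewrite (hder_uniqT H1 H2) {H1 H2 Hp Hm}.
move: ('J fp u) ('J fm u) => Jp Jm.
rewrite 2!mulmxDr -!scalemxAr mulmxA.
have -> : h *m nn^T = (dot nn h)%:M by rewrite [LHS]mx11_scalar dotE dotC.
rewrite mul_scalar_mx scalerA sub0r scaleNr.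
move: (_ * dot nn h) => a; rewrite scalerBr.
by rewrite [LHS]addrACA [LHS]addrC.
Qed.

Lemma jacobian_near (F G : 'rV[R]_n -> 'rV[R]_n) u :
  (\near u, F u = G u) -> differentiable F u -> differentiable G u ->
  'J F u = 'J G u.
Proof.
move=> FG dF dG; apply/matrixP => i j.
transitivity ('D_(delta_mx 0 i) F u 0 j); first exact: (jacobianE i j dF).
transitivity ('D_(delta_mx 0 i) G u 0 j); last exact/esym/(jacobianE i j dG).
by rewrite (near_eq_derive _ FG).
Qed.

Lemma near_differentiable (F G : 'rV[R]_n -> 'rV[R]_n) u :
  (\near u, F u = G u) -> differentiable G u -> differentiable F u.
Proof.
move=> FG dG.
have FGu : F u = G u by exact: nbhs_singleton FG.
have H : F \o shift u = cst (F u) + 'd G u +o_ (0 : 'rV[R]_n) id.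
  apply/eqaddoP => e e0.
  have /diff_locally/eqaddoP/(_ e e0) := dG.
  have := FG; rewrite (near_shift 0) => FG0.
  apply: filterS2 FG0 => h; rewrite /= subr0 => FGh; rewrite !fctE /=.
  by rewrite FGh FGu.
have cG : continuous ('d G u) by exact: diff_continuous.
have E : 'd F u = 'd G u :> (_ -> _) by exact: diff_unique cG H.
apply/diff_locallyP.
rewrite E.
split.
  exact: cG.
exact: H.
Qed.

(** Strictly above the layer the smoothed field agrees with [fp] in a neighbourhood of [u], and
    nothing is asked of [fm]. On the face <n, u> = mu this agreement is one-sided, so the explicit
    formula is used with phi' = 0; [mu < delta] makes [fm] differentiable there. The same division
    occurs at the lower face. *)
Lemma jacobian_smoothed_plus u delta : mu < delta -> mu <= dot nn u ->
  differentiable fp u -> (dot nn u < delta -> differentiable fm u) ->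
  'J f u = 'J fp u.
Proof.
move=> md; rewrite le_eqVlt => /predU1P[mE|mu_lt] dp dm.
  have {}dm : differentiable fm u by apply: dm; rewrite -mE.
  rewrite jacobian_smoothed// -mE divff ?gt_eqF// phi_one// (dcutoff_eq0 phi_der)//.
    by rewrite subrr scale0r mul0r scale0r !addr0 scale1r.
  by right.
have H : \near u, f u = fp u.
  have := @dot_continuous R n nn u => /cvgr_gt/(_ _ mu_lt).
  by apply: filterS => v /ltW; exact: smoothed_plus.
exact: (jacobian_near H (near_differentiable H dp) dp).
Qed.

Lemma jacobian_smoothed_minus u : dot nn u <= 0 ->
  differentiable fm u -> (dot nn u = 0 -> differentiable fp u) ->
  'J f u = 'J fm u.
Proof.
rewrite le_eqVlt => /predU1P[mE|mu_lt] dm dp.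
  have {}dp := dp mE.
  rewrite jacobian_smoothed// mE mul0r phi_zero// (dcutoff_eq0 phi_der)//.
    by rewrite subr0 mul0r !scale0r addr0 add0r scale1r.
  by left.
have H : \near u, f u = fm u.
  have := @dot_continuous R n nn u => /cvgr_lt/(_ _ mu_lt).
  by apply: filterS => v /ltW; exact: smoothed_minus.
exact: (jacobian_near H (near_differentiable H dm) dm).
Qed.

End Smoothed.

(** * Limits of linear initial value problems *)

Section LinearLimit.
Variable R : realType.
Implicit Types (a b t : R).

Lemma dist_between_l (x y z : R) : x <= y -> y <= z -> `|y - x| <= `|z - x|.
Proof. by move=> xy yz; rewrite !ger0_norm ?subr_ge0//; lra. Qed.

Lemma dist_between_r (x y z : R) : x <= y -> y <= z -> `|y - z| <= `|x - z|.
Proof. by move=> xy yz; rewrite !ler0_norm ?subr_le0//; lra. Qed.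

Lemma gt0_of_close (x y : R) : `|x - y| < y / 2 -> 0 < x.
Proof. by rewrite ltr_norml => /andP[]; lra. Qed.

Lemma gronwall m n (L T : R) : 0 <= L -> 0 <= T ->
  exists2 C : R, 1 <= C & forall a b (x x' : R -> 'M[R]_(m, n)) K,
  b - a <= T -> 0 <= K ->
  (forall t, a <= t <= b -> hder `[a, b] x t (x' t)) ->
  (forall t, a <= t <= b -> `|x' t| <= L * `|x t| + K) ->
  forall t, a <= t <= b -> `|x t| <= C * (`|x a| + K).
Proof.
move=> L0 T0; have [C C1 HC] := @gronwall3 R m n 1 1 1 1 L T L0 T0.
exists C => // a b x x' K bT K0 Hd Hb t tab.
have := HC a b x x' (fun=> 0) (fun=> 0) (fun=> 0) (fun=> 0) K bT K0 _ _ t tab.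
rewrite !normr0 !addr0; apply=> s sab.
  by split; [exact: Hd|exact: hder_cst|exact: hder_cst].
by rewrite !addr0; split; rewrite ?addr_ge0 ?mulr_ge0//; exact: Hb.
Qed.

(** The mean value inequality with slope [g t] extends the derivative to the endpoints. It serves at
    time 0, where [gamma] is not assumed to satisfy the equation, and at the ends of the interval
    for limits of solutions. *)
Lemma hder_closed m n a b (y g : R -> 'M[R]_(m, n)) :
  {within `[a, b], continuous y} -> {within `[a, b], continuous g} ->
  (forall t, a < t < b -> hder `[a, b] y t (g t)) ->
  forall t, a <= t <= b -> hder `[a, b] y t (g t).
Proof.
move=> yc /within_ctsP gc yd t /andP[at_ tb] e e0.
have tI : `[a, b]%classic t by apply/itvccP; rewrite at_.
have [d d0 Hd] := gc t tI e e0; exists d => // s /itvccP/andP[as_ sb] st.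
have main p q : p <= q -> a <= p -> q <= b ->
    (forall r, p < r < q -> `|r - t| < d) ->
    `|y q - y p - (q - p) *: g t| <= e * (q - p).
  move=> pq ap qb Hr.
  have sub r : p <= r <= q -> a <= r <= b.
    by move=> /andP[pr rq]; rewrite (le_trans ap)//= (le_trans rq).
  have subI : `[p, q]%classic `<=` `[a, b]%classic.
    by move=> r /itvccP/sub ?; apply/itvccP.
  apply: (@mvt_mx _ _ _ p q y g (g t) e pq); [|..|exact: ltW|].
  - exact: continuous_subspaceW yc.
  - move=> r /andP[pr rq]; apply: (hder_sub subI); apply: yd.
    by rewrite (le_lt_trans ap)//= (lt_le_trans rq).
  - move=> r /andP[pr rq]; apply/ltW/Hd; last by apply: Hr; rewrite pr.
    by apply: subI; apply/itvccP; rewrite !ltW.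
have [ts|st'] := leP t s.
  rewrite [in leRHS]ger0_norm ?subr_ge0//; apply: main => // r /andP[tr rs].
  by apply: le_lt_trans st; rewrite !ger0_norm ?subr_ge0// ?(ltW tr)//; lra.
rewrite [in leRHS]ltr0_norm ?subr_lt0// opprB.
have -> : y s - y t - (s - t) *: g t = - (y t - y s - (t - s) *: g t).
  by rewrite -(opprB t s) scaleNr opprK [RHS]opprB (opprB (y t)) addrC.
rewrite normrN; apply: main => //.
  exact: ltW.
move=> r /andP[sr rt]; apply: le_lt_trans st.
by rewrite !ltr0_norm ?subr_lt0//; lra.
Qed.

Lemma within_cts_bounded m n a b (f : R -> 'M[R]_(m, n)) :
  {within `[a, b], continuous f} ->
  exists2 M : R, 0 <= M & forall t, a <= t <= b -> `|f t| <= M.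
Proof.
move=> fc; have [ab|ba] := leP a b; last first.
  exists 0 => // t /andP[at_ tb]; have := le_trans at_ tb.
  by rewrite leNgt ba.
have nc : {within `[a, b], continuous (fun t => `|f t|)}.
  move/within_ctsP : fc => fc; apply/(@within_ctsP _ R^o) => x Ax e e0.
  have [d d0 Hd] := fc x Ax e e0; exists d => // y Ay yx.
  by apply: le_lt_trans (Hd y Ay yx); exact: ler_dist_dist.
have [c _ Hc] := EVT_max ab nc; by exists `|f c|.
Qed.

Lemma within_cts_mulmx m n p a b (f : R -> 'M[R]_(m, n)) (g : R -> 'M[R]_(n, p)) :
  {within `[a, b], continuous f} -> {within `[a, b], continuous g} ->
  {within `[a, b], continuous (fun t => f t *m g t)}.
Proof.
move=> fc gc; have [M M0 HM] := within_cts_bounded fc.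
have [N N0 HN] := within_cts_bounded gc.
move/within_ctsP : fc => fc; move/within_ctsP : gc => gc.
apply/within_ctsP => x Ax e e0.
pose c := n%:R * (M + N + 1) + 1 : R.
have c0 : 0 < c by rewrite /c ltr_wpDl// mulr_ge0// !addr_ge0.
have ec0 : 0 < e / c / 2 by rewrite !divr_gt0.
have [d d0 Hd] := fc x Ax _ ec0; have [d' d'0 Hd'] := gc x Ax _ ec0.
exists (Num.min d d'); first by rewrite lt_min d0.
move=> y Ay; rewrite lt_min => /andP[yd yd'].
have -> : f y *m g y - f x *m g x = (f y - f x) *m g y + f x *m (g y - g x).
  by rewrite mulmxBl mulmxBr addrA subrK.
have H1 := HM x ((itvccP _ _ _).1 Ax); have H2 := HN y ((itvccP _ _ _).1 Ay).
have H3 := ltW (Hd y Ay yd); have H4 := ltW (Hd' y Ay yd').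
apply: (le_lt_trans (ler_normD _ _)).
have B1 : `|(f y - f x) *m g y| <= n%:R * (e / c / 2) * N.
  apply: (le_trans (mulmx_norm _ _)); apply: ler_pM => //.
  exact: ler_wpM2l.
have B2 : `|f x *m (g y - g x)| <= n%:R * M * (e / c / 2).
  apply: (le_trans (mulmx_norm _ _)); apply: ler_pM => //.
  exact: ler_wpM2l.
apply: (le_lt_trans (lerD B1 B2)).
apply: (@lt_le_trans _ _ (c * (e / c / 2) * 2)); last first.
  by rewrite le_eqVlt; apply/orP; left; apply/eqP; field; rewrite gt_eqF.
have -> : n%:R * (e / c / 2) * N + n%:R * M * (e / c / 2) =
  (n%:R * (M + N)) * (e / c / 2) by ring.
have -> : c * (e / c / 2) * 2 = (2 * c) * (e / c / 2) by ring.
rewrite ltr_pM2r// /c.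
have : 0 <= n%:R * (M + N) :> R by rewrite mulr_ge0// addr_ge0.
by have : 0 <= n%:R :> R by []; lra.
Qed.

Lemma within_ctsD m n a b (f g : R -> 'M[R]_(m, n)) :
  {within `[a, b], continuous f} -> {within `[a, b], continuous g} ->
  {within `[a, b], continuous (fun t => f t + g t)}.
Proof. by move=> fc gc x; apply: cvgD; [exact: fc|exact: gc]. Qed.

(** Passage to the limit mu -> 0 in an estimate with error O(mu). *)
Lemma le_addM_small (x y C m0 : R) : 0 < m0 ->
  (forall mu, 0 < mu < m0 -> x <= y + C * mu) -> x <= y.
Proof.
move=> m00 H; apply/ler_addgt0Pr => e e0.
have C0 : 0 < `|C| + 1 by rewrite ltr_wpDl.
pose mu := Num.min (m0 / 2) (e / (`|C| + 1)).
have mu0 : 0 < mu by rewrite lt_min !divr_gt0.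
have mum : mu < m0 by rewrite /mu gt_min; apply/orP; left; lra.
apply: (le_trans (H mu _)); first by rewrite mu0.
rewrite lerD2l; apply: (@le_trans _ _ ((`|C| + 1) * mu)).
  by rewrite ler_pM2r//; apply: (le_trans (ler_norm C)); rewrite lerDl.
by rewrite mulrC -ler_pdivlMr// /mu ge_min lexx orbT.
Qed.

(** The limit exists by completeness; the rate [C * mu] remains when nu < mu tends to 0 in the
    hypothesis. *)
Lemma cauchy_at_right m n (f : R -> 'M[R]_(m, n)) (C m0 : R) : 0 < m0 -> 0 <= C ->
  (forall mu nu, 0 < mu < m0 -> 0 < nu < m0 -> `|f mu - f nu| <= C * Num.max mu nu) ->
  exists l, forall mu, 0 < mu < m0 -> `|f mu - l| <= C * mu.
Proof.
move=> m00 C0 H.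
have C10 : 0 < C + 1 by rewrite ltr_wpDl.
have : cvg (f @ (0 : R)^'+).
  apply/cauchy_cvgP/cauchy_exP => e e0.
  pose nu := Num.min (m0 / 2) (e / (C + 1) / 2).
  have nu0 : 0 < nu by rewrite lt_min !divr_gt0.
  have num0 : nu < m0 by rewrite /nu gt_min; apply/orP; left; lra.
  have nue : nu <= e / (C + 1) / 2 by rewrite ge_min lexx orbT.
  exists (f nu).
  suff : \forall mu \near (0 : R)^'+, ball (f nu) e (f mu) by [].
  near=> mu; rewrite -ball_normE/=.
  have mu0 : 0 < mu by near: mu; exact: nbhs_right_gt.
  have munu : mu < nu by near: mu; exact: nbhs_right_lt.
  apply: (le_lt_trans (H _ _ _ _)); rewrite ?nu0 ?mu0 ?(lt_trans munu)//.
  rewrite max_l ?ltW//; apply: (@le_lt_trans _ _ (C * (e / (C + 1) / 2))).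
    exact: ler_wpM2l.
  apply: (@lt_le_trans _ _ ((C + 1) * (e / (C + 1) / 2) * 2)); last first.
    by rewrite le_eqVlt; apply/orP; left; apply/eqP; field; rewrite gt_eqF.
  have : 0 < e / (C + 1) / 2 by rewrite !divr_gt0.
  by move: (e / _ / 2) => q q0; nra.
move=> fl; exists (lim (f @ (0 : R)^'+)) => mu mum.
have mu0 : 0 < mu by case/andP: mum.
have {}fl : f @ 0^'+ --> lim (f @ (0 : R)^'+) by [].
apply/ler_addgt0Pr => e e0.
have /cvgrPdist_lt/(_ e e0) fl' := fl.
near (0 : R)^'+ => nu.
have nu0 : 0 < nu by near: nu; exact: nbhs_right_gt.
have numu : nu < mu by near: nu; apply: nbhs_right_lt.
have fnu : `|lim (f @ (0 : R)^'+) - f nu| < e by near: nu.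
rewrite -(subrK (f nu) (f mu)) -addrA; apply: (le_trans (ler_normD _ _)).
apply: lerD; last by rewrite distrC ltW.
apply: (le_trans (H _ _ mum _)).
  by rewrite nu0 (lt_trans numu)//; case/andP: mum.
by rewrite max_l // ltW.
Unshelve. all: by end_near. Qed.


(* The right-hand side [y *m B + Lam *m y *m E] covers the system for [(v, z)]
   when the pair is written as one row block. *)
Lemma linear_limit_row p q (Lam : 'M[R]_p) (E : 'M[R]_q) (T C mu0 : R)
    (B : R -> 'M[R]_q) (Bm : R -> R -> 'M[R]_q) (s : R -> R) (y0 : 'M[R]_(p, q))
    (ym : R -> R -> 'M[R]_(p, q)) :
  0 < T -> 0 < mu0 -> 0 <= C -> {within `[0, T], continuous B} ->
  (forall mu, 0 < mu < mu0 -> [/\ 0 <= s mu, s mu <= C * mu, s mu <= T &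
    `|ym mu (s mu) - y0| <= C * mu]) ->
  (forall mu t, 0 < mu < mu0 -> s mu <= t <= T ->
    hder `[s mu, T] (ym mu) t (ym mu t *m Bm mu t + Lam *m ym mu t *m E) /\
    `|Bm mu t - B t| <= C * mu) ->
  exists (y : R -> 'M[R]_(p, q)) (C' : R), [/\ 0 <= C', y 0 = y0,
    forall t, 0 <= t <= T -> hder `[0, T] y t (y t *m B t + Lam *m y t *m E),
    forall mu t, 0 < mu < mu0 -> s mu <= t <= T -> `|ym mu t| <= C' &
    forall mu t, 0 < mu < mu0 -> s mu <= t <= T -> `|ym mu t - y t| <= C' * mu].
Proof.
move=> T0 m00 C0 Bc Hs Hd.
have [MB MB0 HMB] := within_cts_bounded Bc.
pose M1 := MB + C * mu0.
have Cm0 : 0 <= C * mu0 by rewrite mulr_ge0// ltW.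
have M10 : 0 <= M1 by rewrite addr_ge0.
have sub mu t : 0 < mu < mu0 -> s mu <= t <= T -> 0 <= t <= T.
  by move=> /Hs[s0 _ _ _] /andP[st ->]; rewrite (le_trans s0).
have Cmu mu : 0 < mu < mu0 -> 0 <= C * mu <= C * mu0.
  by move=> /andP[mu_gt0 mu_lt]; rewrite mulr_ge0 ?ler_wpM2l// ltW.
have HBm mu t : 0 < mu < mu0 -> s mu <= t <= T -> `|Bm mu t| <= M1.
  move=> mum tI; have [_ HB] := Hd mu t mum tI.
  rewrite -(subrK (B t) (Bm mu t)) addrC; apply: (le_trans (ler_normD _ _)).
  apply: lerD; first by apply: HMB; exact: sub tI.
  by apply: (le_trans HB); case/andP: (Cmu _ mum).
pose kE : R := q%:R * p%:R * `|Lam| * `|E|.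
have kE0 : 0 <= kE by rewrite !mulr_ge0.
have HE (u : 'M[R]_(p, q)) : `|Lam *m u *m E| <= kE * `|u|.
  apply: (le_trans (mulmx_norm _ _)).
  apply: (@le_trans _ _ (q%:R * (p%:R * `|Lam| * `|u|) * `|E|)).
    by apply: ler_pM => //; apply: ler_wpM2l => //; exact: mulmx_norm.
  by rewrite le_eqVlt; apply/orP; left; apply/eqP; rewrite /kE; ring.
pose L := q%:R * M1 + kE.
have L0 : 0 <= L by rewrite addr_ge0// mulr_ge0.
have HBu (u : 'M[R]_(p, q)) (N : 'M[R]_q) : `|N| <= M1 -> `|u *m N + Lam *m u *m E| <= L * `|u|.
  move=> NM; apply: (le_trans (ler_normD _ _)); rewrite mulrDl; apply: lerD => //.
  apply: (le_trans (mulmx_norm _ _)); rewrite mulrAC; apply: ler_wpM2r => //.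
  exact: ler_wpM2l.
have [G G1 HG] := @gronwall p q L T L0 (ltW T0).
have G0 : 0 <= G by exact: le_trans G1.
pose M2 := G * (`|y0| + C * mu0).
have M20 : 0 <= M2 by rewrite mulr_ge0// addr_ge0.
have Hy mu t : 0 < mu < mu0 -> s mu <= t <= T -> `|ym mu t| <= M2.
  move=> mum tI; have [s0 sC sT ys] := Hs mu mum.
  have sTT : T - s mu <= T by lra.
  apply: (le_trans (HG (s mu) T (ym mu) _ 0 sTT (lexx _) _ _ t tI)).
  - by move=> r rI; exact: (Hd mu r mum rI).1.
  - by move=> r rI; rewrite addr0; apply: HBu; exact: HBm.
  rewrite addr0; apply: ler_wpM2l => //.
  rewrite -(subrK y0 (ym mu _)) addrC; apply: (le_trans (ler_normD _ _)).
  by apply: lerD => //; apply: (le_trans ys); case/andP: (Cmu _ mum).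
clearbody M2 L.
pose L2 := L * M2; have L20 : 0 <= L2 by rewrite mulr_ge0.
have L2E : L2 = L * M2 by [].
have Hmvt mu a b l K : 0 < mu < mu0 -> s mu <= a -> a <= b -> b <= T -> 0 <= K ->
    (forall r, a <= r <= b ->
      `|ym mu r *m Bm mu r + Lam *m ym mu r *m E - l| <= K) ->
    `|ym mu b - ym mu a - (b - a) *: l| <= K * (b - a).
  move=> mum sa ab bT K0 HK.
  have subr r : a <= r <= b -> s mu <= r <= T.
    by move=> /andP[ar rb]; rewrite (le_trans sa)//= (le_trans rb).
  have subI : `[a, b]%classic `<=` `[s mu, T]%classic.
    by move=> r /itvccP/subr ?; apply/itvccP.
  have Hh r : a <= r <= b ->
      hder `[a, b] (ym mu) r (ym mu r *m Bm mu r + Lam *m ym mu r *m E).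
    by move=> /subr rI; apply: hder_sub subI _; exact: (Hd mu r mum rI).1.
  apply: (mvt_mx ab _ _ K0).
  - by apply: hder_within_continuous => r /itvccP; exact: Hh.
  - by move=> r /andP[ar rb]; apply: Hh; rewrite !ltW.
  - by move=> r /andP[ar rb]; apply: HK; rewrite !ltW.
have Hlip mu a b : 0 < mu < mu0 -> s mu <= a -> a <= b -> b <= T ->
    `|ym mu b - ym mu a| <= L2 * (b - a).
  move=> mum sa ab bT.
  have := Hmvt mu a b 0 L2 mum sa ab bT L20; rewrite scaler0 subr0; apply => r rI.
  have rI' : s mu <= r <= T.
    by case/andP: rI => ar rb; rewrite (le_trans sa)//= (le_trans rb).
  rewrite subr0; apply: (le_trans (HBu _ _ (HBm _ _ mum rI'))).
  by apply: ler_wpM2l => //; exact: Hy.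
(* This controls the solutions at times of order mu, where they are still close to [y0]. *)
have Hinit mu t : 0 < mu < mu0 -> s mu <= t <= T -> `|ym mu t - y0| <= L2 * t + C * mu.
  move=> mum /andP[st tT]; have [s0 sC sT ys] := Hs mu mum.
  rewrite -(subrK (ym mu (s mu)) (ym mu t)) -addrA; apply: (le_trans (ler_normD _ _)).
  apply: lerD => //; apply: (le_trans (Hlip mu _ _ mum (lexx _) st tT)).
  by apply: ler_wpM2l => //; lra.
pose C3 := L2 * C + C; have C30 : 0 <= C3 by rewrite addr_ge0// mulr_ge0.
have C3E : C3 = L2 * C + C by [].
clearbody L2 C3.
(* At the common starting time each solution is within C3 max(mu, nu) of [y0]; the other summand
   bounds the forcing term produced by the difference of the coefficients. *)
pose C4 := G * (2 * C3 + 2 * q%:R * M2 * C).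
have C40 : 0 <= C4 by apply: mulr_ge0 => //; apply: addr_ge0; rewrite !mulr_ge0.
have Hcauchy mu nu t : 0 < mu < mu0 -> 0 < nu < mu0 -> s mu <= t -> s nu <= t -> t <= T ->
    `|ym mu t - ym nu t| <= C4 * Num.max mu nu.
  move=> mum num smt snt tT.
  set N := Num.max mu nu.
  have muN : mu <= N by rewrite le_max lexx.
  have nuN : nu <= N by rewrite le_max lexx orbT.
  have [sm0 smC smT _] := Hs mu mum; have [sn0 snC snT _] := Hs nu num.
  (* The two solutions start at different times, so they are compared from the later one. Their
     difference solves the equation of [mu] with forcing [ym nu r *m (Bm mu r - Bm nu r)]. *)
  pose S := Num.max (s mu) (s nu).
  have SC : S <= C * N by rewrite ge_max (le_trans smC) ?(le_trans snC)// ler_wpM2l.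
  have mS : s mu <= S by rewrite le_max lexx.
  have nS : s nu <= S by rewrite le_max lexx orbT.
  have St : S <= t by rewrite ge_max smt.
  have ST : S <= T by exact: le_trans tT.
  have S0 : 0 <= S by exact: le_trans mS.
  have sb r : S <= r <= T -> (s mu <= r <= T) * (s nu <= r <= T).
    by move=> /andP[Sr ->]; rewrite (le_trans mS)// (le_trans nS).
  have STT : T - S <= T by rewrite lerBlDr lerDl.
  have K0 : 0 <= q%:R * M2 * (2 * C * N).
    by rewrite !mulr_ge0//; apply: le_trans muN; case/andP: mum => /ltW.
  have tI : S <= t <= T by rewrite St.
  have Ssub m : s m <= S -> `[S, T]%classic `<=` `[s m, T]%classic.
    move=> mS' r /itvccP/andP[Sr rT]; apply/itvccP; by rewrite rT (le_trans mS').
  have := HG S T (fun r => ym mu r - ym nu r)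
    (fun r => (ym mu r *m Bm mu r + Lam *m ym mu r *m E) -
              (ym nu r *m Bm nu r + Lam *m ym nu r *m E)) _ STT K0 _ _ t tI.
  move=> /(_ _ _)/le_trans; apply.
  - move=> r rI; apply: hderB.
      by apply: (hder_sub (Ssub _ mS)); exact: (Hd mu r mum (sb r rI).1).1.
    by apply: (hder_sub (Ssub _ nS)); exact: (Hd nu r num (sb r rI).2).1.
  - move=> r rI; have [r1 r2] := sb r rI.
    have -> : (ym mu r *m Bm mu r + Lam *m ym mu r *m E) -
              (ym nu r *m Bm nu r + Lam *m ym nu r *m E) =
      ((ym mu r - ym nu r) *m Bm mu r + Lam *m (ym mu r - ym nu r) *m E) +
      ym nu r *m (Bm mu r - Bm nu r).
      rewrite !mulmxBr !mulmxBl opprD.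
      move: (ym mu r *m _) (ym nu r *m _) (ym nu r *m _) => x1 x2 x3.
      move: (_ *m E) (_ *m E) => w1 w2.
      by rewrite [LHS]addrACA [RHS]addrAC subrKA.
    apply: (le_trans (ler_normD _ _)); apply: lerD; first by apply: HBu; exact: HBm.
    apply: (le_trans (mulmx_norm _ _)); apply: ler_pM => //.
      by apply: ler_wpM2l => //; exact: Hy.
    rewrite -(subrK (B r) (Bm mu r)) -addrA; apply: (le_trans (ler_normD _ _)).
    have H1 := (Hd mu r mum r1).2; have := (Hd nu r num r2).2; rewrite distrC => H2.
    have : C * mu <= C * N by exact: ler_wpM2l.
    have : C * nu <= C * N by exact: ler_wpM2l.
    by lra.
  rewrite /C4 -[leRHS]mulrA; apply: ler_wpM2l => //; rewrite [leRHS]mulrDl; apply: lerD; last first.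
    by rewrite le_eqVlt; apply/orP; left; apply/eqP; ring.
  rewrite -(subrK y0 (ym mu S)) -addrA; apply: (le_trans (ler_normD _ _)).
  have H1 := Hinit mu S mum (sb S (introT andP (conj (lexx _) ST))).1.
  have := Hinit nu S num (sb S (introT andP (conj (lexx _) ST))).2.
  rewrite distrC => H2.
  have : C * mu <= C * N by exact: ler_wpM2l.
  have : C * nu <= C * N by exact: ler_wpM2l.
  have : L2 * S <= L2 * (C * N) by exact: ler_wpM2l.
  by rewrite C3E; lra.
pose C5 := C4 + C; have C50 : 0 <= C5 by rewrite addr_ge0.
(* At t = 0 the limit is set to [y0], because [s mu] may be positive for every [mu] and then no
   solution reaches 0. For t > 0 all small [mu] satisfy [s mu <= t]. Outside [0, T] the value 0 is a
   default. *)
have /choice[y yP] : forall t, exists l : 'M[R]_(p, q), (t = 0 -> l = y0) /\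
    (0 <= t <= T -> forall mu, 0 < mu < mu0 -> s mu <= t -> `|ym mu t - l| <= C5 * mu).
  move=> t; have [->|t0] := eqVneq t 0.
    exists y0; split=> // _ mu mum st.
    have t0T : s mu <= 0 <= T by rewrite st ltW.
    apply: (le_trans (Hinit mu 0 mum t0T)); rewrite mulr0 add0r.
    by apply: ler_wpM2r; [case/andP: mum => /ltW|rewrite /C5 lerDr].
  have [tI|/negP tI] := boolP (0 <= t <= T); last first.
    by exists 0; split=> [/eqP|//]; rewrite (negbTE t0).
  have tp : 0 < t by rewrite lt_neqAle eq_sym t0; case/andP: tI.
  have C10 : 0 < C + 1 by rewrite ltr_wpDl.
  pose m0 := Num.min mu0 (t / (C + 1)).
  have m0p : 0 < m0 by rewrite lt_min m00 divr_gt0.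
  have m0P mu : 0 < mu < m0 -> 0 < mu < mu0 /\ s mu <= t.
    move=> /andP[mup]; rewrite lt_min => /andP[mu1 mu2].
    have mum : 0 < mu < mu0 by rewrite mup.
    split=> //; have [_ sC _ _] := Hs mu mum; apply: (le_trans sC).
    by move: mu2; rewrite ltr_pdivlMr//; nra.
  have [mu nu mum num|l Hl] := @cauchy_at_right p q (fun mu => ym mu t) C4 m0 m0p C40.
    have [mu1 mu2] := m0P _ mum; have [nu1 nu2] := m0P _ num.
    by apply: Hcauchy => //; case/andP: tI.
  exists l; split=> [/eqP|_ mu mum smt]; first by rewrite (negbTE t0).
  have mup : 0 < mu by case/andP: mum.
  apply: (@le_trans _ _ (C4 * mu)); last first.
    by apply: ler_wpM2r; [exact: ltW|rewrite /C5 lerDl].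
  (* The rate of [cauchy_at_right] holds for mu < m0 only. Any other [mu] with [s mu <= t] is
     compared with a smaller nu, which then tends to 0. *)
  apply: (@le_addM_small _ _ C4 (Num.min m0 mu)); first by rewrite lt_min m0p.
  move=> nu /andP[nup]; rewrite lt_min => /andP[num numu].
  have num' : 0 < nu < m0 by rewrite nup.
  have [nu1 nu2] := m0P _ num'.
  rewrite -(subrK (ym nu t) (ym mu t)) -addrA; apply: (le_trans (ler_normD _ _)).
  apply: lerD; last exact: Hl.
  have := Hcauchy mu nu t mum nu1 smt nu2; rewrite max_l ?(ltW numu)//; apply.
  by case/andP: tI.
have y_lim mu t : 0 < mu < mu0 -> s mu <= t <= T -> `|ym mu t - y t| <= C5 * mu.
  by move=> mum tI; apply: (yP t).2 => //; [exact: sub tI|case/andP: tI].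
have y_0 : y 0 = y0 by exact: (yP 0).1.
have small a : 0 < a -> exists2 m0, 0 < m0 & forall mu, 0 < mu < m0 -> 0 < mu < mu0 /\ s mu <= a.
  move=> ap; have C10 : 0 < C + 1 by rewrite ltr_wpDl.
  exists (Num.min mu0 (a / (C + 1))); first by rewrite lt_min m00 divr_gt0.
  move=> mu /andP[mup]; rewrite lt_min => /andP[mu1 mu2].
  have mum : 0 < mu < mu0 by rewrite mup.
  split=> //; have [_ sC _ _] := Hs mu mum; apply: (le_trans sC).
  by move: mu2; rewrite ltr_pdivlMr//; nra.
have y_lip a b : 0 <= a -> a <= b -> b <= T -> `|y b - y a| <= L2 * (b - a).
  move=> a0 ab bT.
  have [b0|b0] := leP b 0.
    have -> : b = a by lra.
    by rewrite !subrr normr0 mulr0.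
  (* At a = 0 the approximating solutions give no value, and [Hinit] replaces their Lipschitz
     bound. *)
  have [an0|ap] := leP a 0.
    have aE : a = 0 by lra.
    rewrite {}aE y_0 subr0; have [m0 m0p Hm0] := small b b0.
    apply: (@le_addM_small _ _ (C + C5) m0 m0p) => mu /Hm0[mum smb].
    have bI : s mu <= b <= T by rewrite smb.
    rewrite -(subrK (ym mu b) (y b)) -addrA; apply: (le_trans (ler_normD _ _)).
    have := y_lim mu b mum bI; have := Hinit mu b mum bI.
    by rewrite [in X in _ -> X -> _]distrC; lra.
  have [m0 m0p Hm0] := small a ap.
  apply: (@le_addM_small _ _ (C5 + C5) m0 m0p) => mu /Hm0[mum sma].
  have aI : s mu <= a <= T by rewrite sma (le_trans ab).
  have bI : s mu <= b <= T by rewrite (le_trans sma).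
  have -> : y b - y a = (y b - ym mu b) + (ym mu b - ym mu a) + (ym mu a - y a).
    by rewrite subrKA addrA subrK.
  apply: (le_trans (ler_normD _ _)).
  have H1 := y_lim mu b mum bI; rewrite distrC in H1; have H2 := y_lim mu a mum aI.
  have H3 := Hlip mu a b mum sma ab bT.
  have H4 := ler_normD (y b - ym mu b) (ym mu b - ym mu a).
  by lra.
have yc : {within `[0, T], continuous y}.
  apply/within_ctsP => x /itvccP/andP[x0 xT] e e0.
  have L210 : 0 < L2 + 1 by rewrite ltr_wpDl.
  exists (e / (L2 + 1)); first by rewrite divr_gt0.
  move=> t /itvccP/andP[t0 tT]; rewrite ltr_pdivlMr// => tx.
  have bound a b : 0 <= a -> a <= b -> b <= T -> `|b - a| * (L2 + 1) < e -> `|y b - y a| < e.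
    move=> a0 ab bT; rewrite ger0_norm ?subr_ge0// => H.
    apply: (le_lt_trans (y_lip a b a0 ab bT)); apply: le_lt_trans H.
    by have : 0 <= b - a; [rewrite subr_ge0|move: (b - a) => d d0; lra].
  have [xt|/ltW xt] := leP x t; first exact: bound.
  by rewrite distrC; apply: bound => //; rewrite distrC.
pose g t := y t *m B t + Lam *m y t *m E.
have cst_c r1 r2 (N : 'M[R]_(r1, r2)) : {within `[0, T], continuous (fun=> N)}.
  by apply: continuous_subspaceT => ?; exact: cvg_cst.
have gc : {within `[0, T], continuous g}.
  apply: within_ctsD; first exact: within_cts_mulmx.
  apply: within_cts_mulmx; last exact: cst_c.
  by apply: within_cts_mulmx; first exact: cst_c.
pose C6 := L * C5 + q%:R * M2 * C.
have ym_g mu r : 0 < mu < mu0 -> s mu <= r <= T ->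
    `|ym mu r *m Bm mu r + Lam *m ym mu r *m E - g r| <= C6 * mu.
  move=> mum rI; have -> : ym mu r *m Bm mu r + Lam *m ym mu r *m E - g r =
    ((y r - ym mu r) *m - B r + Lam *m (ym mu r - y r) *m E) + ym mu r *m (Bm mu r - B r).
    rewrite /g mulmxN !mulmxBr !mulmxBl opprB opprD.
    move: (ym mu r *m _) (y r *m _) (ym mu r *m _) => x1 x2 x3.
    move: (_ *m E) (_ *m E) => w1 w2.
    by rewrite [LHS]addrACA [RHS]addrC [RHS]addrA subrKA.
  have := y_lim mu r mum rI; have := Hy mu r mum rI; have [_ BB] := Hd mu r mum rI.
  move=> yM yl; apply: (le_trans (ler_normD _ _)); rewrite /C6 mulrDl; apply: lerD.
    rewrite mulmxN -mulNmx opprB; apply: (@le_trans _ _ (L * `|ym mu r - y r|)).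
      apply: HBu; apply: (le_trans (HMB r (sub _ _ mum rI))).
      by rewrite /M1 lerDl.
    by rewrite -mulrA; apply: ler_wpM2l.
  apply: (le_trans (mulmx_norm _ _)); rewrite -(mulrA _ C); apply: ler_pM => //.
  exact: ler_wpM2l.
(* The mean value inequality with slope [g t] holds for [ym mu] up to O(mu), and passes to the
   limit. *)
have yd t : 0 < t < T -> hder `[0, T] y t (g t).
  move=> /andP[t0 tT] e e0.
  have tI : `[0, T]%classic t by apply/itvccP; rewrite !ltW.
  move/within_ctsP: gc => /(_ t tI e e0)[d d0 Hg].
  (* The bound t / 2 keeps [r] positive, so that for small [mu] the interval between [r] and [t]
     lies after [s mu]. *)
  exists (Num.min d (t / 2)); first by rewrite lt_min d0 divr_gt0.
  move=> r /itvccP/andP[r0 rT]; rewrite lt_min => /andP[rd rt2].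
  have main a b : 0 < a -> a <= b -> b <= T -> (forall c, a <= c <= b -> `|c - t| < d) ->
      `|y b - y a - (b - a) *: g t| <= e * (b - a).
    move=> a0 ab bT Hc; have [m0 m0p Hm0] := small a a0.
    apply: (@le_addM_small _ _ (C6 * (b - a) + C5 + C5) m0 m0p) => mu /Hm0[mum sma].
    have mup : 0 <= mu by case/andP: mum => /ltW.
    have aI : s mu <= a <= T by rewrite sma (le_trans ab).
    have bI : s mu <= b <= T by rewrite (le_trans sma).
    have C6m : 0 <= C6 * mu by apply: le_trans (ym_g mu a mum aI).
    have -> : y b - y a - (b - a) *: g t =
       (y b - ym mu b) + (ym mu b - ym mu a - (b - a) *: g t) + (ym mu a - y a).
      by rewrite -(addrA (ym mu b)) (subrKA (ym mu b)) (addrC (- ym mu a)) (addrA (y b))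
        (subrKA (ym mu a)) addrAC.
    apply: (le_trans (ler_normD _ _)).
    have H1 := y_lim mu b mum bI; rewrite distrC in H1; have H2 := y_lim mu a mum aI.
    have H4 := ler_normD (y b - ym mu b) (ym mu b - ym mu a - (b - a) *: g t).
    have eC : 0 <= e + C6 * mu by rewrite addr_ge0// ltW.
    have H3 : `|ym mu b - ym mu a - (b - a) *: g t| <= (e + C6 * mu) * (b - a).
      apply: Hmvt => // c cI.
      have cI' : s mu <= c <= T.
        by case/andP: cI => ac cb; rewrite (le_trans sma)//= (le_trans cb).
      have c0 : `[0, T]%classic c by apply/itvccP; exact: sub cI'.
      rewrite -(subrK (g c) (ym mu c *m Bm mu c + Lam *m ym mu c *m E)) -[X in `|X|]addrA; apply: (le_trans (ler_normD _ _)).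
      rewrite (addrC e); apply: lerD; first exact: (ym_g mu c mum cI').
      apply/ltW/Hg; first exact: c0.
      exact: Hc.
    by lra.
  have [tr|rt] := leP t r.
    rewrite [in leRHS]ger0_norm ?subr_ge0//; apply: main => // c /andP[tc cr].
    by apply: le_lt_trans rd; exact: dist_between_l.
  have rp : 0 < r by exact: gt0_of_close rt2.
  rewrite [in leRHS]ltr0_norm ?subr_lt0// opprB.
  have -> : y r - y t - (r - t) *: g t = - (y t - y r - (t - r) *: g t).
    by rewrite -(opprB t r) scaleNr opprK [RHS]opprB (opprB (y t)) addrC.
  rewrite normrN; apply: main => //; [exact: ltW|exact: ltW|].
  by move=> c /andP[rc ct]; apply: le_lt_trans rd; exact: dist_between_r.
exists y, (M2 + C5); split=> //.
- exact: addr_ge0.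
- exact: hder_closed.
- by move=> mu t mum tI; apply: (le_trans (Hy mu t mum tI)); rewrite lerDl.
- move=> mu t mum tI; apply: (le_trans (y_lim mu t mum tI)).
  by apply: ler_wpM2r; [case/andP: mum => /ltW|rewrite lerDr].
Qed.

End LinearLimit.

(** * The pair (v, z) as one row block *)

Section RowPair.
Variables (R : realType) (k n : nat).
Local Notation M := 'M[R]_(k, n).

Lemma norm_row_mx_le m (a : 'M[R]_(m, n)) (b : 'M[R]_(m, n)) c : 0 <= c ->
  `|a| <= c -> `|b| <= c -> `|row_mx a b| <= c.
Proof.
move=> c0 ac bc; apply: mx_norm_le => // i j; rewrite mxE.
by case: splitP => j' _; [apply: le_trans ac|apply: le_trans bc]; exact: mx_entry_le.
Qed.

Lemma norm_lsubmx m (y : 'M[R]_(m, n + n)) : `|lsubmx y| <= `|y|.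
Proof. by apply: mx_norm_le => // i j; rewrite mxE mx_entry_le. Qed.

Lemma norm_rsubmx m (y : 'M[R]_(m, n + n)) : `|rsubmx y| <= `|y|.
Proof. by apply: mx_norm_le => // i j; rewrite mxE mx_entry_le. Qed.

Lemma hder_row_mx (A : set R) (v z : R -> M) t v' z' :
  hder A v t v' -> hder A z t z' ->
  hder A (fun t => row_mx (v t) (z t)) t (row_mx v' z').
Proof.
move=> /hder_mx Hv /hder_mx Hz; apply/hder_mx => i j.
case: (split_ordP j) => j' ->.
  rewrite row_mxEl (_ : (fun _ => _) = fun t => v t i j')//.
  by apply/funext => s; rewrite row_mxEl.
rewrite row_mxEr (_ : (fun _ => _) = fun t => z t i j')//.
by apply/funext => s; rewrite row_mxEr.
Qed.

Lemma hder_lsubmx (A : set R) (y : R -> 'M[R]_(k, n + n)) t y' :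
  hder A y t y' -> hder A (fun t => lsubmx (y t)) t (lsubmx y').
Proof.
apply: (@hder_lin _ _ _ lsubmx 1) => // [a u v|u]; first by rewrite linearP.
by rewrite mul1r norm_lsubmx.
Qed.

Lemma hder_rsubmx (A : set R) (y : R -> 'M[R]_(k, n + n)) t y' :
  hder A y t y' -> hder A (fun t => rsubmx (y t)) t (rsubmx y').
Proof.
apply: (@hder_lin _ _ _ rsubmx 1) => // [a u v|u]; first by rewrite linearP.
by rewrite mul1r norm_rsubmx.
Qed.

(** Right multiplication of the row (v, z) by [pairB A] gives v A + z in the first block, while
    [pairE] moves v into the second block, where the equation of z has the term Lam v. *)
Definition pairE : 'M[R]_(n + n) := block_mx 0 1%:M 0 0.
Definition pairB (A : 'M[R]_n) : 'M[R]_(n + n) := block_mx A 0 1%:M 0.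

Lemma pair_rhs (Lam : 'M[R]_k) (A : 'M[R]_n) (v z : M) :
  row_mx v z *m pairB A + Lam *m row_mx v z *m pairE =
  row_mx (v *m A + z) (Lam *m v).
Proof.
rewrite /pairB /pairE mul_mx_row !mul_row_block !mulmx0 !mulmx1 !addr0.
by rewrite add_row_mx addr0 add0r.
Qed.

Lemma norm_pairB (A A' : 'M[R]_n) : `|pairB A - pairB A'| <= `|A - A'|.
Proof.
rewrite /pairB opp_block_mx add_block_mx !subrr.
apply: mx_norm_le => // i j; rewrite mxE; case: splitP => i' _.
  rewrite mxE; case: splitP => j' _; first exact: mx_entry_le.
  by rewrite mxE normr0.
by rewrite row_mx0 mxE normr0.
Qed.

Lemma linear_limit (Lam : 'M[R]_k) (T C mu0 : R)
    (A : R -> 'M[R]_n) (Am : R -> R -> 'M[R]_n) (s : R -> R) (v0 z0 : M)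
    (vm zm : R -> R -> M) :
  0 < T -> 0 < mu0 -> 0 <= C -> {within `[0, T], continuous A} ->
  (forall mu, 0 < mu < mu0 -> [/\ 0 <= s mu, s mu <= C * mu, s mu <= T,
    `|vm mu (s mu) - v0| <= C * mu & `|zm mu (s mu) - z0| <= C * mu]) ->
  (forall mu t, 0 < mu < mu0 -> s mu <= t <= T ->
    [/\ hder `[s mu, T] (vm mu) t (vm mu t *m Am mu t + zm mu t),
        hder `[s mu, T] (zm mu) t (Lam *m vm mu t) &
        `|Am mu t - A t| <= C * mu]) ->
  exists (v z : R -> M) (C' : R), [/\ 0 <= C', v 0 = v0 /\ z 0 = z0,
    forall t, 0 <= t <= T -> hder `[0, T] v t (v t *m A t + z t) /\
      hder `[0, T] z t (Lam *m v t),
    forall mu t, 0 < mu < mu0 -> s mu <= t <= T -> `|vm mu t| <= C' &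
    forall mu t, 0 < mu < mu0 -> s mu <= t <= T ->
      `|vm mu t - v t| <= C' * mu /\ `|zm mu t - z t| <= C' * mu].
Proof.
move=> T0 m00 C0 Ac Hs Hd.
have Bc : {within `[0, T], continuous (fun t => pairB (A t))}.
  move/within_ctsP : Ac => Ac; apply/within_ctsP => x Ax e e0.
  have [d d0 H] := Ac x Ax e e0; exists d => // y Ay yx.
  exact: le_lt_trans (norm_pairB _ _) (H y Ay yx).
have [|mu t mum tI|y [C' [C'0 y0 yd yb yl]]] :=
  @linear_limit_row R k (n + n) Lam pairE T C mu0 (fun t => pairB (A t))
    (fun mu t => pairB (Am mu t)) s (row_mx v0 z0)
    (fun mu t => row_mx (vm mu t) (zm mu t)) T0 m00 C0 Bc.
- move=> mu mum; have [s0 sC sT vs zs] := Hs mu mum; split=> //.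
  rewrite opp_row_mx add_row_mx; apply: norm_row_mx_le => //.
  by apply: le_trans vs.
- have [Hv Hz HA] := Hd mu t mum tI; split.
    by rewrite pair_rhs; exact: hder_row_mx.
  exact: le_trans (norm_pairB _ _) HA.
exists (fun t => lsubmx (y t)), (fun t => rsubmx (y t)), C'; split => //.
- by rewrite y0 row_mxKl row_mxKr.
- move=> t tI; have := yd t tI; rewrite -[y t]hsubmxK pair_rhs hsubmxK => H.
  split; first by have := hder_lsubmx H; rewrite row_mxKl.
  by have := hder_rsubmx H; rewrite row_mxKr.
- move=> mu t mum tI; apply: le_trans (yb mu t mum tI).
  by rewrite -[X in `|X| <= _](row_mxKl _ (zm mu t)) norm_lsubmx.
move=> mu t mum tI; have := yl mu t mum tI.
rewrite -{1}[y t]hsubmxK opp_row_mx add_row_mx => H; split.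
  apply: le_trans H; set X := vm _ _ - _; set Y := zm _ _ - _.
  by rewrite -[X in `|X| <= _](row_mxKl X Y) norm_lsubmx.
apply: le_trans H; set X := vm _ _ - _; set Y := zm _ _ - _.
by rewrite -[X in `|X| <= _](row_mxKr X Y) norm_rsubmx.
Qed.

End RowPair.

(** * Tracking and the layer estimate *)

Section Tracking.
Variables (R : realType) (n : nat).
Implicit Types (a b t : R).

Lemma hder_subI (W : normedModType R) a b a' b' (g : R -> W) t l :
  a <= a' -> b' <= b -> hder `[a, b] g t l -> hder `[a', b'] g t l.
Proof.
move=> aa bb; apply: hder_sub => s /itvccP/andP[as_ sb].
by apply/itvccP; rewrite (le_trans aa)// (le_trans sb).
Qed.

Lemma within_cts_norm m p a b (y : R -> 'M[R]_(m, p)) c :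
  {within `[a, b], continuous y} -> {within `[a, b], continuous (fun t => `|y t - c| : R^o)}.
Proof.
move/within_ctsP => H; apply/(@within_ctsP _ R^o) => x Ax e e0.
have [d d0 Hd] := H x Ax e e0; exists d => // s As sx.
apply: le_lt_trans (Hd s As sx); apply: le_trans (ler_dist_dist _ _) _.
by rewrite opprB addrA subrK.
Qed.

Lemma lipschitz_mvt m p a b (y y' : R -> 'M[R]_(m, p)) K : a <= b -> 0 <= K ->
  (forall t, a <= t <= b -> hder `[a, b] y t (y' t)) ->
  (forall t, a <= t <= b -> `|y' t| <= K) -> `|y b - y a| <= K * (b - a).
Proof.
move=> ab K0 Hd HK.
have := @mvt_mx _ _ _ a b y y' 0 K ab _ _ K0; rewrite scaler0 subr0; apply.
- by apply: hder_within_continuous => t /itvccP; exact: Hd.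
- by move=> t /andP[at_ tb]; apply: Hd; rewrite !ltW.
- by move=> t /andP[at_ tb]; rewrite subr0 HK// !ltW.
Qed.

(** The speed bound is available only inside the ball. As long as the curve stays there it has moved
    at most [M * t], and the strict inequality [M * tau < rho] lets continuous induction close the
    argument. *)
Lemma stay_in_ball (tau M rho : R) (eta eta' : R -> 'rV[R]_n) w :
  0 <= M -> M * tau < rho -> eta 0 = w ->
  (forall t, 0 <= t <= tau -> hder `[0, tau] eta t (eta' t)) ->
  (forall t, 0 <= t <= tau -> `|eta t - w| <= rho -> `|eta' t| <= M) ->
  forall t, 0 <= t <= tau -> `|eta t - w| <= M * t /\ `|eta t - w| < rho.
Proof.
move=> M0 Mtau eta0 Hd HM.
have key t : 0 <= t <= tau -> (forall s, 0 <= s <= t -> `|eta s - w| <= rho) ->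
    `|eta t - w| <= M * t.
  move=> /andP[t0 tt] H.
  have sub s : 0 <= s <= t -> 0 <= s <= tau.
    by move=> /andP[-> st]; exact: le_trans tt.
  have := @lipschitz_mvt _ _ 0 t eta eta' M t0 M0 _ _.
  rewrite eta0 subr0; apply => s sI; last by apply: HM; [exact: sub|exact: H].
  by apply: (@hder_subI _ 0 tau) => //; apply: Hd; exact: sub.
have lt_rho t : 0 <= t <= tau -> M * t < rho.
  by move=> /andP[t0 tt]; apply: le_lt_trans Mtau; exact: ler_wpM2l.
have H := @continuous_induction R 0 tau (fun t => `|eta t - w|) rho.
have {}H : forall t, 0 <= t <= tau -> `|eta t - w| < rho.
  move=> t tI; have tau0 : 0 <= tau by case/andP: tI => ? ?; lra.
  apply: H tI.
  - apply: within_cts_norm; apply: hder_within_continuous => s /itvccP; exact: Hd.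
  - by rewrite eta0 subrr normr0; apply: le_lt_trans (lt_rho 0 _); rewrite ?mulr0 ?lexx.
  - by move=> s sI Hs; apply: le_lt_trans (lt_rho s sI); exact: key.
move=> t tI; split; last exact: H.
apply: key => // s /andP[s0 st]; apply/ltW/H; rewrite s0.
by case/andP: tI => _; exact: le_trans.
Qed.

(** Gronwall's lemma for a differential inequality known only while [x] is small: the bound it
    yields is below [r], so the range of validity is never left. With [x a = 0] it is a uniqueness
    statement. *)
Lemma tracking m p (L T : R) : 0 <= L -> 0 <= T ->
  exists2 C : R, 1 <= C & forall a b r (x x' : R -> 'M[R]_(m, p)), b - a <= T ->
  (forall t, a <= t <= b -> hder `[a, b] x t (x' t)) ->
  (forall t, a <= t <= b -> `|x t| <= r -> `|x' t| <= L * `|x t|) ->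
  C * `|x a| < r ->
  forall t, a <= t <= b -> `|x t| <= C * `|x a| /\ `|x t| < r.
Proof.
move=> L0 T0; have [C C1 HC] := @gronwall R m p L T L0 T0.
exists C => // a b r x x' bT Hd Hb Cr.
have key t : a <= t <= b -> (forall s, a <= s <= t -> `|x s| <= r) ->
    `|x t| <= C * `|x a|.
  move=> /andP[at_ tb] H.
  have sub s : a <= s <= t -> a <= s <= b.
    by move=> /andP[-> st]; exact: le_trans tb.
  have tT : t - a <= T by lra.
  have := HC a t x x' 0 tT (lexx _) _ _ t; rewrite addr0; apply.
  - by move=> s sI; apply: (@hder_subI _ a b) => //; apply: Hd; exact: sub.
  - by move=> s sI; rewrite addr0; apply: Hb; [exact: sub|exact: H].
  - by rewrite at_ lexx.
have {}H : forall t, a <= t <= b -> `|x t| < r.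
  move=> t tI.
  apply: (@continuous_induction R a b (fun t => `|x t|) r) tI.
  - have : {within `[a, b], continuous x}.
      by apply: hder_within_continuous => s /itvccP; exact: Hd.
    move=> /(@within_cts_norm _ _ _ _ _ 0) /(@within_ctsP _ R^o) H.
    by apply/(@within_ctsP _ R^o) => y Ay e e0; have [d d0 Hd'] := H y Ay e e0;
      exists d => // z Az zy; have := Hd' z Az zy; rewrite !subr0.
  - by apply: le_lt_trans Cr; rewrite -[leLHS]mul1r ler_wpM2r.
  - by move=> s sI Hs; apply: le_lt_trans Cr; exact: key.
move=> t tI; split; last exact: H.
apply: key => // s /andP[s0 st]; apply/ltW/H; rewrite s0.
by case/andP: tI => _; exact: le_trans.
Qed.

End Tracking.

Section Layer.
Variables (R : realType) (n k : nat).
Implicit Types (t : R).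

Lemma hder_inv (A : set R) (psi : R -> R) t (l : R) : psi t != 0 ->
  hder A (psi : R -> R^o) t l ->
  hder A (fun t => (psi t)^-1 : R^o) t (- l / psi t ^+ 2).
Proof.
move=> p0 H.
have dV : differentiable (@GRing.inv R : R -> R^o) (psi t) by exact: differentiable_Rinv.
have := @hder_comp R R^o R^o (@GRing.inv R) A psi t l dV H.
by rewrite diff_Rinv//= /GRing.scale/= mulrC mulNr mulrN.
Qed.

Lemma norm_convex m p (Phi M : R) (a b : 'M[R]_(m, p)) : 0 <= Phi <= 1 ->
  `|a| <= M -> `|b| <= M -> `|Phi *: a + (1 - Phi) *: b| <= M.
Proof.
move=> /andP[P0 P1] aM bM; apply: (le_trans (ler_normD _ _)).
rewrite !normrZ (ger0_norm P0) ger0_norm ?subr_ge0//.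
have : Phi * `|a| <= Phi * M by exact: ler_wpM2l.
have : (1 - Phi) * `|b| <= (1 - Phi) * M by rewrite ler_wpM2l// subr_ge0.
by lra.
Qed.

Ltac nonneg := repeat first
  [ assumption | exact: normr_ge0 | exact: ler0n | exact: ler01 | exact: sqr_ge0
  | apply: mulr_ge0 | apply: addr_ge0 ].

(* With p = Phi a + (1 - Phi) b, al = <n, V> / <n, p> and X = V - Phi al (a - b),
   the large factor kappa cancels in the equations of al and X. *)
Lemma layer (nn : 'rV[R]_n) (Lam : 'M[R]_k) (c M tau : R) (V0 Z0 : 'M[R]_(k, n))
    (psi0 : R) :
  0 < c -> 0 <= M -> 0 <= tau ->
  exists2 C : R, 0 <= C &
  forall (p a b : R -> 'rV[R]_n) (Jp Jm : R -> 'M[R]_n) (Phi kappa : R -> R)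
    (V Z : R -> 'M[R]_(k, n)),
  (forall t, 0 <= t <= tau ->
    [/\ hder `[0, tau] a t (p t *m Jp t), hder `[0, tau] b t (p t *m Jm t),
        hder `[0, tau] (Phi : R -> R^o) t (kappa t * dot nn (p t)),
        p t = Phi t *: a t + (1 - Phi t) *: b t & 0 <= Phi t <= 1]) ->
  (forall t, 0 <= t <= tau ->
    [/\ `|a t| <= M, `|b t| <= M, `|Jp t| <= M & `|Jm t| <= M]) ->
  (forall t, 0 <= t <= tau -> c <= dot nn (a t) /\ c <= dot nn (b t)) ->
  (forall t, 0 <= t <= tau ->
     hder `[0, tau] V t (V t *m (Phi t *: Jp t + (1 - Phi t) *: Jm t +
       kappa t *: (nn^T *m (a t - b t))) + Z t) /\
     hder `[0, tau] Z t (Lam *m V t)) ->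
  [/\ V 0 = V0, Z 0 = Z0, Phi 0 = 0 & psi0 = dot nn (b 0)] ->
  forall t, 0 <= t <= tau ->
    [/\ `|V t| <= C, `|Z t - Z0| <= C * t &
     `|V t - (V0 + (psi0^-1 *: (V0 *m nn^T)) *m (Phi t *: (a 0 - b 0)))| <= C * t].
Proof.
move=> c0 M0 tau0.
pose N := `|nn^T|; have N0 : 0 <= N by exact: normr_ge0.
(* With S = |X| + |al| + |Z|, the bounds proved below are e0 S for [V], e1 S for [W], e2 for [D], e3
   S for [al1], e4 for [q1], e5 S for [X1] and e6 S for [Lam *m V]. All are fixed before [Phi] and
   [kappa], hence independent of mu. *)
pose e0 := 1 + 2 * M; have e00 : 0 <= e0 by nonneg.
pose e1 := n%:R * M * e0 + 1; have e10 : 0 <= e1 by nonneg.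
pose e2 := n%:R * `|nn| * (3 * n%:R * M ^+ 2).
have e20 : 0 <= e2 by nonneg.
have c10 : 0 <= c^-1 by rewrite invr_ge0 ltW.
pose e3 := c^-1 * (n%:R * e1 * N + e2).
have e30 : 0 <= e3 by nonneg.
pose e4 := 2 * n%:R * M ^+ 2; have e40 : 0 <= e4 by nonneg.
pose e5 := e1 + e3 * (2 * M) + e4.
have e50 : 0 <= e5 by nonneg.
pose e6 := k%:R * `|Lam| * e0; have e60 : 0 <= e6 by nonneg.
pose L := e3 + e5 + e6; have L0 : 0 <= L by nonneg.
have [G G1 HG] := @gronwall3 R k n k 1 k n L tau L0 tau0.
have G0 : 0 <= G by exact: le_trans G1.
pose al0 := psi0^-1 *: (V0 *m nn^T).
pose S0 := `|V0| + `|al0| + `|Z0|; have S00 : 0 <= S0 by nonneg.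
pose C1 := L * (G * S0); have C10 : 0 <= C1 by nonneg.
have M20 : 0 <= 2 * M by nonneg.
pose C := e0 * (G * S0) + C1 + C1 * (2 * M) + `|al0| * e4.
exists C; first by nonneg.
move=> p a b Jp Jm Phi kappa V Z Hab HM Hc HV [V00 Z00 Phi0 psi0E].
pose q t := a t - b t.
pose psi t := dot nn (p t).
pose q1 t := p t *m Jp t - p t *m Jm t.
pose al t := (psi t)^-1 *: (V t *m nn^T).
pose X t := V t - al t *m (Phi t *: q t).
(* [W] and [D] are the derivatives of [V] and [psi] without their terms in [kappa]; [al1] and [X1]
   turn out to be the derivatives of [al] and [X]. *)
pose W t := V t *m (Phi t *: Jp t + (1 - Phi t) *: Jm t) + Z t.
pose D t := dot nn (p t *m Jm t + Phi t *: q1 t).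
pose al1 t := (psi t)^-1 *: (W t *m nn^T - D t *: al t).
pose X1 t := W t - al1 t *m (Phi t *: q t) - al t *m (Phi t *: q1 t).
have psic t : 0 <= t <= tau -> c <= psi t.
  move=> tI; have [_ _ _ pE /andP[P0 P1]] := Hab t tI; have [ca cb] := Hc t tI.
  rewrite /psi pE dotD !dotZ.
  have : Phi t * c <= Phi t * dot nn (a t) by exact: ler_wpM2l.
  have : (1 - Phi t) * c <= (1 - Phi t) * dot nn (b t) by rewrite ler_wpM2l// subr_ge0.
  by lra.
have psi_gt0 t : 0 <= t <= tau -> 0 < psi t by move=> /psic; exact: lt_le_trans.
have alE t : 0 <= t <= tau -> V t *m nn^T = psi t *: al t.
  by move=> /psi_gt0 pp; rewrite /al scalerA divff ?gt_eqF// scale1r.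
have qd t : 0 <= t <= tau -> hder `[0, tau] q t (q1 t).
  by move=> tI; have [Ha Hb _ _ _] := Hab t tI; exact: hderB.
have Phiqd t : 0 <= t <= tau -> hder `[0, tau] (fun t => Phi t *: q t) t
    ((kappa t * psi t) *: q t + Phi t *: q1 t).
  by move=> tI; have [_ _ HP _ _] := Hab t tI; apply: hder_scale => //; exact: qd.
have pd t : 0 <= t <= tau -> hder `[0, tau] p t
    (p t *m Jm t + ((kappa t * psi t) *: q t + Phi t *: q1 t)).
  move=> tI; have [_ Hb _ _ _] := Hab t tI.
  apply: (@hder_ext _ _ _ (fun t => b t + Phi t *: q t)); first exact/itvccP.
    move=> s /itvccP sI; have [_ _ _ -> _] := Hab s sI.
    by rewrite /q scalerBr scalerBl scale1r addrC addrA addrAC.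
  by apply: hderD => //; exact: Phiqd.
have dotq t : q t *m nn^T = (dot nn (q t))%:M by rewrite [LHS]mx11_scalar dotE dotC.
have psid t : 0 <= t <= tau -> hder `[0, tau] (psi : R -> R^o) t
    (D t + kappa t * psi t * dot nn (q t)).
  move=> /pd /(hder_dot nn); congr (hder _ _ _ _).
  by rewrite /D; move: (q t) (q1 t) => Q Q1; rewrite !dotD !dotZ; ring.
have VE t : 0 <= t <= tau ->
    V t *m (Phi t *: Jp t + (1 - Phi t) *: Jm t + kappa t *: (nn^T *m (a t - b t))) + Z t =
    W t + (kappa t * psi t) *: (al t *m q t).
  move=> tI; rewrite -/(q t) mulmxDr -scalemxAr mulmxA alE// -scalemxAl scalerA /W.
  by rewrite addrAC.
(* The term kappa <n, q> al occurs twice with opposite signs, once from the derivative of [V] and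
   once from that of 1 / psi. *)
have ald t : 0 <= t <= tau -> hder `[0, tau] al t (al1 t).
  move=> tI; have pp := psi_gt0 t tI; have pn0 := lt0r_neq0 pp.
  have H1 := hder_inv pn0 (psid t tI).
  have H2 := hder_mulmx (HV t tI).1 (hder_cst `[0, tau] nn^T t).
  have := hder_scale H1 H2; congr (hder _ _ _ _).
  rewrite /al1 mulmx0 addr0 VE// mulmxDl -scalemxAl -mulmxA dotq mul_mx_scalar alE//.
  move: (al t) (W t *m nn^T) (D t) (dot nn (q t)) (kappa t) => x y d Q ka.
  by apply/matrixP => i j; rewrite !mxE; field.
(* The term kappa psi al q of the derivative of [V] is the derivative of [Phi] times al q, and [X]
   subtracts it. *)
have Xd t : 0 <= t <= tau -> hder `[0, tau] X t (X1 t).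
  move=> tI; have := hderB (HV t tI).1 (hder_mulmx (ald t tI) (Phiqd t tI)).
  congr (hder _ _ _ _).
  rewrite VE// /X1 (mulmxDr (al t) (_ *: q t)) -(scalemxAr (kappa t * psi t)).
  move: (al1 t *m _) ((kappa t * psi t) *: (al t *m q t)) (al t *m (Phi t *: q1 t)) => x y z.
  by apply/matrixP => i j; rewrite !mxE; ring.
pose S t := `|X t| + `|al t| + `|Z t|.
have S_ge0 t : 0 <= S t by nonneg.
have alS t : `|al t| <= S t by rewrite /S addrAC lerDr addr_ge0.
have XS t : `|X t| <= S t by rewrite /S -addrA lerDl addr_ge0.
have ZS t : `|Z t| <= S t by rewrite /S lerDr addr_ge0.
have q_le t : 0 <= t <= tau -> `|q t| <= 2 * M.
  move=> tI; have [Ma Mb _ _] := HM t tI; apply: (le_trans (ler_normB _ _)).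
  by rewrite mulr_natl mulr2n lerD.
have p_le t : 0 <= t <= tau -> `|p t| <= M.
  move=> tI; have [_ _ _ -> PI] := Hab t tI; have [Ma Mb _ _] := HM t tI.
  exact: norm_convex.
have pJ_le t (J : 'M[R]_n) : 0 <= t <= tau -> `|J| <= M -> `|p t *m J| <= n%:R * M ^+ 2.
  move=> tI JM; apply: (le_trans (mulmx_norm _ _)).
  rewrite expr2 mulrA; apply: ler_pM => //.
  by apply: ler_wpM2l => //; exact: p_le.
have q1_le t : 0 <= t <= tau -> `|q1 t| <= e4.
  move=> tI; have [_ _ Mp Mm] := HM t tI; apply: (le_trans (ler_normB _ _)).
  have := pJ_le t _ tI Mp; have := pJ_le t _ tI Mm; rewrite /e4; lra.
have Phi_le m r (x : 'M[R]_(m, r)) t : 0 <= t <= tau -> `|Phi t *: x| <= `|x|.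
  move=> tI; have [_ _ _ _ /andP[P0 P1]] := Hab t tI.
  by rewrite normrZ ger0_norm// -[leRHS]mul1r ler_wpM2r.
have colrow (x : 'cV[R]_k) (y : 'rV[R]_n) : `|x *m y| <= `|x| * `|y|.
  by have := mulmx_norm x y; rewrite mul1r.
have VX t : V t = X t + al t *m (Phi t *: q t) by rewrite /X subrK.
have V_le t : 0 <= t <= tau -> `|V t| <= e0 * S t.
  move=> tI; rewrite VX; apply: (le_trans (ler_normD _ _)).
  rewrite /e0 mulrDl mul1r; apply: lerD => //.
  apply: (le_trans (colrow _ _)); rewrite mulrC; apply: ler_pM => //.
  exact: le_trans (Phi_le _ _ _ _ tI) (q_le t tI).
have W_le t : 0 <= t <= tau -> `|W t| <= e1 * S t.
  move=> tI; have [_ _ Mp Mm] := HM t tI; have [_ _ _ _ PI] := Hab t tI.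
  apply: (le_trans (ler_normD _ _)); rewrite /e1 mulrDl mul1r; apply: lerD => //.
  apply: (le_trans (mulmx_norm _ _)).
  have AM := norm_convex PI Mp Mm.
  have -> : n%:R * M * e0 * S t = n%:R * (e0 * S t) * M by ring.
  by apply: ler_pM => //; apply: ler_wpM2l => //; exact: V_le.
have D_le t : 0 <= t <= tau -> `|D t| <= e2.
  move=> tI; have [_ _ Mp Mm] := HM t tI.
  apply: (le_trans (dot_norm_le _ _)); rewrite /e2; apply: ler_wpM2l; first by nonneg.
  apply: (le_trans (ler_normD _ _)).
  have := pJ_le t _ tI Mm; have := le_trans (Phi_le _ _ (q1 t) t tI) (q1_le t tI).
  rewrite /e4; lra.
have al1_le t : 0 <= t <= tau -> `|al1 t| <= e3 * S t.
  move=> tI; have pp := psi_gt0 t tI.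
  have ip : 0 <= (psi t)^-1 by rewrite invr_ge0 ltW.
  rewrite /al1 normrZ (ger0_norm ip) /e3 -[X in _ <= X]mulrA.
  apply: ler_pM => //.
    by rewrite lef_pV2 ?posrE//; exact: psic.
  apply: (le_trans (ler_normB _ _)); rewrite mulrDl; apply: lerD.
    apply: (le_trans (mulmx_norm _ _)); rewrite -/N.
    have -> : n%:R * e1 * N * S t = n%:R * (e1 * S t) * N by ring.
    by apply: ler_pM => //; apply: ler_wpM2l => //; exact: W_le.
  by rewrite normrZ; apply: ler_pM => //; exact: D_le.
have X1_le t : 0 <= t <= tau -> `|X1 t| <= e5 * S t.
  move=> tI; rewrite /X1 /e5 (mulrDl _ e4) (mulrDl e1).
  apply: (le_trans (ler_normB _ _)); apply: lerD; last first.
    apply: (le_trans (colrow _ _)); rewrite mulrC; apply: ler_pM => //.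
    exact: le_trans (Phi_le _ _ _ _ tI) (q1_le t tI).
  apply: (le_trans (ler_normB _ _)); apply: lerD; first exact: W_le.
  apply: (le_trans (colrow _ _)); rewrite mulrAC; apply: ler_pM => //.
    exact: al1_le.
  exact: le_trans (Phi_le _ _ _ _ tI) (q_le t tI).
have Z1_le t : 0 <= t <= tau -> `|Lam *m V t| <= e6 * S t.
  move=> tI; apply: (le_trans (mulmx_norm _ _)); rewrite /e6 -[X in _ <= X]mulrA.
  by apply: ler_wpM2l; [nonneg|exact: V_le].
have SL t e : e <= L -> e * S t <= L * S t by move=> eL; exact: ler_wpM2r.
have e3L : e3 <= L by rewrite /L -addrA lerDl addr_ge0.
have e5L : e5 <= L by rewrite /L addrAC lerDr addr_ge0.
have e6L : e6 <= L by rewrite /L lerDr addr_ge0.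
have I0 : 0 <= (0 : R) <= tau by rewrite lexx.
have X0E : X 0 = V0 by rewrite /X Phi0 scale0r mulmx0 subr0.
have psi00 : psi 0 = psi0.
  by have [_ _ _ pE _] := Hab 0 I0; rewrite /psi pE Phi0 scale0r add0r subr0 scale1r psi0E.
have al0E : al 0 = al0 by rewrite /al psi00 V00.
have S_le t : 0 <= t <= tau -> S t <= G * S0.
  move=> tI; have := HG 0 tau X X1 al al1 Z (fun t => Lam *m V t) 0.
  rewrite subr0 => /(_ (lexx _) (lexx _)) H.
  have {H} := H _ _ t tI; rewrite addr0 X0E al0E Z00; apply.
  - by move=> s sI; split; [exact: Xd|exact: ald|exact: (HV s sI).2].
  - move=> s sI; rewrite !addr0 -/(S s); split.
    + by apply: le_trans (X1_le s sI) _; exact: SL.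
    + by apply: le_trans (al1_le s sI) _; exact: SL.
    + by apply: le_trans (Z1_le s sI) _; exact: SL.
have lip m r (y y' : R -> 'M[R]_(m, r)) K t : 0 <= t <= tau -> 0 <= K ->
    (forall s, 0 <= s <= tau -> hder `[0, tau] y s (y' s)) ->
    (forall s, 0 <= s <= tau -> `|y' s| <= K) -> `|y t - y 0| <= K * t.
  move=> /andP[t0 tt] K0 Hd HK.
  have sub s : 0 <= s <= t -> 0 <= s <= tau by move=> /andP[-> st]; exact: le_trans tt.
  rewrite -[in X in _ <= X](subr0 t); apply: (@lipschitz_mvt _ _ _ 0 t y y') => // s sI; last by apply: HK; exact: sub.
  by apply: (@hder_subI _ _ 0 tau) => //; apply: Hd; exact: sub.
have L_C1 e s : e <= L -> 0 <= s <= tau -> e * S s <= C1.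
  move=> eL sI; apply: (le_trans (SL s e eL)); apply: ler_wpM2l => //; exact: S_le.
move=> t tI.
have t0 : 0 <= t by case/andP: tI.
have Zl : `|Z t - Z 0| <= C1 * t.
  apply: (lip _ _ Z (fun t => Lam *m V t)) => // s sI; first exact: (HV s sI).2.
  by apply: le_trans (Z1_le s sI) _; exact: L_C1.
have Xl : `|X t - X 0| <= C1 * t.
  apply: (lip _ _ X X1) => // s sI.
  by apply: le_trans (X1_le s sI) _; exact: L_C1.
have all : `|al t - al 0| <= C1 * t.
  apply: (lip _ _ al al1) => // s sI.
  by apply: le_trans (al1_le s sI) _; exact: L_C1.
have ql : `|q t - q 0| <= e4 * t.
  exact: (lip _ _ q q1).
have C_ge x : 0 <= x -> [/\ e0 * (G * S0) <= C, C1 * x <= C * x &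
    C1 * x + C1 * (2 * M) * x + `|al0| * e4 * x <= C * x].
  move=> x0; have H1 : 0 <= e0 * (G * S0) by nonneg.
  have H2 : 0 <= C1 * (2 * M) by nonneg.
  have H3 : 0 <= `|al0| * e4 by nonneg.
  have C_terms : [/\ e0 * (G * S0) <= C, C1 <= C & C1 + C1 * (2 * M) + `|al0| * e4 <= C].
    rewrite /C; move: (e0 * _) H1 (C1 * _) H2 (_ * e4) H3 => d1 d10 d2 d20 d3 d30.
    by split; rewrite -!addrA ?lerDl ?lerDr 1?addrCA ?lerDl ?addr_ge0.
  have [T1 T2 T3] := C_terms; split=> //; first exact: ler_wpM2r.
  by rewrite -!mulrDl; exact: ler_wpM2r.
have [HC1 HC2 HC3] := C_ge t t0.
split.
- by apply: le_trans HC1; apply: (le_trans (V_le t tI)); apply: ler_wpM2l => //; exact: S_le.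
- by apply: le_trans HC2; rewrite -Z00.
apply: le_trans HC3.
(* [X], [al] and [q] are compared with their values at time 0, from which each moves by O(t); only
   [Phi], which varies by 1 across the layer, is kept at time [t]. *)
have -> : V t - (V0 + psi0^-1 *: (V0 *m nn^T) *m (Phi t *: (a 0 - b 0))) =
    (X t - X 0) + (al t - al 0) *m (Phi t *: q t) + al0 *m (Phi t *: (q t - q 0)).
  rewrite -/al0 -/(q 0) X0E al0E VX (scalerBr _ (q t)).
  rewrite (mulmxBr al0 (Phi t *: q t)) (mulmxBl (al t) al0).
  move: (al t *m (Phi t *: q t)) (al0 *m (Phi t *: q t)) (al0 *m _) (X t) => x y z u.
  by apply/matrixP => i j; rewrite !mxE; ring.
apply: (le_trans (ler_normD _ _)); apply: lerD.
  apply: (le_trans (ler_normD _ _)); apply: lerD => //.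
  apply: (le_trans (colrow _ _)); rewrite mulrAC; apply: ler_pM => //.
  exact: le_trans (Phi_le _ _ _ _ tI) (q_le t tI).
apply: (le_trans (colrow _ _)); rewrite -[X in _ <= X]mulrA; apply: ler_pM => //.
exact: le_trans (Phi_le _ _ _ _ tI) ql.
Qed.
End Layer.

(** * Crossing the layer *)

Lemma term_le_sum5 (R : realType) (a b c d e : R) :
  0 <= a -> 0 <= b -> 0 <= c -> 0 <= d -> 0 <= e ->
  [/\ a <= a + b + c + d + e, b <= a + b + c + d + e,
      c <= a + b + c + d + e & d <= a + b + c + d + e].
Proof. by move=> *; split; lra. Qed.

Lemma half_lt (R : realType) (r : R) : 0 < r -> r / 2 < r.
Proof. by move=> r0; lra. Qed.

Lemma ge_of_close (R : realType) (mu m x y : R) :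
  mu < m / 2 -> m <= y -> - (m / 2) <= x - y -> mu <= x.
Proof. by move=> *; lra. Qed.

Section Crossing.
Variables (R : realType) (n k : nat) (phi : R -> R).
Hypothesis phi_der : forall y, derivable phi y 1.
Hypothesis phi_one : forall y, 1 <= y -> phi y = 1.
Hypothesis phi_zero : forall y, y <= 0 -> phi y = 0.
Hypothesis phi_incr : forall y, 0 < y < 1 -> 0 < (phi^`())%classic y.
Variables (nn : 'rV[R]_n) (fp fm : 'rV[R]_n -> 'rV[R]_n) (Dp Dm : set 'rV[R]_n).
Variable delta : R.
Hypothesis Dp_open : open Dp.
Hypothesis Dm_open : open Dm.
Hypothesis fp_smooth : forall j, Ck j Dp fp.
Hypothesis fm_smooth : forall j, Ck j Dm fm.
Hypothesis Dp_sub : Uplus nn `|` Sigma nn `<=` Dp.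
Hypothesis delta_gt0 : 0 < delta.
Hypothesis Dm_sub : [set u | dot nn u < delta] `<=` Dm.
Variable T : R.
Hypothesis T_gt0 : 0 < T.
Variables (gamma : R -> 'rV[R]_n) (w : 'rV[R]_n).
Hypothesis gamma_w : gamma 0 = w.
Hypothesis w_Sigma : dot nn w = 0.
Hypothesis fp_w : 0 < dot nn (fp w).
Hypothesis fm_w : 0 < dot nn (fm w).

Local Notation f := (smoothed nn phi fp fm).

Let dfp u : Dp u -> differentiable fp u.
Proof. exact: Ck_differentiable. Qed.

Let dfm u : Dm u -> differentiable fm u.
Proof. exact: Ck_differentiable. Qed.

Let DpP u : 0 <= dot nn u -> Dp u.
Proof.
move=> u0; apply: Dp_sub; move: u0; rewrite le_eqVlt => /predU1P[u0|u0]; last by left.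
by right; rewrite /Sigma/=.
Qed.

Let DmP u : dot nn u < delta -> Dm u.
Proof. exact: Dm_sub. Qed.

(** A tube around the single point [u]: within radius [r] the variation [r^-1 * |v - u|] is at most
    1. *)
Lemma jacobian_bounded_near (D : set 'rV[R]_n) (F : 'rV[R]_n -> 'rV[R]_n) u :
  open D -> (forall j, Ck j D F) -> D u ->
  \forall v \near u, `|'J F v| <= `|'J F u| + 1.
Proof.
move=> oD sF Du.
have Ku : compact [set u] by exact: compact_set1.
have KD : [set u] `<=` D by move=> v ->.
have H := tube_jacobian oD sF Ku KD.
near (0 : R)^'+ => r.
have r0 : 0 < r by near: r; exact: nbhs_right_gt.
have Hr : forall u0, [set u] u0 -> forall v, `|v - u0| < r ->
    D v /\ `|'J F v - 'J F u0| <= r^-1 * `|v - u0| by near: r; exact: H.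
apply/nbhs_ballP; exists r => //= v; rewrite -ball_normE/= distrC => vr.
have [_ Jv] := Hr u erefl v vr.
have : `|'J F v - 'J F u| <= 1.
  by apply: (le_trans Jv); rewrite mulrC ler_pdivrMr// mul1r ltW.
move: ('J F v) ('J F u) => A B AB; rewrite -(subrK B A) addrC.
by apply: (le_trans (ler_normD _ _)); rewrite lerD2l.
Unshelve. all: by end_near. Qed.

Lemma norm_bounded_near (F : 'rV[R]_n -> 'rV[R]_n) u : {for u, continuous F} ->
  \forall v \near u, `|F v| <= `|F u| + 1.
Proof.
move=> /cvgrPdist_lt/(_ 1 ltr01); apply: filterS => v Hv.
rewrite -(subrK (F u) (F v)) addrC; apply: (le_trans (ler_normD _ _)).
by rewrite lerD2l distrC ltW.
Qed.

Lemma dot_near (F : 'rV[R]_n -> 'rV[R]_n) u c : {for u, continuous F} ->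
  c < dot nn (F u) -> \forall v \near u, c <= dot nn (F v).
Proof.
move=> cF cu.
have : (dot nn (F v) : R^o) @[v --> u] --> (dot nn (F u) : R^o).
  by apply: (cvg_comp F (dot nn : _ -> R^o) cF); exact: dot_continuous.
by move=> /cvgr_gt/(_ _ cu); apply: filterS => v /ltW.
Qed.

(* Opaque names for the Jacobians: unification unfolds both sides of
   ['J fp u = 'J fm u] and practically never returns. *)
Variables (Jp Jm : 'rV[R]_n -> 'M[R]_n) (Jf : R -> 'rV[R]_n -> 'M[R]_n).
Hypothesis JpE : forall u, Jp u = 'J fp u.
Hypothesis JmE : forall u, Jm u = 'J fm u.
Hypothesis JfE : forall mu u, Jf mu u = 'J (f mu) u.

Lemma Jp_bounded_near u : Dp u -> \forall v \near u, `|Jp v| <= `|Jp u| + 1.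
Proof.
move=> Du; rewrite JpE; have := jacobian_bounded_near Dp_open fp_smooth Du.
by apply: filterS => v; rewrite JpE.
Qed.

Lemma Jm_bounded_near u : Dm u -> \forall v \near u, `|Jm v| <= `|Jm u| + 1.
Proof.
move=> Du; rewrite JmE; have := jacobian_bounded_near Dm_open fm_smooth Du.
by apply: filterS => v; rewrite JmE.
Qed.

Lemma Jp_tube (K : set 'rV[R]_n) : compact K -> K `<=` Dp ->
  \forall r \near (0 : R)^'+, forall u, K u -> forall v, `|v - u| < r ->
    Dp v /\ `|Jp v - Jp u| <= r^-1 * `|v - u|.
Proof.
move=> cK KD; have := tube_jacobian Dp_open fp_smooth cK KD.
by apply: filterS => r H u Ku v vu; rewrite !JpE; exact: H.
Qed.

Lemma Jf_plus mu u : 0 < mu < delta -> mu <= dot nn u -> Jf mu u = Jp u.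
Proof.
move=> /andP[mu0 md] mu_u; rewrite JfE JpE.
apply: (@jacobian_smoothed_plus R n phi phi_der phi_one phi_zero nn fp fm mu mu0 u delta md mu_u).
  by apply: dfp; apply: DpP; apply: le_trans mu_u; exact: ltW.
by move=> ud; apply: dfm; exact: DmP.
Qed.

Lemma Jf_minus mu u : 0 < mu -> dot nn u <= 0 -> Jf mu u = Jm u.
Proof.
move=> mu0 u0; rewrite JfE JmE.
apply: (@jacobian_smoothed_minus R n phi phi_der phi_one phi_zero nn fp fm mu mu0 u u0).
  by apply: dfm; apply: DmP; exact: (le_lt_trans u0 delta_gt0).
by move=> uE; apply: dfp; apply: DpP; rewrite uE.
Qed.

Lemma Jf_layer mu u : Dp u -> Dm u ->
  Jf mu u = phi (dot nn u / mu) *: Jp u + (1 - phi (dot nn u / mu)) *: Jm u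
    + (phi^`()%classic (dot nn u / mu) / mu) *: (nn^T *m (fp u - fm u)).
Proof.
move=> /dfp dp /dfm dm; rewrite JfE JpE JmE.
exact: (@jacobian_smoothed R n phi phi_der nn fp fm mu u dp dm).
Qed.

Lemma hder_fp (A : set R) (g : R -> 'rV[R]_n) t l : Dp (g t) -> hder A g t l ->
  hder A (fun t => fp (g t)) t (l *m Jp (g t)).
Proof.
move=> Dt Hg; rewrite JpE.
rewrite (_ : l *m _ = 'd fp (g t) l); last by rewrite /jacobian mul_rV_lin1.
by apply: hder_comp => //; exact: dfp.
Qed.

Lemma hder_fm (A : set R) (g : R -> 'rV[R]_n) t l : Dm (g t) -> hder A g t l ->
  hder A (fun t => fm (g t)) t (l *m Jm (g t)).
Proof.
move=> Dt Hg; rewrite JmE.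
rewrite (_ : l *m _ = 'd fm (g t) l); last by rewrite /jacobian mul_rV_lin1.
by apply: hder_comp => //; exact: dfm.
Qed.

Lemma crossing_ball : exists rho c M : R, [/\ 0 < rho, 0 < c, 0 <= M &
  forall u, `|u - w| <= rho -> [/\ Dp u, Dm u, `|fp u| <= M, `|fm u| <= M &
    [/\ `|Jp u| <= M, `|Jm u| <= M, c <= dot nn (fp u) & c <= dot nn (fm u)]]].
Proof.
have Dpw : Dp w by apply: DpP; rewrite w_Sigma.
have Dmw : Dm w by apply: DmP; rewrite w_Sigma.
pose c := Num.min (dot nn (fp w)) (dot nn (fm w)) / 2.
have c0 : 0 < c by rewrite divr_gt0// lt_min fp_w.
have cp : c < dot nn (fp w).
  apply: (@lt_le_trans _ _ (Num.min (dot nn (fp w)) (dot nn (fm w)))).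
    by move: c0; rewrite /c; lra.
  by rewrite ge_min lexx.
have cm : c < dot nn (fm w).
  apply: (@lt_le_trans _ _ (Num.min (dot nn (fp w)) (dot nn (fm w)))).
    by move: c0; rewrite /c; lra.
  by rewrite ge_min lexx orbT.
pose M1 := `|fp w| + 1 : R; pose M2 := `|fm w| + 1 : R.
pose M3 := `|Jp w| + 1 : R; pose M4 := `|Jm w| + 1 : R.
have M10 : 0 <= M1 by exact: addr_ge0.
have M20 : 0 <= M2 by exact: addr_ge0.
have M30 : 0 <= M3 by exact: addr_ge0.
have M40 : 0 <= M4 by exact: addr_ge0.
have cfp := Ck_continuous fp_smooth Dpw; have cfm := Ck_continuous fm_smooth Dmw.
have J1 := Jp_bounded_near Dpw.
have J2 := Jm_bounded_near Dmw.
have F1 := norm_bounded_near cfp; have F2 := norm_bounded_near cfm.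
have F3 := dot_near cfp cp; have F4 := dot_near cfm cm.
have F5 : \forall u \near w, Dp u by exact: open_nbhs_nbhs.
have F6 : \forall u \near w, Dm u by exact: open_nbhs_nbhs.
have : nbhs w (fun u => ((Dp u /\ Dm u) /\ (`|fp u| <= M1 /\ `|fm u| <= M2)) /\
    ((`|Jp u| <= M3 /\ `|Jm u| <= M4) /\
     (c <= dot nn (fp u) /\ c <= dot nn (fm u)))).
  exact: (filterI (filterI (filterI F5 F6) (filterI F1 F2)) (filterI (filterI J1 J2) (filterI F3 F4))).
move=> /nbhs_ballP[r /= r0 Hr].
exists (r / 2), c, (M1 + M2 + M3 + M4); split => //; first by rewrite divr_gt0.
  by rewrite !addr_ge0.
move=> u ur; have /Hr : ball w r u.
  by rewrite -ball_normE/= distrC; apply: (le_lt_trans ur); lra.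
move=> [[[d1 d2] [f1 f2]] [[j1 j2] [c1 c2]]].
clearbody M1 M2 M3 M4; clear J1 J2.
by split => //; [lra|lra|split => //; lra].
Qed.

Lemma weight_bounds mu u : 0 <= phi (dot nn u / mu) <= 1.
Proof. exact: cutoff_bounds. Qed.

Lemma crossing_layer : exists rho c M tau : R, [/\ 0 < rho, 0 < c, 0 <= M, 0 < tau <= T &
  [/\ M * tau < rho, forall u, `|u - w| <= rho -> [/\ Dp u, Dm u, `|fp u| <= M,
      `|fm u| <= M & [/\ `|Jp u| <= M, `|Jm u| <= M,
      c <= dot nn (fp u) & c <= dot nn (fm u)]] &
    forall mu u, `|u - w| <= rho -> `|f mu u| <= M /\ c <= dot nn (f mu u)]].
Proof.
have [rho [c [M [rho0 c0 M0 H]]]] := crossing_ball.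
have M10 : 0 < 2 * (M + 1) by rewrite mulr_gt0// ltr_wpDl.
(* A curve from [w] with speed at most [M] then cannot leave the ball before [tau]; adding 1 to [M]
   avoids a division by 0. *)
pose tau := Num.min T (rho / (2 * (M + 1))).
have tau0 : 0 < tau by rewrite lt_min T_gt0 divr_gt0.
exists rho, c, M, tau; split => //; first by rewrite tau0 ge_min lexx.
split => //.
  have : tau <= rho / (2 * (M + 1)) by rewrite ge_min lexx orbT.
  by rewrite ler_pdivlMr//; move: (M) M0 tau0 => m m0 t0; nra.
move=> mu u /H[_ _ fpM fmM [_ _ cp cm]].
have PI := weight_bounds mu u; split; first exact: norm_convex.
rewrite /smoothed dotD !dotZ; move: PI; move: (phi _) => P /andP[P0 P1].
have : P * c <= P * dot nn (fp u) by exact: ler_wpM2l.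
have : (1 - P) * c <= (1 - P) * dot nn (fm u) by rewrite ler_wpM2l// subr_ge0.
by lra.
Qed.

Hypothesis gamma_plus : forall t, 0 <= t <= T -> hder `[0, T] gamma t (fp (gamma t)).
Hypothesis gamma_minus : forall t, - T <= t <= 0 ->
  hder `[- T, 0] gamma t (fm (gamma t)).
Hypothesis gamma_pos : forall t, 0 < t <= T -> 0 < dot nn (gamma t).
Hypothesis gamma_neg : forall t, - T <= t < 0 -> dot nn (gamma t) < 0.

Lemma dot_lower_bound a b (y : R -> 'rV[R]_n) (x : 'rV[R]_n) : a <= b ->
  {within `[a, b], continuous y} -> (forall t, a <= t <= b -> 0 < dot x (y t)) ->
  exists2 m : R, 0 < m & forall t, a <= t <= b -> m <= dot x (y t).
Proof.
move=> ab /within_ctsP yc y0.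
have dc : {within `[a, b], continuous (fun t => dot x (y t))}.
  apply/(@within_ctsP _ R^o) => t tI e e0.
  have N0 : 0 < n%:R * `|x| + 1 by rewrite ltr_wpDl// mulr_ge0.
  have [d d0 Hd] := yc t tI _ (divr_gt0 e0 N0); exists d => // s sI st.
  have := Hd s sI st; rewrite ltr_pdivlMr// => H; apply: le_lt_trans H.
  rewrite -dotB; apply: (le_trans (dot_norm_le _ _)).
  by rewrite mulrC ler_wpM2l// lerDl.
have [m mI Hm] := EVT_min ab dc; exists (dot x (y m)).
  by apply: y0; move: mI; rewrite in_itv.
by move=> t tI; apply: Hm; rewrite in_itv.
Qed.

(** All constants, including the exit speed [c], precede [mu] and the solutions. Up to the time mu /
    c the estimate of [layer] applies; afterwards the Jacobian is that of [fp] and only its argument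
    is off by O(mu). *)
Lemma crossing_forward (Lam : 'M[R]_k) (V0 Z0 : 'M[R]_(k, n)) :
  exists C mu0 c : R, [/\ 0 <= C, 0 < mu0, 0 < c & forall mu, 0 < mu < mu0 ->
    [/\ 0 <= mu / c, mu / c <= C * mu & mu / c <= T] /\
    forall (eta : R -> 'rV[R]_n) (V Z : R -> 'M[R]_(k, n)),
    (forall t, 0 <= t <= T -> hder `[0, T] eta t (f mu (eta t))) -> eta 0 = w ->
    (forall t, 0 <= t <= T ->
      hder `[0, T] V t (V t *m Jf mu (eta t) + Z t) /\
      hder `[0, T] Z t (Lam *m V t)) -> V 0 = V0 -> Z 0 = Z0 ->
    [/\ forall t, 0 <= t <= mu / c -> `|V t| <= C /\ `|Z t - Z0| <= C * mu,
      `|V (mu / c) - (V0 + ((dot nn (fm w))^-1 *: (V0 *m nn^T)) *m (fp w - fm w))|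
        <= C * mu &
      forall t, mu / c <= t <= T ->
        [/\ `|eta t - gamma t| <= C * mu, Jf mu (eta t) = Jp (eta t) &
            `|Jp (eta t) - Jp (gamma t)| <= C * mu]]].
Proof.
have [rho [c [M [tau [rho0 c0 M0 /andP[tau0 tauT] [Mtau ball fball]]]]]] := crossing_layer.
have g_c : {within `[0, T], continuous gamma}.
  by apply: hder_within_continuous => t /itvccP; exact: gamma_plus.
have g_ge t : 0 <= t <= T -> 0 <= dot nn (gamma t).
  move=> /andP[t0 tT]; have [->|tn0] := eqVneq t 0; first by rewrite gamma_w w_Sigma.
  by apply/ltW/gamma_pos; rewrite tT lt_neqAle eq_sym tn0 t0.
have [m m0 Hm] : exists2 m : R, 0 < m & forall t, tau <= t <= T -> m <= dot nn (gamma t).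
  apply: dot_lower_bound => // [|t /andP[t1 t2]].
    by apply: continuous_subspaceW g_c => t /itvccP/andP[t1 t2]; apply/itvccP;
      rewrite t2 (le_trans (ltW tau0)).
  by apply: gamma_pos; rewrite t2 (lt_le_trans tau0).
pose K := [set gamma t | t in `[0, T]%classic].
have Kc : compact K by apply: continuous_compact => //; exact: segment_compact.
have KD : K `<=` Dp by move=> _ [t /itvccP tI <-]; apply: DpP; exact: g_ge.
have tub1 := tube Dp_open fp_smooth Kc KD.
have tub2 := Jp_tube Kc KD.
(* The condition on [m] makes a deviation of at most r / 2 change <n, gamma> by at most m / 2. *)
have [r [r0 rm tubF tubJ]] : exists r : R, [/\ 0 < r, n%:R * `|nn| * r <= m,
    forall t, 0 <= t <= T -> forall v, `|v - gamma t| < r ->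
      Dp v /\ `|fp v - fp (gamma t)| <= r^-1 * `|v - gamma t| &
    forall t, 0 <= t <= T -> forall v, `|v - gamma t| < r ->
      Dp v /\ `|Jp v - Jp (gamma t)| <= r^-1 * `|v - gamma t|].
  have N0 : 0 < n%:R * `|nn| + 1 by rewrite ltr_wpDl// mulr_ge0.
  near (0 : R)^'+ => r; exists r.
  have tubF : forall u, K u -> forall v, `|v - u| < r ->
      Dp v /\ `|fp v - fp u| <= r^-1 * `|v - u| by near: r; exact: tub1.
  have tubJ : forall u, K u -> forall v, `|v - u| < r ->
      Dp v /\ `|Jp v - Jp u| <= r^-1 * `|v - u| by near: r; exact: tub2.
  have Kg t : 0 <= t <= T -> K (gamma t) by move=> tI; exists t => //; apply/itvccP.
  have r0 : 0 < r by near: r; exact: nbhs_right_gt.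
  split=> //.
  - have : r < m / (n%:R * `|nn| + 1) by near: r; apply: nbhs_right_lt; exact: divr_gt0.
    by rewrite ltr_pdivlMr//; move: (n%:R * `|nn|) => N; lra.
  - by move=> t /Kg; exact: tubF.
  - by move=> t /Kg; exact: tubJ.
have ri0 : 0 <= r^-1 by rewrite invr_ge0 ltW.
have [G G1 HG] := @tracking R 1 n r^-1 T ri0 (ltW T_gt0).
have G0 : 0 <= G by exact: le_trans G1.
have [Cl Cl0 Hlayer] := @layer R n k nn Lam c M tau V0 Z0 (dot nn (fm w)) c0 M0 (ltW tau0).
(* Both trajectories leave [w] with speed at most [M], so at time mu / c they are at most (2 M / c)
   mu apart; [G] is the tracking factor from there on. *)
pose C1 := G * (2 * M / c); have ci0 : 0 <= c^-1 by rewrite invr_ge0 ltW.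
have C10 : 0 <= C1 by rewrite mulr_ge0// !mulr_ge0.
pose C := Cl + Cl / c + C1 + r^-1 * C1 + c^-1.
have Clc : 0 <= Cl / c by rewrite mulr_ge0.
have rC1 : 0 <= r^-1 * C1 by rewrite mulr_ge0.
have C0 : 0 <= C by rewrite !addr_ge0.
have [ClC ClcC C1C rC1C] : [/\ Cl <= C, Cl / c <= C, C1 <= C & r^-1 * C1 <= C].
  exact: term_le_sum5.
have C110 : 0 < C1 + 1 by rewrite ltr_wpDl.
(* In this order: the exit time is below [tau]; closeness to [gamma] keeps <n, eta> above mu after
   [tau]; [fm] is differentiable on the upper face of the layer; the tracking bound C1 mu stays
   below r / 2. *)
pose mu0 := Num.min (Num.min (c * tau) (m / 2)) (Num.min delta (r / 2 / (C1 + 1))).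
exists C, mu0, c; split=> //.
  by rewrite !lt_min mulr_gt0// divr_gt0// delta_gt0 !divr_gt0.
move=> mu /andP[mu_gt0]; rewrite !lt_min => /andP[/andP[mu_tau mu_m] /andP[mu_delta mu_r]].
have mu_ge0 := ltW mu_gt0.
set s := mu / c.
have s0 : 0 <= s by rewrite mulr_ge0.
have stau : s < tau by rewrite /s ltr_pdivrMr// mulrC.
have sT : s <= T by exact: le_trans (ltW stau) tauT.
have sC : s <= C * mu.
  rewrite /s mulrC; apply: ler_wpM2r => //; rewrite /C.
  by rewrite lerDr !addr_ge0.
split => // eta V Z Heta eta0 HVZ HV0 HZ0.
have subtau t : 0 <= t <= tau -> 0 <= t <= T by move=> /andP[-> ?]; exact: le_trans tauT.
have HetaI t : 0 <= t <= tau -> hder `[0, tau] eta t (f mu (eta t)).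
  by move=> tI; apply: (@hder_subI _ _ 0 T) => //; apply: Heta; exact: subtau.
have eta_ball t : 0 <= t <= tau -> `|eta t - w| <= M * t /\ `|eta t - w| < rho.
  apply: (@stay_in_ball _ _ tau M rho eta (fun t => f mu (eta t))) => //.
  by move=> u _ /(fball mu)[].
have gamma_ball t : 0 <= t <= tau -> `|gamma t - w| <= M * t /\ `|gamma t - w| < rho.
  apply: (@stay_in_ball _ _ tau M rho gamma (fun t => fp (gamma t))) => //.
    by move=> u uI; apply: (@hder_subI _ _ 0 T) => //; apply: gamma_plus; exact: subtau.
  by move=> u _ /ball[].
have eta_ballw t : 0 <= t <= tau -> `|eta t - w| <= rho.
  by move=> /eta_ball[_ /ltW].
have a_ge t : 0 <= t <= tau -> c * t <= dot nn (eta t).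
  move=> /andP[t0 tt].
  have sub u : 0 <= u <= t -> 0 <= u <= tau by move=> /andP[-> ?]; exact: le_trans tt.
  have : - dot nn (eta t) - (- dot nn (eta 0)) <= - c * (t - 0); last first.
    by rewrite eta0 w_Sigma !oppr0 !addr0 mulNr lerN2.
  have hd u : 0 <= u <= t -> hder `[0, t] (fun t => - dot nn (eta t) : R^o) u
      (- dot nn (f mu (eta u))).
    move=> uI; apply: (@hderN _ R^o); apply: hder_dot.
    by apply: (@hder_subI _ _ 0 tau) => //; apply: HetaI; exact: sub.
  apply: (@mvt_le _ 0 t (fun u => - dot nn (eta u)) (fun u => - dot nn (f mu (eta u))) _ t0).
  - by apply: (@hder_within_continuous _ R^o _ _ (fun u => - dot nn (f mu (eta u)))) => u /itvccP; exact: hd.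
  - by move=> u /andP[u0 ut]; apply: hd; rewrite !ltW.
  - move=> u /andP[u0 ut]; rewrite lerN2.
    by apply: (fball mu _ (eta_ballw u _)).2; apply: sub; rewrite !ltW.
have s_tau : 0 <= s <= tau by rewrite s0 ltW.
have x_s : `|eta s - gamma s| <= 2 * M / c * mu.
  have [H1 _] := eta_ball s s_tau; have [H2 _] := gamma_ball s s_tau.
  rewrite -(subrK w (eta s)) -addrA; apply: (le_trans (ler_normD _ _)).
  rewrite (distrC w); apply: (le_trans (lerD H1 H2)).
  by rewrite le_eqVlt; apply/orP; left; apply/eqP; rewrite /s; field; rewrite gt_eqF.
have sub_s t : s <= t <= T -> 0 <= t <= T by move=> /andP[st ->]; rewrite (le_trans s0).
(* This keeps the solution from re-entering the layer: up to [tau] because <n, eta> grows at rate at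
   least [c], afterwards because <n, gamma> is at least [m] and [eta] is close to [gamma]. *)
have key t : s <= t <= T -> `|eta t - gamma t| <= r / 2 ->
    mu <= dot nn (eta t) /\ `|eta t - gamma t| < r.
  move=> /andP[st tT] xr.
  have xr' : `|eta t - gamma t| < r by apply: (le_lt_trans xr); exact: half_lt.
  split => //.
  have [tt|tt] := leP t tau.
    have : c * s <= c * t by rewrite ler_pM2l.
    have -> : c * s = mu by rewrite /s mulrC divfK// gt_eqF.
    by move=> /le_trans; apply; apply: a_ge; rewrite tt (le_trans s0).
  have m1 : m <= dot nn (gamma t) by apply: Hm; rewrite tT ltW.
  have : `|dot nn (eta t - gamma t)| <= m / 2.
    apply: (le_trans (dot_norm_le _ _)).
    apply: (@le_trans _ _ (n%:R * `|nn| * (r / 2))); first by apply: ler_wpM2l; rewrite ?mulr_ge0.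
    by rewrite mulrA ler_pM2r// invr_gt0.
  by rewrite dotB ler_norml => /andP[+ _]; exact: ge_of_close mu_m m1.
have x_der t : s <= t <= T -> hder `[s, T] (fun t => eta t - gamma t) t
    (f mu (eta t) - fp (gamma t)).
  move=> tI; apply: hderB; apply: (@hder_subI _ _ 0 T) => //.
    by apply: Heta; exact: sub_s.
  by apply: gamma_plus; exact: sub_s.
have track t : s <= t <= T ->
    `|eta t - gamma t| <= C1 * mu /\ `|eta t - gamma t| < r / 2.
  move=> tI.
  have GC1 : G * `|eta s - gamma s| <= C1 * mu.
    by rewrite /C1 -mulrA; apply: ler_wpM2l.
  have Gr : G * `|eta s - gamma s| < r / 2.
    apply: (le_lt_trans GC1); move: mu_r; rewrite ltr_pdivlMr//.
    by rewrite mulrDr mulr1 mulrC => H; apply: le_lt_trans H; rewrite lerDl.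
  have sTT : T - s <= T by rewrite lerBlDr lerDl.
  have [u uI xr|H1 H2] := HG s T (r / 2) (fun t => eta t - gamma t) _ sTT x_der _ Gr t tI.
    have [mu_a xr'] := key u uI xr.
    rewrite smoothed_plus//.
    exact: (tubF u (sub_s u uI) _ xr').2.
  by split=> //; exact: le_trans GC1.
have H3 t : s <= t <= T -> [/\ `|eta t - gamma t| <= C * mu, Jf mu (eta t) = Jp (eta t) &
            `|Jp (eta t) - Jp (gamma t)| <= C * mu].
  move=> tI; have [H1 /ltW H2] := track t tI; have [mu_a xr'] := key t tI H2.
  split.
  - by apply: (le_trans H1); exact: ler_wpM2r.
  - by apply: Jf_plus => //; rewrite mu_gt0.
  - apply: (le_trans (tubJ t (sub_s t tI) _ xr').2).
    apply: (@le_trans _ _ (r^-1 * (C1 * mu))); first exact: ler_wpM2l.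
    by rewrite mulrA; exact: ler_wpM2r.
pose Phi t := phi (dot nn (eta t) / mu).
pose kappa t := phi^`()%classic (dot nn (eta t) / mu) / mu.
(* The layer estimate is used with p the velocity [f mu (eta t)], and a, b the two fields along
   [eta]; it holds up to [tau], past the exit time. *)
have layer_t t : 0 <= t <= tau ->
    [/\ `|V t| <= Cl, `|Z t - Z0| <= Cl * t &
     `|V t - (V0 + ((dot nn (fm w))^-1 *: (V0 *m nn^T)) *m (Phi t *: (fp w - fm w)))| <= Cl * t].
  move=> tI; have := Hlayer (fun t => f mu (eta t)) (fun t => fp (eta t)) (fun t => fm (eta t))
    (fun t => Jp (eta t)) (fun t => Jm (eta t)) Phi kappa V Z.
  rewrite eta0 => H; apply: (H _ _ _ _ _ t tI).
  - move=> u uI; have [Du Du' _ _ _] := ball _ (eta_ballw u uI); split.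
    + by apply: hder_fp => //; exact: HetaI.
    + by apply: hder_fm => //; exact: HetaI.
    + by apply: hder_weight => //; exact: HetaI.
    + by [].
    + exact: weight_bounds.
  - by move=> u uI; have [_ _ ? ? [? ? _ _]] := ball _ (eta_ballw u uI).
  - by move=> u uI; have [_ _ _ _ [_ _ ? ?]] := ball _ (eta_ballw u uI).
  - move=> u uI; have [Du Du' _ _ _] := ball _ (eta_ballw u uI).
    have [HV HZ] := HVZ u (subtau u uI); rewrite Jf_layer// in HV.
    by split; apply: (@hder_subI _ _ 0 T).
  - split=> //; first by rewrite /Phi eta0 w_Sigma mul0r phi_zero.
split.
- move=> t /andP[t0 ts]; have tI : 0 <= t <= tau by rewrite t0 (le_trans ts)// ltW.
  have [H1 H2 _] := layer_t t tI; split.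
    exact: le_trans ClC.
  apply: (le_trans H2); apply: (@le_trans _ _ (Cl * s)); first exact: ler_wpM2l.
  by rewrite /s mulrA mulrAC; exact: ler_wpM2r.
(* At time [s] one has <n, eta> >= c s = mu, so the weight is 1 and the full jump appears. *)
- have [_ _] := layer_t s s_tau; rewrite {1}/Phi phi_one ?scale1r => [H|].
    by apply: (le_trans H); rewrite /s mulrA mulrAC; exact: ler_wpM2r.
  rewrite ler_pdivlMr// mul1r; apply: le_trans (a_ge s s_tau).
  by rewrite /s mulrC divfK// gt_eqF.
- exact: H3.
Unshelve. all: by end_near. Qed.

Lemma hder_reflI (W : normedModType R) (g : R -> W) t l :
  hder `[- T, 0] g (- t) l -> hder `[0, T] (fun t => g (- t)) t (- l).
Proof.
move=> /hder_refl; apply: hder_sub => s /itvccP/andP[s0 sT].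
by apply/itvccP; rewrite oppr_le0 s0 lerN2 sT.
Qed.

(** In reversed time <n, eta> decreases at rate at least [c] up to [tau], and then stays negative by
    closeness to [gamma]; so the field is [fm] all along. Tracking from initial distance 0 gives
    equality, hence nothing depends on [mu] for t <= 0. *)
Lemma crossing_backward mu (eta : R -> 'rV[R]_n) : 0 < mu ->
  (forall t, - T <= t <= 0 -> hder `[- T, 0] eta t (f mu (eta t))) -> eta 0 = w ->
  forall t, - T <= t <= 0 -> eta t = gamma t /\ Jf mu (eta t) = Jm (gamma t).
Proof.
move=> mu_gt0 Heta eta0.
have [rho [c [M [tau [rho0 c0 M0 /andP[tau0 tauT] [Mtau ball fball]]]]]] := crossing_layer.
have opI t : 0 <= t <= T -> - T <= - t <= 0.
  by move=> /andP[t0 tT]; rewrite lerN2 tT oppr_le0.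
pose e t := eta (- t); pose g t := gamma (- t).
have ed t : 0 <= t <= T -> hder `[0, T] e t (- f mu (e t)).
  by move=> /opI tI; apply: hder_reflI; exact: Heta.
have gd t : 0 <= t <= T -> hder `[0, T] g t (- fm (g t)).
  by move=> /opI tI; apply: hder_reflI; exact: gamma_minus.
have e0 : e 0 = w by rewrite /e oppr0.
have g0 : g 0 = w by rewrite /g oppr0.
have g_lt t : 0 < t <= T -> dot nn (g t) < 0.
  by move=> /andP[t0 tT]; apply: gamma_neg; rewrite lerN2 tT oppr_lt0.
have g_le t : 0 <= t <= T -> dot nn (g t) <= 0.
  move=> /andP[t0 tT]; have [->|tn0] := eqVneq t 0; first by rewrite g0 w_Sigma.
  by apply/ltW/g_lt; rewrite tT lt_neqAle eq_sym tn0 t0.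
have g_c : {within `[0, T], continuous g}.
  by apply: hder_within_continuous => t /itvccP; exact: gd.
have dotN u : dot nn (- u) = - dot nn u by rewrite -scaleN1r dotZ mulN1r.
have [m m0 Hm] : exists2 m : R, 0 < m & forall t, tau <= t <= T -> m <= - dot nn (g t).
  have [||m m0 Hm] := @dot_lower_bound tau T (fun t => - g t) nn tauT.
  - apply: (@hder_within_continuous _ _ _ _ (fun t => - - fm (g t))) => t /itvccP/andP[t1 t2].
    apply: hderN; apply: (@hder_subI _ _ 0 T) => //; first exact: ltW.
    by apply: gd; rewrite t2 (le_trans (ltW tau0)).
  - by move=> t /andP[t1 t2]; rewrite dotN oppr_gt0 g_lt// t2 (lt_le_trans tau0).
  - by exists m => // t /Hm; rewrite dotN.
pose K := [set g t | t in `[0, T]%classic].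
have Kc : compact K by apply: continuous_compact => //; exact: segment_compact.
have KD : K `<=` Dm.
  by move=> _ [t /itvccP tI <-]; apply: DmP; apply: le_lt_trans delta_gt0; exact: g_le.
have tub1 := tube Dm_open fm_smooth Kc KD.
have [r [r0 rm tubF]] : exists r : R, [/\ 0 < r, n%:R * `|nn| * r <= m &
    forall t, 0 <= t <= T -> forall v, `|v - g t| < r ->
      Dm v /\ `|fm v - fm (g t)| <= r^-1 * `|v - g t|].
  have N0 : 0 < n%:R * `|nn| + 1 by rewrite ltr_wpDl// mulr_ge0.
  near (0 : R)^'+ => r; exists r.
  have tubF : forall u, K u -> forall v, `|v - u| < r ->
      Dm v /\ `|fm v - fm u| <= r^-1 * `|v - u| by near: r; exact: tub1.
  have Kg t : 0 <= t <= T -> K (g t) by move=> tI; exists t => //; apply/itvccP.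
  have r0 : 0 < r by near: r; exact: nbhs_right_gt.
  split=> //.
  - have : r < m / (n%:R * `|nn| + 1) by near: r; apply: nbhs_right_lt; exact: divr_gt0.
    by rewrite ltr_pdivlMr//; move: (n%:R * `|nn|) => N; lra.
  - by move=> t /Kg; exact: tubF.
have ri0 : 0 <= r^-1 by rewrite invr_ge0 ltW.
have [G G1 HG] := @tracking R 1 n r^-1 T ri0 (ltW T_gt0).
have subtau t : 0 <= t <= tau -> 0 <= t <= T by move=> /andP[-> ?]; exact: le_trans tauT.
have edI t : 0 <= t <= tau -> hder `[0, tau] e t (- f mu (e t)).
  by move=> tI; apply: (@hder_subI _ _ 0 T) => //; apply: ed; exact: subtau.
have e_ballw t : 0 <= t <= tau -> `|e t - w| <= rho.
  move=> tI; apply: ltW.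
  apply: (@stay_in_ball _ _ tau M rho e (fun t => - f mu (e t)) w M0 Mtau e0 edI _ t tI).2.
  by move=> u _ /(fball mu)[]; rewrite normrN.
have a_le t : 0 <= t <= tau -> dot nn (e t) <= - c * t.
  move=> /andP[t0 tt].
  have sub u : 0 <= u <= t -> 0 <= u <= tau by move=> /andP[-> ?]; exact: le_trans tt.
  have : dot nn (e t) - dot nn (e 0) <= - c * (t - 0); last first.
    by rewrite e0 w_Sigma; lra.
  have hd u : 0 <= u <= t -> hder `[0, t] (fun t => dot nn (e t) : R^o) u
      (dot nn (- f mu (e u))).
    move=> uI; apply: hder_dot.
    by apply: (@hder_subI _ _ 0 tau) => //; apply: edI; exact: sub.
  apply: (@mvt_le _ 0 t (fun u => dot nn (e u)) (fun u => dot nn (- f mu (e u))) _ t0).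
  - by apply: (@hder_within_continuous _ R^o _ _ (fun u => dot nn (- f mu (e u)))) => u /itvccP; exact: hd.
  - by move=> u /andP[u0 ut]; apply: hd; rewrite !ltW.
  - move=> u /andP[u0 ut]; rewrite dotN lerN2.
    by apply: (fball mu _ (e_ballw u _)).2; apply: sub; rewrite !ltW.
have key t : 0 <= t <= T -> `|e t - g t| <= r / 2 ->
    dot nn (e t) <= 0 /\ `|e t - g t| < r.
  move=> /andP[t0 tT] xr.
  have xr' : `|e t - g t| < r by apply: (le_lt_trans xr); exact: half_lt.
  split => //.
  have [tt|tt] := leP t tau.
    have := a_le t (introT andP (conj t0 tt)).
    by move=> /le_trans; apply; rewrite mulNr oppr_le0 mulr_ge0// ltW.
  have m1 : m <= - dot nn (g t) by apply: Hm; rewrite tT ltW.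
  have : `|dot nn (e t - g t)| <= m / 2.
    apply: (le_trans (dot_norm_le _ _)).
    apply: (@le_trans _ _ (n%:R * `|nn| * (r / 2))); first by apply: ler_wpM2l; rewrite ?mulr_ge0.
    by rewrite mulrA; lra.
  by rewrite dotB ler_norml => /andP[_]; lra.
have eg t : 0 <= t <= T -> e t = g t.
  move=> tI.
  have x_der u : 0 <= u <= T -> hder `[0, T] (fun t => e t - g t) u
      (- f mu (e u) - - fm (g u)).
    by move=> uI; apply: hderB; [exact: ed|exact: gd].
  have Gr : G * `|e 0 - g 0| < r / 2 by rewrite e0 g0 subrr normr0 mulr0 divr_gt0.
  have T0 : T - 0 <= T by rewrite subr0.
  have [u uI xr|H1 H2] := HG 0 T (r / 2) (fun t => e t - g t) _ T0 x_der _ Gr t tI.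
    have [mu_a xr'] := key u uI xr.
    by rewrite smoothed_minus// -opprD normrN; exact: (tubF u uI _ xr').2.
  move: H1; rewrite e0 g0 subrr normr0 mulr0 normr_le0 subr_eq0.
  by move=> /eqP.
move=> t /andP[tT t0].
have tI : 0 <= - t <= T by rewrite oppr_ge0 t0 lerNl tT.
have := eg _ tI; rewrite /e /g opprK => E; split=> //; rewrite E.
by apply: Jf_minus => //; have := g_le _ tI; rewrite /g opprK.
Unshelve. all: by end_near. Qed.

End Crossing.

(** * Smoothness along a trajectory *)

(** Each order has its own witnesses, which need not agree from one order to the next. This makes
    closure properties plain inductions; [diffn_chain] recovers one sequence of derivatives. *)
Fixpoint diffn (R : realType) (W : normedModType R) (j : nat) (A : set R)
    (g : R -> W) : Prop :=
  if j is j'.+1 then exists g' : R -> W,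
    (forall x, A x -> hder A g x (g' x)) /\ diffn j' A g'
  else True.

Section Diffn.
Variables (R : realType) (A : set R).

Lemma diffn_ext (W : normedModType R) j (g h : R -> W) :
  (forall x, A x -> g x = h x) -> diffn j A g -> diffn j A h.
Proof.
case: j => // j gh [g' [Hg Hg']]; exists g'; split => // x Ax.
exact: hder_ext (Hg x Ax).
Qed.

Lemma diffnW (W : normedModType R) j (g : R -> W) : diffn j.+1 A g -> diffn j A g.
Proof.
elim: j g => // j IH g [g' [Hg Hg']]; exists g'; split => //; exact: IH.
Qed.

Lemma diffn_cst (W : normedModType R) j (c : W) : diffn j A (fun=> c).
Proof.
elim: j c => // j IH c; exists (fun=> 0); split; last exact: IH.
by move=> x _; exact: hder_cst.
Qed.

Lemma diffnD (W : normedModType R) j (g h : R -> W) :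
  diffn j A g -> diffn j A h -> diffn j A (fun t => g t + h t).
Proof.
elim: j g h => // j IH g h [g' [Hg Hg']] [h' [Hh Hh']].
exists (fun t => g' t + h' t); split; last exact: IH.
by move=> x Ax; apply: hderD; [exact: Hg|exact: Hh].
Qed.

Lemma diffn_mulmx m n p j (f : R -> 'M[R]_(m, n)) (g : R -> 'M[R]_(n, p)) :
  diffn j A f -> diffn j A g -> diffn j A (fun t => f t *m g t).
Proof.
elim: j f g => // j IH f g Hf0 Hg0.
have [f' [Hf Hf']] := Hf0; have [g' [Hg Hg']] := Hg0.
exists (fun t => f' t *m g t + f t *m g' t); split.
  by move=> x Ax; apply: hder_mulmx; [exact: Hf|exact: Hg].
by apply: diffnD; apply: IH => //; exact: diffnW.
Qed.

Lemma diffn_scale (W : normedModType R) j (f : R -> R) (g : R -> W) :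
  diffn j A (f : R -> R^o) -> diffn j A g -> diffn j A (fun t => f t *: g t).
Proof.
elim: j f g => // j IH f g Hf0 Hg0.
have [f' [Hf Hf']] := Hf0; have [g' [Hg Hg']] := Hg0.
exists (fun t => f' t *: g t + f t *: g' t); split.
  by move=> x Ax; apply: hder_scale; [exact: Hf|exact: Hg].
by apply: diffnD; apply: IH => //; exact: diffnW.
Qed.

Lemma diffn_sum (W : normedModType R) j (I : Type) (r : seq I) (F : I -> R -> W) :
  (forall i, diffn j A (F i)) -> diffn j A (fun t => \sum_(i <- r) F i t).
Proof.
move=> H; elim: r => [|i r IH].
  by apply: (diffn_ext _ (diffn_cst j (0 : W))) => x _; rewrite big_nil.
by apply: (diffn_ext _ (diffnD (H i) IH)) => x _; rewrite big_cons.
Qed.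

Lemma diffn_entry m n j (f : R -> 'M[R]_(m, n)) a b :
  diffn j A f -> diffn j A (fun t => f t a b : R^o).
Proof.
elim: j f => // j IH f [f' [Hf Hf']]; exists (fun t => f' t a b); split; last exact: IH.
by move=> x Ax; exact: ((hder_mx _ _ _ _).1 (Hf x Ax)).
Qed.

Lemma diffn_mx m n j (f : R -> 'M[R]_(m, n)) :
  (forall a b, diffn j A (fun t => f t a b : R^o)) -> diffn j A f.
Proof.
move=> H.
apply: (@diffn_ext _ _ (fun t => \sum_a \sum_b (f t a b) *: (delta_mx a b : 'M[R]_(m, n)))).
  by move=> x _; rewrite -matrix_sum_delta.
apply: diffn_sum => a; apply: diffn_sum => b; apply: diffn_scale => //.
exact: diffn_cst.
Qed.

(** The derivative of F(gamma) is the sum of f_i(gamma) D_i F(gamma), whose factors have the same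
    form. The induction therefore runs over all [F] and target spaces at once. *)
Lemma diffn_flow n (D : set 'rV[R]_n) (f : 'rV[R]_n -> 'rV[R]_n) (gamma : R -> 'rV[R]_n) :
  (forall k, Ck k D f) -> (forall t, A t -> D (gamma t)) ->
  (forall t, A t -> hder A gamma t (f (gamma t))) ->
  forall j (W : normedModType R) (F : 'rV[R]_n -> W), (forall k, Ck k D F) ->
    diffn j A (fun t => F (gamma t)).
Proof.
move=> sf Dg Hg; elim=> // j IH W F sF.
exists (fun t => \sum_(i < n) (f (gamma t) 0 i) *: 'D_(delta_mx 0 i) F (gamma t)); split.
  move=> t At; have dF : differentiable F (gamma t) by exact: Ck_differentiable (Dg t At).
  have := hder_comp dF (Hg t At); congr (hder _ _ _ _).
  rewrite [X in 'd _ _ X]row_sum_delta linear_sum; apply: eq_bigr => i _.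
  by rewrite linearZ/= -deriveE.
apply: diffn_sum => i; apply: diffn_scale.
  by apply: diffn_entry; exact: IH.
by apply: (IH W (fun u => 'D_(delta_mx 0 i) F u)); exact: Ck_derive.
Qed.

Lemma diffn_jacobian n (D : set 'rV[R]_n) (f F : 'rV[R]_n -> 'rV[R]_n)
    (J : 'rV[R]_n -> 'M[R]_n) (gamma : R -> 'rV[R]_n) :
  (forall u, J u = 'J F u) ->
  (forall k, Ck k D f) -> (forall t, A t -> D (gamma t)) ->
  (forall t, A t -> hder A gamma t (f (gamma t))) ->
  (forall k, Ck k D F) -> forall j, diffn j A (fun t => J (gamma t)).
Proof.
move=> JE sf Dg Hg sF j; apply: diffn_mx => a b.
apply: (@diffn_ext _ _ (fun t => ('D_(delta_mx 0 a) F (gamma t)) 0 b : R^o)).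
  move=> t At; rewrite JE; apply/esym; apply: jacobianE.
  exact: Ck_differentiable (Dg t At).
apply: diffn_entry.
by apply: (@diffn_flow _ _ _ _ sf Dg Hg j _ (fun u => (derive F u (delta_mx 0 a)))); exact: Ck_derive.
Qed.

(** The equations express the derivatives of [v] and [z] through [v], [z] and [B], so every order
    gives the next. *)
Lemma diffn_linear k n (Lam : 'M[R]_k) (B : R -> 'M[R]_n) (v z : R -> 'M[R]_(k, n)) :
  (forall j, diffn j A B) ->
  (forall t, A t -> hder A v t (v t *m B t + z t)) ->
  (forall t, A t -> hder A z t (Lam *m v t)) ->
  forall j, diffn j A v /\ diffn j A z.
Proof.
move=> HB Hv Hz; elim=> // j [IHv IHz]; split.
  exists (fun t => v t *m B t + z t); split => //.
  by apply: diffnD => //; exact: diffn_mulmx.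
exists (fun t => Lam *m v t); split => //.
by apply: diffn_mulmx => //; exact: diffn_cst.
Qed.

(** At accumulation points derivatives are unique, so choosing one at each point gives an operator
    that agrees on [A] with every witness and can be iterated. *)
Lemma diffn_chain (W : normedModType R) (g : R -> W) :
  (forall x, A x -> forall d : R, 0 < d ->
    exists y : R, [/\ A y, y != x & `|y - x| < d]) ->
  (forall j, diffn j A g) ->
  exists h : nat -> R -> W, h 0%N = g /\
    forall k x, A x -> hder A (h k) x (h k.+1 x).
Proof.
move=> acc Hg.
pose d (g : R -> W) x := xget 0 [set l | hder A g x l].
have dP (f f' : R -> W) x : A x -> hder A f x (f' x) -> d f x = f' x.
  move=> Ax H; have Hd : hder A f x (d f x).
    exact: (@xgetPex _ 0 [set l | hder A f x l] (ex_intro _ _ H)).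
  exact: hder_uniq (acc x Ax) Hd H.
have Hh k : forall j, diffn j A (iter k d g).
  elim: k => [|k IH j /=]; first exact: Hg.
  have [f' [Hf Hf']] := IH j.+1.
  by apply: diffn_ext Hf' => x Ax; rewrite (dP _ f' x Ax (Hf x Ax)).
exists (fun k => iter k d g); split => // k x Ax.
have [f' [Hf _]] := Hh k 1%N.
by rewrite /= (dP _ f' x Ax (Hf x Ax)); exact: Hf.
Qed.

End Diffn.

Lemma itv_accumulation (R : realType) (a b x : R) : a < b -> `[a, b]%classic x ->
  forall d : R, 0 < d -> exists y : R, [/\ `[a, b]%classic y, y != x & `|y - x| < d].
Proof.
move=> ab /itvccP/andP[ax xb] d d0.
have [xb'|bx] := ltP x b.
  exists (Num.min b (x + d / 2)); split.
  - apply/itvccP; rewrite ge_min lexx andbT le_min (ltW ab)/=; lra.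
  - by rewrite gt_eqF// lt_min xb'/=; lra.
  - rewrite gtr0_norm; last by rewrite subr_gt0 lt_min xb'/=; lra.
    by rewrite ltrBlDr gt_min; apply/orP; right; lra.
have xE : x = b by lra.
exists (Num.max a (x - d / 2)); split.
- apply/itvccP; rewrite le_max lexx/= ge_max (ltW ab)/=; lra.
- by rewrite lt_eqF// gt_max xE ab/=; lra.
- rewrite ltr0_norm; last by rewrite subr_lt0 gt_max xE ab/=; lra.
  by rewrite opprB ltrBlDr -ltrBlDl lt_max; apply/orP; right; lra.
Qed.

(** * The limit for real systems *)

Section RealCore.
Variables (R : realType) (n k : nat) (phi : R -> R).
Hypothesis phi_der : forall y, derivable phi y 1.
Hypothesis phi_one : forall y, 1 <= y -> phi y = 1.
Hypothesis phi_zero : forall y, y <= 0 -> phi y = 0.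
Hypothesis phi_incr : forall y, 0 < y < 1 -> 0 < (phi^`())%classic y.
Variables (nn : 'rV[R]_n) (fp fm : 'rV[R]_n -> 'rV[R]_n) (Dp Dm : set 'rV[R]_n).
Variable delta : R.
Hypothesis Dp_open : open Dp.
Hypothesis Dm_open : open Dm.
Hypothesis fp_smooth : forall j, Ck j Dp fp.
Hypothesis fm_smooth : forall j, Ck j Dm fm.
Hypothesis Dp_sub : Uplus nn `|` Sigma nn `<=` Dp.
Hypothesis delta_gt0 : 0 < delta.
Hypothesis Dm_sub : [set u | dot nn u < delta] `<=` Dm.
Variable T : R.
Hypothesis T_gt0 : 0 < T.
Variables (gamma : R -> 'rV[R]_n) (w : 'rV[R]_n).
Hypothesis gamma_w : gamma 0 = w.
Hypothesis w_Sigma : dot nn w = 0.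
Hypothesis fp_w : 0 < dot nn (fp w).
Hypothesis fm_w : 0 < dot nn (fm w).
Local Notation f := (smoothed nn phi fp fm).
Variables (Jp Jm : 'rV[R]_n -> 'M[R]_n) (Jf : R -> 'rV[R]_n -> 'M[R]_n).
Hypothesis JpE : forall u, Jp u = 'J fp u.
Hypothesis JmE : forall u, Jm u = 'J fm u.
Hypothesis JfE : forall mu u, Jf mu u = 'J (f mu) u.
Hypothesis gamma_cont : {within `[- T, T], continuous gamma}.
Hypothesis gamma_traj : forall t, - T <= t <= T -> t != 0 ->
  hder `[- T, T] gamma t (piecewise nn fp fm (gamma t)).
Hypothesis gamma_pos : forall t, 0 < t <= T -> 0 < dot nn (gamma t).
Hypothesis gamma_neg : forall t, - T <= t < 0 -> dot nn (gamma t) < 0.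

Lemma within_cts_comp (W : normedModType R) (A : set R) (F : 'rV[R]_n -> W)
    (g : R -> 'rV[R]_n) : {within A, continuous g} ->
  (forall t, A t -> {for g t, continuous F}) -> {within A, continuous (fun t => F (g t))}.
Proof.
move=> /subspace_continuousP gc Fc; apply/subspace_continuousP => x Ax.
by apply: (cvg_comp g F (gc x Ax)); exact: Fc.
Qed.

Let Dp_gamma t : 0 <= t <= T -> Dp (gamma t).
Proof.
move=> /andP[t0 tT]; apply: Dp_sub; have [->|tn0] := eqVneq t 0.
  by right; rewrite gamma_w.
by left; apply: gamma_pos; rewrite tT lt_neqAle eq_sym tn0 t0.
Qed.

Let Dm_gamma t : - T <= t <= 0 -> Dm (gamma t).
Proof.
move=> /andP[tT t0]; apply: Dm_sub; rewrite /=; have [->|tn0] := eqVneq t 0.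
  by rewrite gamma_w w_Sigma.
by apply: lt_trans delta_gt0; apply: gamma_neg; rewrite tT lt_neqAle tn0 t0.
Qed.

Let NT : - T <= 0. Proof. by rewrite oppr_le0 ltW. Qed.
Let T0 : 0 <= T. Proof. exact: ltW. Qed.

(** The equation is assumed for t > 0 only; [hder_closed] adds the right derivative at 0. *)
Let gamma_plus t : 0 <= t <= T -> hder `[0, T] gamma t (fp (gamma t)).
Proof.
have gc : {within `[0, T], continuous gamma}.
  apply: continuous_subspaceW gamma_cont => s /itvccP/andP[s0 sT].
  by apply/itvccP; rewrite sT (le_trans NT).
apply: (@hder_closed R 1 n 0 T gamma (fun t => fp (gamma t)) gc).
  by apply: within_cts_comp => // s /itvccP sI; apply: (Ck_continuous fp_smooth); exact: Dp_gamma.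
move=> s /andP[s0 sT]; apply: (@hder_subI _ _ (- T) T) => //.
have sI : - T <= s <= T by rewrite (ltW sT) andbT (le_trans NT)// ltW.
have sI' : 0 < s <= T by rewrite s0 ltW.
by have := @gamma_traj s sI (lt0r_neq0 s0); rewrite /piecewise (gamma_pos sI').
Qed.

Let gamma_minus t : - T <= t <= 0 -> hder `[- T, 0] gamma t (fm (gamma t)).
Proof.
have gc : {within `[- T, 0], continuous gamma}.
  apply: continuous_subspaceW gamma_cont => s /itvccP/andP[s0 sT].
  by apply/itvccP; rewrite s0 (le_trans sT).
apply: (@hder_closed R 1 n (- T) 0 gamma (fun t => fm (gamma t)) gc).
  by apply: within_cts_comp => // s /itvccP sI; apply: (Ck_continuous fm_smooth); exact: Dm_gamma.
move=> s /andP[sT s0]; apply: (@hder_subI _ _ (- T) T) => //.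
have sI : - T <= s <= T by rewrite (ltW sT) (le_trans (ltW s0)).
have sI' : - T <= s < 0 by rewrite s0 ltW.
have := @gamma_traj s sI (ltr0_neq0 s0).
by rewrite /piecewise ltNge (ltW (gamma_neg sI')).
Qed.

Let Jp_diffn j : diffn j `[0, T] (fun t => Jp (gamma t)).
Proof.
have Dg t : `[0, T]%classic t -> Dp (gamma t) by move=> /itvccP; exact: Dp_gamma.
have Hg t : `[0, T]%classic t -> hder `[0, T] gamma t (fp (gamma t)).
  by move=> /itvccP; exact: gamma_plus.
exact: (@diffn_jacobian R _ n Dp fp fp Jp gamma JpE fp_smooth Dg Hg fp_smooth j).
Qed.

Let Jm_diffn j : diffn j `[- T, 0] (fun t => Jm (gamma t)).
Proof.
have Dg t : `[- T, 0]%classic t -> Dm (gamma t) by move=> /itvccP; exact: Dm_gamma.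
have Hg t : `[- T, 0]%classic t -> hder `[- T, 0] gamma t (fm (gamma t)).
  by move=> /itvccP; exact: gamma_minus.
exact: (@diffn_jacobian R _ n Dm fm fm Jm gamma JmE fm_smooth Dg Hg fm_smooth j).
Qed.

Lemma diffn_cts (W : normedModType R) (A : set R) (g : R -> W) :
  diffn 1 A g -> {within A, continuous g}.
Proof. by move=> [g' [Hg _]]; exact: hder_within_continuous Hg. Qed.

(** Gronwall's lemma for the time-reversed difference, which starts at 0. It identifies the
    solutions for different mu on [- T, 0]. *)
Lemma linear_backward_uniq (Lam : 'M[R]_k) (B : R -> 'M[R]_n)
    (v z v' z' : R -> 'M[R]_(k, n)) :
  {within `[- T, 0], continuous B} ->
  (forall t, - T <= t <= 0 -> hder `[- T, 0] v t (v t *m B t + z t) /\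
     hder `[- T, 0] z t (Lam *m v t)) ->
  (forall t, - T <= t <= 0 -> hder `[- T, 0] v' t (v' t *m B t + z' t) /\
     hder `[- T, 0] z' t (Lam *m v' t)) ->
  v 0 = v' 0 -> z 0 = z' 0 -> forall t, - T <= t <= 0 -> v t = v' t /\ z t = z' t.
Proof.
move=> Bc Hv Hv' v0 z0.
have [M M0 HM] := within_cts_bounded Bc.
pose L := n%:R * M + 1 + k%:R * `|Lam|.
have nM0 : 0 <= n%:R * M by exact: mulr_ge0.
have kL0 : 0 <= k%:R * `|Lam| by exact: mulr_ge0.
have L0 : 0 <= L by rewrite !addr_ge0.
have [G G1 HG] := @gronwall3 R k n 1 1 k n L T L0 T0.
pose x t := v (- t) - v' (- t); pose y t := z (- t) - z' (- t).
have opI t : 0 <= t <= T -> - T <= - t <= 0.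
  by move=> /andP[t0 tT]; rewrite lerN2 tT oppr_le0.
have xd t : 0 <= t <= T -> hder `[0, T] x t (- (x t *m B (- t) + y t)).
  move=> /opI tI; have := hderB (Hv _ tI).1 (Hv' _ tI).1 => /hder_reflI.
  rewrite /x /y mulmxBl; congr (hder _ _ _ (- _)).
  move: (v _ *m _) (v' _ *m _) (z _) (z' _) => a b c d.
  by rewrite opprD addrACA.
have yd t : 0 <= t <= T -> hder `[0, T] y t (- (Lam *m x t)).
  move=> /opI tI; have := hderB (Hv _ tI).2 (Hv' _ tI).2 => /hder_reflI.
  by rewrite /x mulmxBr.
have TT : T - 0 <= T by rewrite subr0.
have x0E : x 0 = 0 by rewrite /x oppr0 v0 subrr.
have y0E : y 0 = 0 by rewrite /y oppr0 z0 subrr.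
have main t : 0 <= t <= T -> `|x t| + `|y t| <= 0.
  move=> tI.
  have := HG 0 T x (fun t => - (x t *m B (- t) + y t)) (fun=> 0) (fun=> 0)
    y (fun t => - (Lam *m x t)) 0 TT (lexx _) _ _ t tI.
  rewrite x0E y0E /= !normr0 !addr0 mulr0; apply => s sI.
    by split; [exact: xd|exact: hder_cst|exact: yd].
  have x0 := normr_ge0 (x s); have y0 := normr_ge0 (y s).
  have xL e : 0 <= e -> e <= L -> e * `|x s| <= L * (`|x s| + `|y s|).
    by move=> e0 eL; apply: ler_pM => //; rewrite lerDl.
  rewrite !normrN !addr0; split.
  - apply: (le_trans (ler_normD _ _)).
    have H1 : `|x s *m B (- s)| <= n%:R * M * `|x s|.
      apply: (le_trans (mulmx_norm _ _)); rewrite mulrAC; apply: ler_wpM2r => //.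
      by apply: ler_wpM2l => //; apply: HM; exact: opI.
    apply: (le_trans (lerD H1 (lexx _))); rewrite mulrDr; apply: lerD.
      by apply: ler_wpM2r => //; rewrite /L; lra.
    by rewrite -[leLHS]mul1r; apply: ler_wpM2r => //; rewrite /L; lra.
  - by rewrite mulr_ge0// addr_ge0.
  - by apply: (le_trans (mulmx_norm _ _)); apply: xL => //; rewrite /L; lra.
move=> t /andP[tT t0].
have tI : 0 <= - t <= T by rewrite oppr_ge0 t0 lerNl tT.
have := main _ tI; rewrite /x /y opprK => H.
have x0 := normr_ge0 (v t - v' t); have y0 := normr_ge0 (z t - z' t).
by split; apply/eqP; rewrite -subr_eq0 -normr_le0; lra.
Qed.

(** The limit of V has two one-sided values at 0, carried by the branches [vl] and [vr]; the single
    continuous [z] serves on both sides. *)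
Lemma crossing_limit (Lam : 'M[R]_k) (V0 Z0 : 'M[R]_(k, n)) (mu1 : R)
    (eta : R -> R -> 'rV[R]_n) (V Z : R -> R -> 'M[R]_(k, n)) :
  0 < mu1 ->
  (forall mu, 0 < mu < mu1 ->
    [/\ forall t, - T <= t <= T -> hder `[- T, T] (eta mu) t (f mu (eta mu t)),
        eta mu 0 = w,
        forall t, - T <= t <= T ->
          hder `[- T, T] (V mu) t (V mu t *m Jf mu (eta mu t) + Z mu t) /\
          hder `[- T, T] (Z mu) t (Lam *m V mu t),
        V mu 0 = V0 & Z mu 0 = Z0]) ->
  exists (v z vl vr : R -> 'M[R]_(k, n)) (C mu2 : R),
  [/\ 0 < mu2,
    forall mu t, 0 < mu < mu2 -> - T <= t <= T ->
      `|V mu t| <= C /\ `|Z mu t - z t| <= C * mu,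
    forall t, - T <= t <= T -> t != 0 -> exists2 m, 0 < m &
      forall mu, 0 < mu < m -> `|V mu t - v t| <= C * mu,
    [/\ forall t, - T <= t < 0 -> vl t = v t, vl 0 = V0, z 0 = Z0,
      forall t, - T <= t <= 0 -> hder `[- T, 0] vl t (vl t *m Jm (gamma t) + z t) /\
        hder `[- T, 0] z t (Lam *m vl t) &
      forall j, diffn j `[- T, 0] vl /\ diffn j `[- T, 0] z] &
    [/\ forall t, 0 < t <= T -> vr t = v t,
      vr 0 = V0 + ((dot nn (fm w))^-1 *: (V0 *m nn^T)) *m (fp w - fm w),
      z 0 = Z0,
      forall t, 0 <= t <= T -> hder `[0, T] vr t (vr t *m Jp (gamma t) + z t) /\
        hder `[0, T] z t (Lam *m vr t) &
      forall j, diffn j `[0, T] vr /\ diffn j `[0, T] z]].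
Proof.
move=> mu10 Hsol.
have [C [mu0 [c [C0 mu00 c0 Hfwd]]]] := crossing_forward phi_der phi_one phi_zero phi_incr
  Dp_open Dm_open fp_smooth fm_smooth Dp_sub delta_gt0 Dm_sub T_gt0 gamma_w w_Sigma
  fp_w fm_w JpE JmE JfE gamma_plus gamma_pos Lam V0 Z0.
set V1 := V0 + _.
pose mu2 := Num.min mu0 mu1.
have mu20 : 0 < mu2 by rewrite lt_min mu00.
have mu2P mu : 0 < mu < mu2 -> (0 < mu < mu0) * (0 < mu < mu1) * (0 <= mu).
  by move=> /andP[mup]; rewrite lt_min mup => /andP[-> ->]; rewrite ltW.
have posI t : 0 <= t <= T -> - T <= t <= T.
  by move=> /andP[t0 ->]; rewrite (le_trans NT).
have negI t : - T <= t <= 0 -> - T <= t <= T.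
  by move=> /andP[-> t0]; rewrite (le_trans t0).
have fwd mu (mum : 0 < mu < mu2) :
    [/\ 0 <= mu / c, mu / c <= C * mu & mu / c <= T] /\
    [/\ forall t, 0 <= t <= mu / c -> `|V mu t| <= C /\ `|Z mu t - Z0| <= C * mu,
      `|V mu (mu / c) - V1| <= C * mu &
      forall t, mu / c <= t <= T ->
        [/\ `|eta mu t - gamma t| <= C * mu, Jf mu (eta mu t) = Jp (eta mu t) &
            `|Jp (eta mu t) - Jp (gamma t)| <= C * mu]].
  have [[m0 m1] m2] := mu2P mu mum.
  have [Hs H] := Hfwd mu m0; split=> //.
  have [He e0 HVZ HV0 HZ0] := Hsol mu m1.
  apply: H => // t /posI tI.
    by apply: (@hder_subI _ _ (- T) T) => //; exact: He.
  by split; apply: (@hder_subI _ _ (- T) T) => //; [exact: (HVZ t tI).1|exact: (HVZ t tI).2].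
have Ac : {within `[0, T], continuous (fun t => Jp (gamma t))}.
  exact: diffn_cts (Jp_diffn 1).
have Bc : {within `[- T, 0], continuous (fun t => Jm (gamma t))}.
  exact: diffn_cts (Jm_diffn 1).
have [mu mum|mu t mum tI|vr [zr [C' [C'0 [vr0 zr0] Hvr Hbnd Hlim]]]] :=
  @linear_limit R k n Lam T C mu2 (fun t => Jp (gamma t))
    (fun mu t => Jf mu (eta mu t)) (fun mu => mu / c) V1 Z0 V Z T_gt0 mu20 C0 Ac.
- have [[s0 sC sT] [Hlay HV _]] := fwd mu mum; split => //.
  by apply: (Hlay (mu / c) _).2; rewrite s0 lexx.
- have [[s0 sC sT] [Hlay HV Htr]] := fwd mu mum.
  have [[m0 m1] m2] := mu2P mu mum; have [_ _ HVZ _ _] := Hsol mu m1.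
  have tI' : - T <= t <= T.
    by apply: posI; case/andP: tI => st ->; rewrite (le_trans s0).
  have sT' : - T <= mu / c by exact: le_trans s0.
  split.
  + by apply: (@hder_subI _ _ (- T) T) => //; exact: (HVZ t tI').1.
  + by apply: (@hder_subI _ _ (- T) T) => //; exact: (HVZ t tI').2.
  + by have [_ -> H] := Htr t tI.
(* Any admissible value would do: before time 0 the solution is the same for all mu. *)
pose mus := mu2 / 2.
have musm : 0 < mus < mu2 by rewrite /mus divr_gt0//=; lra.
pose vl := V mus; pose zl := Z mus.
have bwd mu (mum : 0 < mu < mu2) : [/\ forall t, - T <= t <= 0 ->
      hder `[- T, 0] (V mu) t (V mu t *m Jm (gamma t) + Z mu t) /\
      hder `[- T, 0] (Z mu) t (Lam *m V mu t), V mu 0 = V0 & Z mu 0 = Z0].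
  have [[m0 m1] m2] := mu2P mu mum; have [He e0 HVZ HV0 HZ0] := Hsol mu m1.
  have mup : 0 < mu by case/andP: mum.
  have Heb t : - T <= t <= 0 -> hder `[- T, 0] (eta mu) t (f mu (eta mu t)).
    by move=> /negI tI; apply: (@hder_subI _ _ (- T) T) => //; exact: He.
  split=> // t tI.
  have [_ JE] := crossing_backward phi_der phi_one phi_zero phi_incr
    Dp_open Dm_open fp_smooth fm_smooth Dp_sub delta_gt0 Dm_sub T_gt0 gamma_w w_Sigma
    fp_w fm_w JpE JmE JfE gamma_minus gamma_neg mup Heb e0 tI.
  rewrite -JE; split; apply: (@hder_subI _ _ (- T) T) => //.
    exact: (HVZ t (negI t tI)).1.
  exact: (HVZ t (negI t tI)).2.
have [Hvl vl0 zl0] := bwd mus musm.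
have eq_l mu t : 0 < mu < mu2 -> - T <= t <= 0 -> V mu t = vl t /\ Z mu t = zl t.
  move=> mum; have [Hv v0 z0] := bwd mu mum.
  by apply: (linear_backward_uniq Bc Hv Hvl); rewrite ?v0 ?z0 ?vl0 ?zl0.
have vlc : {within `[- T, 0], continuous vl}.
  by apply: hder_within_continuous => t /itvccP tI; exact: (Hvl t tI).1.
have [Ml Ml0 HMl] := within_cts_bounded vlc.
have vrc : {within `[0, T], continuous vr}.
  by apply: hder_within_continuous => t /itvccP tI; exact: (Hvr t tI).1.
have [Mr Mr0 HMr] := within_cts_bounded vrc.
pose Lz := k%:R * `|Lam| * Mr; have Lz0 : 0 <= Lz by rewrite !mulr_ge0.
(* Inside the layer [Hlim] gives nothing, but [Z mu t] and [zr t] are both within O(mu) of [Z0].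
   Hence the convergence of Z is uniform across 0. *)
have zr_lip t : 0 <= t <= T -> `|zr t - Z0| <= Lz * t.
  move=> /andP[t0 tT].
  have sub s : 0 <= s <= t -> 0 <= s <= T by move=> /andP[-> st]; exact: le_trans tT.
  rewrite -zr0 -[X in _ <= _ * X]subr0.
  apply: (@lipschitz_mvt _ _ _ 0 t zr (fun s => Lam *m vr s)) => // s sI.
    by apply: (@hder_subI _ _ 0 T) => //; exact: (Hvr s (sub s sI)).2.
  apply: (le_trans (mulmx_norm _ _)); rewrite /Lz; apply: ler_wpM2l; first exact: mulr_ge0.
  by apply: HMr; exact: sub.
pose z t := if t <= 0 then zl t else zr t.
pose v t := if t < 0 then vl t else vr t.
have z_l t : `[- T, 0]%classic t -> zl t = z t by move=> /itvccP/andP[_ t0]; rewrite /z t0.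
have z_r t : `[0, T]%classic t -> zr t = z t.
  move=> /itvccP/andP[t0 _]; rewrite /z; case: ifPn => // t0'.
  have -> : t = 0 by apply/eqP; rewrite eq_le t0' t0.
  by rewrite zr0 /zl zl0.
have Hvl' t : - T <= t <= 0 -> hder `[- T, 0] vl t (vl t *m Jm (gamma t) + z t) /\
    hder `[- T, 0] z t (Lam *m vl t).
  move=> tI; have tI' := (itvccP _ _ _).2 tI; have [H1 H2] := Hvl t tI.
  by split; [rewrite -z_l|exact: hder_ext z_l H2].
have Hvr' t : 0 <= t <= T -> hder `[0, T] vr t (vr t *m Jp (gamma t) + z t) /\
    hder `[0, T] z t (Lam *m vr t).
  move=> tI; have tI' := (itvccP _ _ _).2 tI; have [H1 H2] := Hvr t tI.
  by split; [rewrite -z_r|exact: hder_ext z_r H2].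
(* [C] covers the layer, [C'] the time after it, [Ml] the time before 0, and [Lz * C] the drift of
   [zr] during the layer. *)
pose K := C + C' + Ml + Lz * C.
have LzC : 0 <= Lz * C by rewrite mulr_ge0.
have K0 : 0 <= K by rewrite !addr_ge0.
have CK : C <= K by rewrite /K; lra.
have C'K : C' <= K by rewrite /K; lra.
have MlK : Ml <= K by rewrite /K; lra.
have CLK : C + Lz * C <= K by rewrite /K; lra.
exists v, z, vl, vr, K, mu2; split => //.
- move=> mu t mum /andP[tT1 tT2]; have [_ m2] := mu2P mu mum.
  have [[s0 sC sT] [Hlay HV Htr]] := fwd mu mum.
  have [t0|t0] := leP t 0.
    have tI : - T <= t <= 0 by rewrite tT1.
    have [-> ->] := eq_l mu t mum tI; rewrite /z t0 subrr normr0; split.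
      by apply: le_trans MlK; exact: HMl.
    exact: mulr_ge0.
  have tI0 : 0 <= t <= T by rewrite ltW.
  rewrite -z_r; last exact/itvccP.
  have [ts|st] := leP t (mu / c).
    have [H1 H2] := Hlay t (introT andP (conj (ltW t0) ts)); split; first exact: le_trans CK.
    apply: (@le_trans _ _ ((C + Lz * C) * mu)); last exact: ler_wpM2r.
    rewrite -(subrK Z0 (Z mu t)) -addrA; apply: (le_trans (ler_normD _ _)).
    rewrite mulrDl; apply: lerD => //; rewrite distrC.
    apply: (le_trans (zr_lip t tI0)); rewrite -[X in _ <= X]mulrA; apply: ler_wpM2l => //.
    exact: le_trans sC.
  have tI : mu / c <= t <= T by rewrite (ltW st).
  have [H1 H2] := Hlim mu t mum tI; split.
    by apply: le_trans C'K; exact: Hbnd tI.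
  by apply: (le_trans H2); exact: ler_wpM2r.
- move=> t /andP[tT1 tT2] tn0; have [t0|t0] := ltP t 0.
    exists mu2 => // mu mum; have [_ m2] := mu2P mu mum.
    have tI : - T <= t <= 0 by rewrite tT1 ltW.
    have [-> _] := eq_l mu t mum tI.
    by rewrite /v t0 subrr normr0; exact: mulr_ge0.
  have tp : 0 < t by rewrite lt_neqAle eq_sym tn0.
  (* The condition mu < c t places [t] after the exit from the layer; the threshold shrinks with
     [t], hence pointwise convergence only. *)
  exists (Num.min mu2 (c * t)); first by rewrite lt_min mu20 mulr_gt0.
  move=> mu /andP[mup]; rewrite lt_min => /andP[mum mut].
  have mum' : 0 < mu < mu2 by rewrite mup.
  have tI : mu / c <= t <= T by rewrite tT2 andbT ler_pdivrMr// mulrC ltW.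
  have [H1 _] := Hlim mu t mum' tI.
  by rewrite /v ltNge t0/=; apply: (le_trans H1); apply: ler_wpM2r => //; exact: ltW.
- split => //.
  + by move=> t /andP[_ t0]; rewrite /v t0.
  + by rewrite /z lexx /zl zl0.
  + apply: (@diffn_linear _ _ k n Lam (fun t => Jm (gamma t))) => // t /itvccP tI.
      exact: (Hvl' t tI).1.
    exact: (Hvl' t tI).2.
- split => //.
  + by move=> t /andP[t0 _]; rewrite /v ltNge ltW.
  + by rewrite /z lexx /zl zl0.
  + apply: (@diffn_linear _ _ k n Lam (fun t => Jp (gamma t))) => // t /itvccP tI.
      exact: (Hvr' t tI).1.
    exact: (Hvr' t tI).2.
Qed.

End RealCore.

(** * Complex rows as real matrices *)

Lemma ord2 (i : 'I_2) : i = 0 \/ i = 1.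
Proof.
by case: i => [[|[|m]] lem] //; [left|right]; exact/val_inj.
Qed.

Section ComplexReal.
Variables (R : realType).
Local Notation C := (Cplx R).
Local Notation Re := (@complex.Re R).
Local Notation Im := (@complex.Im R).

Lemma ReD (x y : C) : Re (x + y) = Re x + Re y.
Proof. by case: x y => [a b] [c d]. Qed.
Lemma ImD (x y : C) : Im (x + y) = Im x + Im y.
Proof. by case: x y => [a b] [c d]. Qed.
Lemma ReN (x : C) : Re (- x) = - Re x.
Proof. by case: x. Qed.
Lemma ImN (x : C) : Im (- x) = - Im x.
Proof. by case: x. Qed.
Lemma ReM (x y : C) : Re (x * y) = Re x * Re y - Im x * Im y.
Proof. by case: x y => [a b] [c d]. Qed.
Lemma ImM (x y : C) : Im (x * y) = Re x * Im y + Im x * Re y.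
Proof. by case: x y => [a b] [c d]. Qed.
Lemma Re_sum (I : Type) (r : seq I) (F : I -> C) :
  Re (\sum_(i <- r) F i) = \sum_(i <- r) Re (F i).
Proof. by apply: (big_morph Re ReD). Qed.
Lemma Im_sum (I : Type) (r : seq I) (F : I -> C) :
  Im (\sum_(i <- r) F i) = \sum_(i <- r) Im (F i).
Proof. by apply: (big_morph Im ImD). Qed.
Lemma Cplx_eq (x y : C) : Re x = Re y -> Im x = Im y -> x = y.
Proof. by case: x y => [a b] [c d] /= -> ->. Qed.

Lemma ofreal_lt (x y : R) : (ofreal x < ofreal y) = (x < y).
Proof. exact: ltcR. Qed.
Lemma ofreal_le (x y : R) : (ofreal x <= ofreal y) = (x <= y).
Proof. exact: lecR. Qed.
Lemma ofreal_gt0 (x : R) : (0 < ofreal x) = (0 < x).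
Proof. exact: (ofreal_lt 0 x). Qed.
(** Radii of balls over [Cplx R] are themselves complex; positivity in this partial order makes them
    real. *)
Lemma gt0_ofreal (x : C) : 0 < x -> exists2 y : R, 0 < y & x = ofreal y.
Proof.
case: x => a b; rewrite ltcE/= => /andP[/eqP b0 a0]; exists a => //.
by rewrite b0.
Qed.

Lemma Cnorm_def (z : C) : `|z| = ofreal (Num.sqrt (Re z ^+ 2 + Im z ^+ 2)).
Proof. exact: normc_def. Qed.

Lemma Re_norm (z : C) (e : R) : `|z| < ofreal e -> `|Re z| < e /\ `|Im z| < e.
Proof.
rewrite Cnorm_def ofreal_lt => H; split; apply: le_lt_trans H.
  by rewrite -sqrtr_sqr ler_wsqrtr// lerDl sqr_ge0.
by rewrite -sqrtr_sqr ler_wsqrtr// lerDr sqr_ge0.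
Qed.

Lemma Cnorm_le (z : C) (e : R) : `|Re z| <= e -> `|Im z| <= e -> `|z| <= ofreal (2 * e).
Proof.
move=> re im; have e0 : 0 <= e by exact: le_trans re.
rewrite Cnorm_def ofreal_le.
rewrite -[leRHS]ger0_norm ?mulr_ge0// -sqrtr_sqr ler_wsqrtr//.
have H x : `|x| <= e -> x ^+ 2 <= e ^+ 2.
  by move=> xe; rewrite -[x ^+ 2]real_normK ?num_real// lerXn2r.
have := H _ re; have := H _ im; have := sqr_ge0 e; rewrite exprMn; lra.
Qed.

Section Dim.
Variable n : nat.

(* Complex rows are encoded as real matrices with two rows, so that real
   calculus applies; a complex scalar [l] acts on them as [cmx l *m _]. *)
Definition c2m (v : 'rV[C]_n) : 'M[R]_(2, n) :=
  \matrix_(i, j) if i == 0 then Re (v 0 j) else Im (v 0 j).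
Definition m2c (M : 'M[R]_(2, n)) : 'rV[C]_n :=
  \row_j (Complex (M 0 j) (M 1 j) : C).

Lemma c2m0 v j : c2m v 0 j = Re (v 0 j). Proof. by rewrite mxE. Qed.
Lemma c2m1 v j : c2m v 1 j = Im (v 0 j). Proof. by rewrite mxE. Qed.
Lemma Re_m2c M j : Re (m2c M 0 j) = M 0 j. Proof. by rewrite mxE. Qed.
Lemma Im_m2c M j : Im (m2c M 0 j) = M 1 j. Proof. by rewrite mxE. Qed.

Lemma c2mK : cancel c2m m2c.
Proof.
by move=> v; apply/rowP => j; apply: Cplx_eq; rewrite ?Re_m2c ?Im_m2c ?c2m0 ?c2m1.
Qed.

Lemma m2cK : cancel m2c c2m.
Proof.
move=> M; apply/matrixP => i j; have [->|->] := ord2 i.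
  by rewrite c2m0 Re_m2c.
by rewrite c2m1 Im_m2c.
Qed.

Lemma c2mB u v : c2m (u - v) = c2m u - c2m v.
Proof.
apply/matrixP => i j; rewrite mxBE; have [->|->] := ord2 i.
  by rewrite !c2m0 !mxE ReD ReN.
by rewrite !c2m1 !mxE ImD ImN.
Qed.

Lemma c2mD u v : c2m (u + v) = c2m u + c2m v.
Proof.
apply/matrixP => i j; rewrite [RHS]mxE; have [->|->] := ord2 i.
  by rewrite !c2m0 !mxE ReD.
by rewrite !c2m1 !mxE ImD.
Qed.

Lemma c2mZ (a : R) v : c2m (ofreal a *: v) = a *: c2m v.
Proof.
apply/matrixP => i j; rewrite [RHS]mxE; have [->|->] := ord2 i.
  by rewrite !c2m0 !mxE ReM /= mul0r subr0.
by rewrite !c2m1 !mxE ImM /= mul0r addr0.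
Qed.

Definition cmx (l : C) : 'M[R]_2 :=
  \matrix_(i, j) if i == j then Re l else if i == 0 then - Im l else Im l.

Lemma c2m_cscale (l : C) v : c2m (l *: v) = cmx l *m c2m v.
Proof.
apply/matrixP => i j; rewrite [RHS]mxE big_ord_recl big_ord1.
rewrite (_ : lift ord0 ord0 = 1); last exact/val_inj.
rewrite c2m1 (c2m0 v j); have [->|->] := ord2 i.
  by rewrite c2m0 !mxE ReM /=; ring.
by rewrite c2m1 !mxE ImM /=; ring.
Qed.

Lemma c2m_mulmx v (J : 'M[R]_n) : c2m (v *m ofrealmx J) = c2m v *m J.
Proof.
apply/matrixP => i j; rewrite [RHS]mxE; have [->|->] := ord2 i.
  rewrite c2m0 mxE Re_sum; apply: eq_bigr => k _.
  by rewrite c2m0 !mxE ReM /= mulr0 subr0.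
rewrite c2m1 mxE Im_sum; apply: eq_bigr => k _.
by rewrite c2m1 !mxE ImM /= mulr0 add0r.
Qed.

Lemma ball_c2m u v (e : R) : ball u (ofreal e) v -> ball (c2m u) e (c2m v).
Proof.
move=> [e0 H]; split; first by rewrite -ofreal_gt0.
move=> i j; have := H 0 j; rewrite -!ball_normE/= => /Re_norm[H1 H2].
have [->|->] := ord2 i; first by rewrite !c2m0 -ReN -ReD.
by rewrite !c2m1 -ImN -ImD.
Qed.

(** [Cnorm_le] doubles the radius, and the remaining factor 2 makes the inequality strict. *)
Lemma ball_m2c u v (e : R) : ball u (e / 4) v -> ball (m2c u) (ofreal e) (m2c v).
Proof.
move=> [e0 H]; split; first by rewrite ofreal_gt0; lra.
move=> i j; rewrite (ord1 i); have := H 0 j; have := H 1 j.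
rewrite -!ball_normE/= => H1 H0.
apply: (@le_lt_trans _ _ (ofreal (2 * (e / 4)))); last by rewrite ofreal_lt; lra.
by apply: Cnorm_le; rewrite ?ReD ?ReN ?ImD ?ImN ?Re_m2c ?Im_m2c ltW.
Qed.

Lemma cvg_c2m T (F : set_system T) {FF : Filter F} (g : T -> 'rV[C]_n) l :
  g @ F --> l -> (fun t => c2m (g t)) @ F --> c2m l.
Proof.
move=> /cvg_ballP H; apply/cvg_ballP => e e0.
have e0' : 0 < ofreal e by rewrite ofreal_gt0.
by have := H _ e0'; apply: filterS => t; exact: ball_c2m.
Qed.

Lemma cvg_m2c T (F : set_system T) {FF : Filter F} (g : T -> 'M[R]_(2, n)) l :
  g @ F --> l -> (fun t => m2c (g t)) @ F --> m2c l.
Proof.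
move=> /cvg_ballP H; apply/cvg_ballP => _ /gt0_ofreal[e e0 ->].
have e0' : 0 < e / 4 by rewrite divr_gt0.
by have := H _ e0'; apply: filterS => t; exact: ball_m2c.
Qed.

Lemma has_cderivP (A : set R) (g : R -> 'rV[C]_n) x l :
  has_cderiv_in A g x l <-> hder A (fun t => c2m (g t)) x (c2m l).
Proof.
split=> H.
  apply/hderE.
  rewrite (_ : (fun y => _) = fun y => c2m (ofreal (y - x)^-1 *: (g y - g x))).
    exact: cvg_c2m.
  by apply/funext => y; rewrite c2mZ c2mB.
rewrite /has_cderiv_in.
rewrite (_ : (fun y => _) = fun y => m2c ((y - x)^-1 *: (c2m (g y) - c2m (g x)))).
  by rewrite -[l]c2mK; apply: cvg_m2c; apply/hderE.
by apply/funext => y; rewrite -c2mB -c2mZ c2mK.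
Qed.

Lemma csmooth_of_diffn (a b : R) (g : R -> 'rV[C]_n) : a < b ->
  (forall j, diffn j `[a, b] (fun t => c2m (g t))) -> csmooth_in `[a, b] g.
Proof.
move=> ab Hg.
have acc x : `[a, b]%classic x -> forall d : R, 0 < d ->
    exists y : R, [/\ `[a, b]%classic y, y != x & `|y - x| < d].
  by move=> xI; exact: itv_accumulation.
have [h [h0 hd]] := diffn_chain acc Hg.
exists (fun k t => m2c (h k t)); split => [x _|k x xI].
  by rewrite h0 c2mK.
apply/has_cderivP; rewrite m2cK.
rewrite (_ : (fun t => c2m (m2c (h k t))) = h k); first exact: hd.
by apply/funext => t; rewrite m2cK.
Qed.

(** The order of the scalars is partial; the proof uses that a nonzero norm is attained at an
    entry. *)
Lemma Cmx_norm_le (v : 'rV[C]_n) (c : R) : 0 <= c ->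
  (forall j, `|v 0 j| <= ofreal c) -> `|v| <= ofreal c.
Proof.
move=> c0 H; have [->|v0] := eqVneq `|v| 0; first by rewrite (ofreal_le 0).
have [[i j]] := mx_norm_neq0 v0; rewrite (ord1 i) /= => E.
by rewrite [leLHS]E; exact: H.
Qed.

(** The column [c2m v *m nn^T] holds the real and imaginary parts of <v, n>, so its product with a
    real row encodes that complex scalar times the row. *)
Lemma c2m_jump (nn fhp fhm : 'rV[R]_n) v :
  c2m (jumpS nn fhp fhm v) =
  c2m v + ((dot nn fhm)^-1 *: (c2m v *m nn^T)) *m (fhp - fhm).
Proof.
rewrite /jumpS c2mD; congr (_ + _); rewrite dotC.
have dv i : (c2m v *m nn^T) i 0 = if i == 0 then Re (dot v (ofrealmx nn))
    else Im (dot v (ofrealmx nn)).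
  rewrite mxE; have [->|->] := ord2 i.
    rewrite Re_sum; apply: eq_bigr => j _.
    by rewrite c2m0 !mxE ReM /= mulr0 subr0.
  rewrite Im_sum; apply: eq_bigr => j _.
  by rewrite c2m1 !mxE ImM /= mulr0 add0r.
set d := dot nn fhm; set e := dot v _ in dv *.
have divE : e / ofreal d = ofreal d^-1 * e by rewrite mulrC /ofreal -fmorphV.
rewrite divE; apply/matrixP => i j; rewrite [RHS]mxE big_ord1.
rewrite [X in _ = X * _]mxE dv; have [->|->] := ord2 i.
  by rewrite c2m0 !mxE ReM ReM /=; ring.
by rewrite c2m1 !mxE ImM ImM /=; ring.
Qed.

End Dim.
End ComplexReal.

Lemma near_at_right0 (R : realType) (P : R -> Prop) :
  (\forall mu \near (0 : R)^'+, P mu) <->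
  exists2 e : R, 0 < e & forall mu, 0 < mu < e -> P mu.
Proof.
split=> [|[e e0 He]].
  rewrite /at_right near_withinE => /nbhs_ballP[e /= e0 He]; exists e => // mu /andP[mu0 mue].
  by apply: He => //; rewrite /ball/= sub0r normrN gtr0_norm.
rewrite /at_right near_withinE; apply/nbhs_ballP; exists e => // mu.
by rewrite /ball/= sub0r normrN => mue mu0; apply: He; rewrite mu0 -(gtr0_norm mu0).
Qed.

Theorem proposition2p1 (R : realType) (n : nat)
  (phi : R -> R)
  (phi_smooth : forall (k : nat) (y : R), derivable (phi^`(k))%classic y 1)
  (phi_one : forall y : R, 1 <= y -> phi y = 1)
  (phi_zero : forall y : R, y <= 0 -> phi y = 0)
  (phi_incr : forall y : R, 0 < y < 1 -> 0 < (phi^`())%classic y)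
  (nn : 'rV[R]_n) (nn_unit : eucl_norm nn = 1)
  (fplus fminus : 'rV[R]_n -> 'rV[R]_n)
  (fplus_smooth : smooth_on (Uplus nn `|` Sigma nn) fplus)
  (* fminus is smooth on the closure of U^- and smoothly extended to a layer
     beyond Sigma *)
  (delta : R) (delta_gt0 : 0 < delta)
  (fminus_smooth : smooth_on [set u : 'rV[R]_n | dot nn u < delta] fminus)
  (T : R) (T_gt0 : 0 < T)
  (gamma : R -> 'rV[R]_n) (w : 'rV[R]_n)
  (gamma_cont : {within `[- T, T], continuous gamma})
  (gamma_traj : forall xi : R, xi \in `[- T, T] -> xi != 0 ->
     has_deriv_in `[- T, T] gamma xi (piecewise nn fplus fminus (gamma xi)))
  (gamma_w : gamma 0 = w) (w_Sigma : Sigma nn w)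
  (gamma_neg : forall xi : R, xi \in `[- T, 0[ -> Uminus nn (gamma xi))
  (gamma_pos : forall xi : R, xi \in `]0, T] -> Uplus nn (gamma xi))
  (fplus_transv : 0 < dot (fplus w) nn)
  (fminus_transv : 0 < dot (fminus w) nn)
  (gammamu : R -> R -> 'rV[R]_n)
  (gammamu_sol : \forall mu \near 0^'+,
     solves_on `[- T, T] (smoothed nn phi fplus fminus mu) (gammamu mu) /\
     gammamu mu 0 = w)
  (lambda : Cplx R) (vminus z0 : 'rV[Cplx R]_n)
  (vmu zmu : R -> R -> 'rV[Cplx R]_n)
  (vzmu_sol : \forall mu \near 0^'+,
     [/\ solves_lin_on `[- T, T] (smoothed nn phi fplus fminus mu)
           (gammamu mu) lambda (vmu mu) (zmu mu),
         vmu mu 0 = vminus & zmu mu 0 = z0]) :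
  exists v z : R -> 'rV[Cplx R]_n,
    [/\ {uniform `[- T, T], zmu mu @[mu --> 0^'+] --> z},
        (exists M : R, \forall mu \near 0^'+,
           forall xi : R, xi \in `[- T, T] -> `|vmu mu xi| <= ofreal M),
        (forall xi : R, xi \in `[- T, T] -> xi != 0 ->
           vmu mu xi @[mu --> 0^'+] --> v xi),
        (exists vl : R -> 'rV[Cplx R]_n,
           (forall xi : R, xi \in `[- T, 0[ -> vl xi = v xi) /\
           smooth_ivp_solution `[- T, 0] fminus gamma lambda vminus z0 vl z) &
        (exists vr : R -> 'rV[Cplx R]_n,
           (forall xi : R, xi \in `]0, T] -> vr xi = v xi) /\
           smooth_ivp_solution `[0, T] fplus gamma lambda
             (jumpS nn (fplus w) (fminus w) vminus) z0 vr z)].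
Proof.
have [Dp [Dpo Dps Dpk]] := fplus_smooth.
have [Dm [Dmo Dms Dmk]] := fminus_smooth.
have [ma ma0 Ha] := (near_at_right0 _).1 gammamu_sol.
have [mb mb0 Hb] := (near_at_right0 _).1 vzmu_sol.
pose mu1 := Num.min ma mb; have mu10 : 0 < mu1 by rewrite lt_min ma0.
have phi_der y : derivable phi y 1 := phi_smooth 0%N y.
have fp_w : 0 < dot nn (fplus w) by rewrite dotC.
have fm_w : 0 < dot nn (fminus w) by rewrite dotC.
have traj t : - T <= t <= T -> t != 0 ->
    hder `[- T, T] gamma t (piecewise nn fplus fminus (gamma t)).
  by move=> tI t0; apply/hderE; apply: gamma_traj => //; rewrite in_itv.
have gpos t : 0 < t <= T -> 0 < dot nn (gamma t).
  by move=> tI; apply: gamma_pos; rewrite in_itv.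
have gneg t : - T <= t < 0 -> dot nn (gamma t) < 0.
  by move=> tI; apply: gamma_neg; rewrite in_itv.
have sol mu : 0 < mu < mu1 ->
    [/\ forall t, - T <= t <= T -> hder `[- T, T] (gammamu mu) t
          (smoothed nn phi fplus fminus mu (gammamu mu t)),
        gammamu mu 0 = w,
        forall t, - T <= t <= T ->
          hder `[- T, T] (fun t => c2m (vmu mu t)) t (c2m (vmu mu t) *m
            'J (smoothed nn phi fplus fminus mu) (gammamu mu t) + c2m (zmu mu t)) /\
          hder `[- T, T] (fun t => c2m (zmu mu t)) t (cmx lambda *m c2m (vmu mu t)),
        c2m (vmu mu 0) = c2m vminus & c2m (zmu mu 0) = c2m z0].
  rewrite lt_min => /andP[mup /andP[mua mub]].
  have [Hg g0] := Ha mu (introT andP (conj mup mua)).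
  have [Hv v0 zz0] := Hb mu (introT andP (conj mup mub)).
  split => //; [|
    |by rewrite v0|by rewrite zz0].
    by move=> t /itvccP tI; apply/hderE; exact: Hg.
  move=> t /itvccP tI; have [H1 H2] := Hv t tI.
  split; last by rewrite -c2m_cscale; apply/has_cderivP.
  move/has_cderivP : H1; rewrite c2mD c2m_mulmx; exact.
(* The real result is applied with k = 2, where [cmx lambda] is the real 2 x 2 matrix of
   multiplication by lambda. *)
have [v [z [vl [vr [C [mu2 [mu20 Hbnd Hpt Hl Hr]]]]]]] :=
  @crossing_limit R n 2 phi phi_der phi_one phi_zero phi_incr nn fplus fminus Dp Dm delta
    Dpo Dmo Dpk Dmk Dps delta_gt0 Dms T T_gt0 gamma w gamma_w w_Sigma fp_w fm_w
    (jacobian fplus) (jacobian fminus) (fun mu => jacobian (smoothed nn phi fplus fminus mu))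
    (fun=> erefl) (fun=> erefl) (fun _ _ => erefl) gamma_cont traj gpos gneg
    (cmx lambda) (c2m vminus) (c2m z0) mu1 gammamu
    (fun mu t => c2m (vmu mu t)) (fun mu t => c2m (zmu mu t)) mu10 sol.
have small e : 0 < e -> exists2 m : R, 0 < m & forall mu, 0 < mu < m -> C * mu < e.
  move=> e0; have C1 : 0 < `|C| + 1 by rewrite ltr_wpDl.
  exists (e / (`|C| + 1)); first exact: divr_gt0.
  move=> mu /andP[mup]; rewrite ltr_pdivlMr// => H; apply: le_lt_trans H.
  rewrite mulrC; apply: ler_wpM2l; first exact: ltW.
  by apply: (le_trans (ler_norm C)); rewrite lerDl.
have closeness (u : 'rV[Cplx R]_n) (N : 'M[R]_(2, n)) e : `|c2m u - N| < e / 4 ->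
    ball (m2c N) (ofreal e) u.
  move=> H; rewrite -[u]c2mK; apply: ball_m2c; rewrite -ball_normE/= distrC; exact: H.
exists (fun t => m2c (v t)), (fun t => m2c (z t)); split.
- move=> P /uniform_nbhs[E [entE EP]].
  move: entE; rewrite -entourage_from_ballE => -[_ /= /gt0_ofreal[e e0 ->] He].
  have e40 : 0 < e / 4 by rewrite divr_gt0.
  have [m m0 Hm] := small _ e40.
  apply/near_at_right0; exists (Num.min m mu2); first by rewrite lt_min m0.
  move=> mu /andP[mup]; rewrite lt_min => /andP[mum mum2].
  apply: EP => t /itvccP tI; apply: He; apply: closeness.
  have mumI : 0 < mu < mu2 by rewrite mup.
  apply: (le_lt_trans (Hbnd mu t mumI tI).2); apply: Hm; by rewrite mup.
(* [Hbnd] bounds real and imaginary parts by [C]; the modulus costs the factor 2 of [Cnorm_le]. *)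
- exists (2 * C); apply/near_at_right0; exists mu2 => // mu mum t.
  rewrite in_itv/= => tI; have [H _] := Hbnd mu t mum tI.
  apply: Cmx_norm_le => [|j].
    by rewrite mulr_ge0//; exact: le_trans H.
  apply: Cnorm_le; apply: le_trans H.
    by rewrite -c2m0; exact: mx_entry_le.
  by rewrite -c2m1; exact: mx_entry_le.
- move=> t; rewrite in_itv/= => tI t0; have [m m0 Hm] := Hpt t tI t0.
  apply: (cvg_ballP (fun mu => vmu mu t) (m2c (v t))).2 => _ /gt0_ofreal[e e0 ->].
  have e40 : 0 < e / 4 by rewrite divr_gt0.
  have [m' m'0 Hm'] := small _ e40.
  apply/near_at_right0; exists (Num.min m m'); first by rewrite lt_min m0.
  move=> mu /andP[mup]; rewrite lt_min => /andP[mum mum'].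
  apply: closeness; apply: (le_lt_trans (Hm mu _)); first by rewrite mup.
  by apply: Hm'; rewrite mup.
- have [vlE vl0 z00 Hd Hs] := Hl; exists (fun t => m2c (vl t)); split.
    by move=> t; rewrite in_itv/= => tI; rewrite vlE.
  have NT : - T < 0 by rewrite oppr_lt0.
  split.
  + apply: csmooth_of_diffn => // j; apply: diffn_ext (Hs j).1 => t _; by rewrite m2cK.
  + apply: csmooth_of_diffn => // j; apply: diffn_ext (Hs j).2 => t _; by rewrite m2cK.
  + move=> t /itvccP tI; have [H1 H2] := Hd t tI; have tI' := (itvccP _ _ _).2 tI.
    split; apply/has_cderivP.
      rewrite c2mD c2m_mulmx !m2cK; apply: hder_ext H1 => // s _; by rewrite m2cK.
    rewrite c2m_cscale m2cK; apply: hder_ext H2 => // s _; by rewrite m2cK.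
  + by rewrite vl0 c2mK.
  + by rewrite z00 c2mK.
have [vrE vr0 z00 Hd Hs] := Hr; exists (fun t => m2c (vr t)); split.
  by move=> t; rewrite in_itv/= => tI; rewrite vrE.
split.
+ apply: csmooth_of_diffn => // j; apply: diffn_ext (Hs j).1 => t _; by rewrite m2cK.
+ apply: csmooth_of_diffn => // j; apply: diffn_ext (Hs j).2 => t _; by rewrite m2cK.
+ move=> t /itvccP tI; have [H1 H2] := Hd t tI; have tI' := (itvccP _ _ _).2 tI.
  split; apply/has_cderivP.
    rewrite c2mD c2m_mulmx !m2cK; apply: hder_ext H1 => // s _; by rewrite m2cK.
  rewrite c2m_cscale m2cK; apply: hder_ext H2 => // s _; by rewrite m2cK.
+ by rewrite vr0 -c2m_jump c2mK.
+ by rewrite z00 c2mK.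
Qed.
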